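(* Every closed predicate formula (formula of the language $L$) deducible in the calculus $\mathsf{MQC}$ is absolutely realizable.
   Context: **Computability.** $\{x\}$ is the unary partial recursive function with Gödel number $x$ (standard Kleene numbering, every natural number is a Gödel number); $!\{x\}(y)$ means that $\{x\}(y)$ is defined. $(a)_i$ is the exponent of the $i$-th prime $\pi_i$ ($\pi_0=2,\pi_1=3,\dots$) in the factorization of $a$ (with $(0)_i=0$). **Predicate formulas.** $L$ is the first-order language (connectives $\&,\lor,\to,\neg$, quantifiers $\forall,\exists$; no equality, function symbols or constants) whose predicate symbols are predicate variables $P^n_i$ ($n,i\in\mathbb N$; $P^n_i$ has arity $n$). $L^*$ adds an individual constant for every natural number. $\bot$ is also allowed as an atomic formula. $\Phi\leftrightarrow\Psi$ abbreviates $(\Phi\to\Psi)\,\&\,(\Psi\to\Phi)$. Write $Z,E,S,A,M$ for $P^1_0,P^2_0,P^2_1,P^3_0,P^3_1$; $P$ and $R$ denote a unary and a binary predicate variable different from these. **Realizability.** An $n$-ary generalized predicate is a function $\mathbb N^n\to 2^{\mathbb N}$. An interpretation $f$ is a partial map assigning an $n$-ary generalized predicate $f(P^n_i)$ to each $P^n_i$ in its domain; it is an interpretation of a formula if it is defined on all its predicate variables. For closed $L^*$-formulas the relation $e\,\mathsf r^f\,\Phi$ ($e\in\mathbb N$) is defined by: never $e\,\mathsf r^f\,\bot$; $e\,\mathsf r^f\,P^n_i(a_1,\dots,a_n)$ iff $e\in f(P^n_i)(a_1,\dots,a_n)$; $e\,\mathsf r^f(\Phi\,\&\,\Psi)$ iff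 $(e)_0\,\mathsf r^f\Phi$ and $(e)_1\,\mathsf r^f\Psi$; $e\,\mathsf r^f(\Phi\lor\Psi)$ iff $(e)_0=0$ and $(e)_1\,\mathsf r^f\Phi$, or $(e)_0=1$ and $(e)_1\,\mathsf r^f\Psi$; $e\,\mathsf r^f(\Phi\to\Psi)$ iff for all $a$, $a\,\mathsf r^f\Phi$ implies $!\{e\}(a)$ and $\{e\}(a)\,\mathsf r^f\Psi$; $e\,\mathsf r^f\neg\Phi$ iff $e\,\mathsf r^f(\Phi\to\bot)$; $e\,\mathsf r^f\exists x\,\Phi(x)$ iff $(e)_1\,\mathsf r^f\Phi((e)_0)$; $e\,\mathsf r^f\forall x\,\Phi(x)$ iff for all $a$, $!\{e\}(a)$ and $\{e\}(a)\,\mathsf r^f\Phi(a)$. A closed formula $\Phi$ is *absolutely realizable* if there is one number $e$ with $e\,\mathsf r^f\,\Phi$ for every interpretation $f$ of $\Phi$. **The formula $Q$.** Formulas built from $Z,E,S,A,M$ only are called $Ar$-formulas; in the standard model over $\mathbb N$ these symbols mean $x=0$, $x=y$, $x+1=y$, $x+y=z$, $x\cdot y=z$. $x\le y$ abbreviates $\exists z\,A(z,x,y)$. $\Delta_0$-formulas are built from atomic $Ar$-formulas by $\neg,\lor,\&,\to$ and bounded quantifiers $(\exists x\le t),(\forall x\le t)$ ($t\neq x$), i.e. $\exists x(x\le t\,\&\,\cdot)$, $\forall x(x\le t\to\cdot)$; $\Sigma$-formulas are built from $\Delta_0$-formulas by $\lor,\&$, bounded quantifiers and $\exists x$. $G(x,y,z)$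 is a fixed $\Sigma$-formula defining $\{x\}(y)=z$ in the standard model such that intuitionistic (Heyting) arithmetic $\mathsf{HA}$ proves $\forall x,y,z_1,z_2(G(x,y,z_1)\,\&\,G(x,y,z_2)\to z_1=z_2)$. $H(x,y)$ is $\exists z(Z(z)\,\&\,G(x,y,z))$. Let $\mathsf c(x,y)=\frac{(x+y)(x+y+1)}2+x$ be the pairing function with projections $\mathsf l,\mathsf r$ ($\mathsf c(\mathsf l(x),\mathsf r(x))=x$), $\mathsf l_*(x,0)=x$, $\mathsf l_*(x,y+1)=\mathsf l(\mathsf l_*(x,y))$, $\mathsf g(x,y)=\mathsf r(\mathsf l_*(x,y))$; $B(u,v)$ is the $Ar$-formula obtained from $\mathsf g(u,v)=1$ by the standard elimination of primitive recursive function symbols via $\Sigma$-formulas provably representing them in $\mathsf{HA}$. $Q$ is the conjunction of: $A_1$: $\forall x,y,z(S(x,z)\,\&\,S(y,z)\to E(x,y))$; $A_2$: $\forall x,y(S(x,y)\to\neg Z(y))$; $A_3$: $\forall x,y,z(E(x,y)\,\&\,E(x,z)\to E(y,z))$; $A_4$: $\forall x,y,z(E(x,y)\,\&\,S(x,z)\to S(y,z))$; $A_5$: $\forall x,y(Z(y)\to A(x,y,x))$; $A_6$: $\forall x,y,z,u,v(S(y,z)\,\&\,A(x,y,u)\,\&\,S(u,v)\to A(x,z,v))$; $A_7$: $\forall x,y(Z(y)\to M(x,y,y))$; $A_8$: $\forall x,y,z,u,v(S(y,z)\,\&\,M(x,y,u)\,\&\,A(u,x,v)\to M(x,z,v))$;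 $A_9$: $\forall x_1,x_2,y,z(E(x_1,x_2)\,\&\,A(x_1,y,z)\to A(x_2,y,z))$; $A_{10}$: $\forall x,y_1,y_2,z(E(y_1,y_2)\,\&\,A(x,y_1,z)\to A(x,y_2,z))$; $A_{11}$: $\forall x_1,x_2,y,z(E(x_1,x_2)\,\&\,M(x_1,y,z)\to M(x_2,y,z))$; $A_{12}$: $\forall x,y_1,y_2,z(E(y_1,y_2)\,\&\,M(x,y_1,z)\to M(x,y_2,z))$; $A_{13}$: $\forall x(Z(x)\lor\exists y\,S(y,x))$; $A_{14}$: $\exists x\,Z(x)$; $A_{15}$: $\forall x,y(Z(x)\,\&\,Z(y)\to E(x,y))$; $A_{16}$: $\forall x,y(E(x,y)\,\&\,Z(x)\to Z(y))$; $A_{17}$: $\forall x\exists y\,S(x,y)$; $A_{18}$: $\forall x,y,z(S(x,y)\,\&\,S(x,z)\to E(y,z))$; $A_{19}$: $\forall x,y,z(S(x,y)\,\&\,E(y,z)\to S(x,z))$; $A_{20}$: $\forall x,y\exists z\,A(x,y,z)$; $A_{21}$: $\forall x,y,z_1,z_2(A(x,y,z_1)\,\&\,A(x,y,z_2)\to E(z_1,z_2))$; $A_{22}$: $\forall x,y,z_1,z_2(A(x,y,z_1)\,\&\,E(z_1,z_2)\to A(x,y,z_2))$; $A_{23}$: $\forall x,y\exists z\,M(x,y,z)$; $A_{24}$: $\forall x,y,z_1,z_2(M(x,y,z_1)\,\&\,M(x,y,z_2)\to E(z_1,z_2))$; $A_{25}$: $\forall x,y,z_1,z_2(M(x,y,z_1)\,\&\,E(z_1,z_2)\to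 M(x,y,z_2))$; $A_{26}$: $\forall x,y,z_1,z_2(G(x,y,z_1)\,\&\,G(x,y,z_2)\to E(z_1,z_2))$; $A_{27}$: $\forall y,z\,\neg\neg\exists v\forall x(x\le z\to(B(v,x)\leftrightarrow H(y,x)))$; $A_{28}$: $\forall x\forall y(B(x,y)\lor\neg B(x,y))$. **The calculus $\mathsf{MQC}$.** The equality axiom for an $n$-ary $P'$ is $\forall\vec x\forall\vec y(E(x_1,y_1)\,\&\dots\&\,E(x_n,y_n)\to(P'(\vec x)\to P'(\vec y)))$; $Eq(E,P_1,\dots,P_m)$ is the conjunction of the equality axioms for $P_1,\dots,P_m$. $M$ (Markov principle) is the formula $\forall x(P(x)\lor\neg P(x))\,\&\,\neg\neg\exists x\,P(x)\to\exists x\,P(x)$. $nCT$ is $\forall x(\neg P(x)\to\exists y\,R(x,y))\to\exists z\forall x(\neg P(x)\to\exists y(G(z,x,y)\,\&\,R(x,y)))$, and $nCT^*$ is the predicate formula $Q\,\&\,Eq(E,P,R)\to nCT$, in which $Z,E,S,A,M$ are treated as predicate variables. A substitutional instance of a formula is obtained by replacing its predicate variables (including $Z,E,S,A,M$) by formulas: each atomic subformula $P_i(v_1,\dots,v_k)$ is replaced by $\Psi_i$ with $v_1,\dots,v_k$ simultaneously substituted for the designated variables $x_1,\dots,x_k$, provided no variable capture occurs. $\mathsf{MQC}$ is the intuitionistic predicate calculus $\mathsf{IQC}$ in the language $L$ with all substitutional instances (by $L$-formulas) of $M$ and $nCT^*$ added as axioms. *)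

(* Defs.v *)
From HB Require Import structures.
From mathcomp Require Import all_boot zify.

Set Implicit Arguments.
Unset Strict Implicit.
Unset Printing Implicit Defensive.

(** * Partial recursive functions and their Goedel numbers *)

(* The pairing function c. *)
Definition cpair (x y : nat) : nat := ((x + y) * (x + y + 1)) %/ 2 + x.

(* Codes are not indexed by an arity: [Proj i] projects on the [i]-th argument
   (from 0), and arguments that are missing from the list read as 0. *)
Inductive code : Type :=
| Zero
| Succ
| Proj of nat
| Comp of code & seq code
| Prec of code & code
| Mu of code.

(* [eval c v z]: the function coded by [c] is defined on the argument list [v]
   and its value is [z]. *)
Inductive eval : code -> seq nat -> nat -> Prop :=
| eval_zero v : eval Zero v 0
| eval_succ v : eval Succ v (nth 0 v 0).+1
| eval_proj i v : eval (Proj i) v (nth 0 v i)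
| eval_comp f gs v ws z :
    size ws = size gs ->
    (forall i, i < size gs -> eval (nth Zero gs i) v (nth 0 ws i)) ->
    eval f ws z -> eval (Comp f gs) v z
| eval_prec0 f g v z :
    eval f v z -> eval (Prec f g) (0 :: v) z
| eval_precS f g n v y z :
    eval (Prec f g) (n :: v) y -> eval g [:: n, y & v] z ->
    eval (Prec f g) (n.+1 :: v) z
| eval_mu f v n (w : nat -> nat) :
    (forall m, m < n -> eval f (m :: v) (w m).+1) ->
    eval f (n :: v) 0 -> eval (Mu f) v n.

Definition seqnum (s : seq nat) : nat := foldr (fun a n => (cpair a n).+1) 0 s.

Fixpoint gnum (c : code) : nat :=
  match c with
  | Zero => 0
  | Succ => 1
  | Proj i => 4 * i + 2
  | Comp f gs => 4 * cpair (gnum f) (seqnum (map gnum gs)) + 3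
  | Prec f g => 4 * cpair (gnum f) (gnum g) + 4
  | Mu f => 4 * gnum f + 5
  end.

(* [kleene x y z] is {x}(y) = z. *)
Definition kleene (x y z : nat) : Prop :=
  exists c : code, gnum c = x /\ eval c [:: y] z.

Lemma eval_fun c v z z' : eval c v z -> eval c v z' -> z = z'.
Proof.
move=> H; elim: H z' => {c v z}.
- by move=> v z' H; inversion H.
- by move=> v z' H; inversion H.
- by move=> i v z' H; inversion H.
- move=> f gs v ws z sz _ IH _ IHf z' H; inversion H; subst.
  apply: IHf; suff -> : ws = ws0 by [].
  apply: (@eq_from_nth _ 0); first by rewrite sz.
  by move=> i; rewrite sz => lti; apply: IH => //; auto.
- by move=> f g v z _ IH z' H; inversion H; subst; apply: IH.
- move=> f g n v y z _ IH1 _ IH2 z' H; inversion H; subst.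
  apply: IH2; suff -> : y = y0 by [].
  exact: IH1.
- move=> f v n w _ IHw _ IH z' H; inversion H; subst.
  have [lt1|lt1|//] := ltngtP n z'.
  + by have := IH _ (H1 _ lt1).
  + by have := IHw _ lt1 _ H2.
Qed.

Lemma cpair_diag s x : x <= s -> cpair x (s - x) = 'C(s.+1, 2) + x.
Proof. by move=> le; rewrite /cpair subnKC // bin2 -divn2 addn1 mulnC. Qed.

Lemma cpairE x y : cpair x y = 'C((x + y).+1, 2) + x.
Proof. by rewrite -cpair_diag ?leq_addr // addKn. Qed.

Lemma bin2S s : 'C(s.+1, 2) = 'C(s, 2) + s.
Proof. by rewrite binS bin1. Qed.

Lemma cpair_surj n : exists x y, cpair x y = n.
Proof.
elim: n => [|n [x [y <-]]]; first by exists 0, 0.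
case: y => [|y].
  by exists 0, x.+1; rewrite !cpairE add0n !addn0 (bin2S x.+1) addnS.
by exists x.+1, y; rewrite !cpairE addSnnS; lia.
Qed.

Lemma cpair_inj x y x' y' : cpair x y = cpair x' y' -> x = x' /\ y = y'.
Proof.
have L s t : s < t -> 'C(s.+1, 2) + s < 'C(t.+1, 2).
  move=> lt; have : 'C(s.+2, 2) <= 'C(t.+1, 2) by apply: leq_bin2l.
  by rewrite (bin2S s.+1); lia.
rewrite !cpairE; have [lt1|lt1|e] := ltngtP (x + y) (x' + y').
- by have := L _ _ lt1; lia.
- by have := L _ _ lt1; lia.
- by rewrite e; lia.
Qed.

Lemma leq_cpair x y : x <= cpair x y /\ y <= cpair x y.
Proof. by rewrite cpairE bin2S; lia. Qed.

(* Every natural number is the Goedel number of exactly one code. *)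
Lemma gnum_surj n : exists c, gnum c = n.
Proof.
have [m] := ubnP n; elim: m n => // m IH n lt.
have IHs k : k < m -> exists gs, seqnum (map gnum gs) = k.
  elim/ltn_ind: k => -[|k] IHk ltk; first by exists [::].
  have [a [b ab]] := cpair_surj k; have [la lb] := leq_cpair a b.
  have [|c cE] := IH a; first by lia.
  have [||gs gsE] := IHk b; [by lia | by lia |].
  by exists (c :: gs); rewrite /= cE gsE ab.
case: n lt => [|[|n]] lt; [by exists Zero | by exists Succ |].
have nE := divn_eq n 4; have := ltn_pmod n (isT : 0 < 4).
have [a [b ab]] := cpair_surj (n %/ 4); have [la lb] := leq_cpair a b.
case: (n %% 4) nE => [|[|[|[|//]]]] nE _.
- by exists (Proj (n %/ 4)) => /=; lia.
- have [|c cE] := IH a; first by lia.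
  have [|gs gsE] := IHs b; first by lia.
  by exists (Comp c gs); rewrite /= cE gsE ab; lia.
- have [|c cE] := IH a; first by lia.
  have [|d dE] := IH b; first by lia.
  by exists (Prec c d); rewrite /= cE dE ab; lia.
- have [|c cE] := IH (n %/ 4); first by lia.
  by exists (Mu c); rewrite /= cE; lia.
Qed.

Lemma gnum_inj : injective gnum.
Proof.
move=> c d; have [m] := ubnP (gnum c); elim: m c d => // m IH c d lt.
have IHs s t : seqnum (map gnum s) < m ->
    seqnum (map gnum s) = seqnum (map gnum t) -> s = t.
  elim: s t => [|a s IHt] [|b t] //=; set k := seqnum _ => lts [].
  move=> /cpair_inj[ab st]; have [la ls] := leq_cpair (gnum a) k.
  have -> : a = b by apply: IH; [lia | exact: ab].
  by have -> : s = t by apply: IHt; [lia | exact: st].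
case: c d lt => [||i|f gs|f g|f] [||j|f' gs'|f' g'|f'] //=; try lia.
- by move=> _ ?; congr Proj; lia.
- have [l1 l2] := leq_cpair (gnum f) (seqnum (map gnum gs)) => lt e.
  have /cpair_inj[e1 e2] : cpair (gnum f) (seqnum (map gnum gs)) =
    cpair (gnum f') (seqnum (map gnum gs')) by lia.
  have -> : f = f' by apply: IH; [lia | exact: e1].
  by have -> : gs = gs' by apply: IHs; [lia | exact: e2].
- have [l1 l2] := leq_cpair (gnum f) (gnum g) => lt e.
  have /cpair_inj[e1 e2] :
    cpair (gnum f) (gnum g) = cpair (gnum f') (gnum g') by lia.
  have -> : f = f' by apply: IH; [lia | exact: e1].
  by have -> : g = g' by apply: IH; [lia | exact: e2].
- by move=> lt e; have -> : f = f' by apply: IH; lia.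
Qed.

Lemma kleene_fun x y z z' : kleene x y z -> kleene x y z' -> z = z'.
Proof. by move=> [c [<- H]] [d [/gnum_inj -> H']]; apply: eval_fun H H'. Qed.

(** * Predicate formulas *)

(* Individual variables are natural numbers; [Atom n i v] is P^n_i(v). *)
Inductive form : Type :=
| Bot
| Atom n (i : nat) (v : n.-tuple nat)
| And of form & form
| Or of form & form
| Imp of form & form
| Neg of form
| All of nat & form
| Ex of nat & form.

Definition Iff (F G : form) : form := And (Imp F G) (Imp G F).
Definition Alls (xs : seq nat) (F : form) : form := foldr All F xs.
Definition Exs (xs : seq nat) (F : form) : form := foldr Ex F xs.
Fixpoint Ands (F : form) (Fs : seq form) : form :=
  if Fs is G :: Gs then And F (Ands G Gs) else F.

Fixpoint fv (F : form) : seq nat :=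
  match F with
  | Bot => [::]
  | Atom _ _ v => v
  | And F G | Or F G | Imp F G => fv F ++ fv G
  | Neg F => fv F
  | All x F | Ex x F => [seq y <- fv F | y != x]
  end.

Definition closed_form (F : form) : bool := nilp (fv F).

(* The predicate variables of a formula: (n, i) stands for P^n_i. *)
Fixpoint preds (F : form) : seq (nat * nat) :=
  match F with
  | Bot => [::]
  | Atom n i _ => [:: (n, i)]
  | And F G | Or F G | Imp F G => preds F ++ preds G
  | Neg F | All _ F | Ex _ F => preds F
  end.

Definition upd (s : nat -> nat) (x a : nat) : nat -> nat :=
  fun y => if y == x then a else s y.

Definition fresh (s : seq nat) : nat := (foldr maxn 0 s).+1.

(* [bvar s x F] is the bound variable used for the binder [x] when [s] is
   substituted in a quantified formula with body [F]: [x] itself unless it would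
   capture a substituted variable. *)
Definition bvar (s : nat -> nat) (x : nat) (F : form) : nat :=
  let im := [seq s y | y <- fv F & y != x] in
  if x \in im then fresh im else x.

(* Simultaneous substitution of variables for the free variables. *)
Fixpoint ren (s : nat -> nat) (F : form) : form :=
  match F with
  | Bot => Bot
  | Atom _ i v => Atom i (map_tuple s v)
  | And F G => And (ren s F) (ren s G)
  | Or F G => Or (ren s F) (ren s G)
  | Imp F G => Imp (ren s F) (ren s G)
  | Neg F => Neg (ren s F)
  | All x F => let x' := bvar s x F in All x' (ren (upd s x x') F)
  | Ex x F => let x' := bvar s x F in Ex x' (ren (upd s x x') F)
  end.

(* The substitution [s] in [F] causes no capture (so [ren s F] renames no bound
   variable). *)
Fixpoint free_for (s : nat -> nat) (F : form) : bool :=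
  match F with
  | Bot | Atom _ _ _ => true
  | And F G | Or F G | Imp F G => free_for s F && free_for s G
  | Neg F => free_for s F
  | All x F | Ex x F =>
      (x \notin [seq s y | y <- fv F & y != x]) && free_for (upd s x x) F
  end.

(* [subst1 F x y] is F[y/x]. *)
Definition subst1 (F : form) (x y : nat) : form := ren (upd id x y) F.

(* [app F [:: a; b; c]] is F(a, b, c), for a formula whose designated variables
   are the variables 0, 1, 2. *)
Definition app (F : form) (s : seq nat) : form := ren (nth 0 s) F.

(** ** Substitutional instances *)

(* [psubst n i = (xs, Psi)]: P^n_i is to be replaced by [Psi] with the designated
   variables [xs]. Other free variables of [Psi] are parameters. *)
Definition psubst : Type := forall n : nat, nat -> n.-tuple nat * form.

Definition desig n (xs vs : n.-tuple nat) : nat -> nat :=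
  fun y => if y \in xs then nth 0 vs (index y xs) else y.

Definition params (T : psubst) (p : nat * nat) : seq nat :=
  [seq y <- fv (T p.1 p.2).2 | y \notin (T p.1 p.2).1].

Fixpoint psub (T : psubst) (F : form) : form :=
  match F with
  | Bot => Bot
  | Atom n i v => ren (desig (T n i).1 v) (T n i).2
  | And F G => And (psub T F) (psub T G)
  | Or F G => Or (psub T F) (psub T G)
  | Imp F G => Imp (psub T F) (psub T G)
  | Neg F => Neg (psub T F)
  | All x F => All x (psub T F)
  | Ex x F => Ex x (psub T F)
  end.

(* No capture: neither of the substituted arguments by the quantifiers of a
   substituted formula, nor of its parameters by the quantifiers of [F]. *)
Fixpoint psub_ok (T : psubst) (F : form) : bool :=
  match F with
  | Bot => true
  | Atom n i v => free_for (desig (T n i).1 v) (T n i).2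
  | And F G | Or F G | Imp F G => psub_ok T F && psub_ok T G
  | Neg F => psub_ok T F
  | All x F | Ex x F =>
      all (fun p => x \notin params T p) (preds F) && psub_ok T F
  end.

Definition instance (F F' : form) : Prop :=
  exists T : psubst,
    [/\ forall n i, uniq (T n i).1, psub_ok T F & F' = psub T F].

(** ** Intuitionistic predicate calculus *)

(* [IQC Ax F]: [F] is deducible in the intuitionistic predicate calculus with the
   additional axioms [Ax] (Kleene's Hilbert-style calculus, with the axiom
   [iqc_bot] for the constant [Bot]). The terms of L are its variables. *)
Inductive IQC (Ax : form -> Prop) : form -> Prop :=
| iqc_ax F : Ax F -> IQC Ax F
| iqc_K F G : IQC Ax (Imp F (Imp G F))
| iqc_S F G H :
    IQC Ax (Imp (Imp F G) (Imp (Imp F (Imp G H)) (Imp F H)))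
| iqc_andI F G : IQC Ax (Imp F (Imp G (And F G)))
| iqc_andE1 F G : IQC Ax (Imp (And F G) F)
| iqc_andE2 F G : IQC Ax (Imp (And F G) G)
| iqc_orI1 F G : IQC Ax (Imp F (Or F G))
| iqc_orI2 F G : IQC Ax (Imp G (Or F G))
| iqc_orE F G H :
    IQC Ax (Imp (Imp F H) (Imp (Imp G H) (Imp (Or F G) H)))
| iqc_negI F G : IQC Ax (Imp (Imp F G) (Imp (Imp F (Neg G)) (Neg F)))
| iqc_negE F G : IQC Ax (Imp (Neg F) (Imp F G))
| iqc_bot F : IQC Ax (Imp Bot F)
| iqc_allE F x y :
    free_for (upd id x y) F -> IQC Ax (Imp (All x F) (subst1 F x y))
| iqc_exI F x y :
    free_for (upd id x y) F -> IQC Ax (Imp (subst1 F x y) (Ex x F))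
| iqc_mp F G : IQC Ax F -> IQC Ax (Imp F G) -> IQC Ax G
| iqc_allI F G x :
    x \notin fv G -> IQC Ax (Imp G F) -> IQC Ax (Imp G (All x F))
| iqc_exE F G x :
    x \notin fv G -> IQC Ax (Imp F G) -> IQC Ax (Imp (Ex x F) G).

(** * Realizability *)

(* An n-ary generalized predicate N^n -> 2^N. *)
Definition gpred (n : nat) : Type := n.-tuple nat -> nat -> Prop.

Definition interp : Type := forall n : nat, nat -> option (gpred n).

Definition interp_of (f : interp) (F : form) : Prop :=
  forall n i, (n, i) \in preds F -> isSome (f n i).

(* (e)_0 and (e)_1: the exponents of 2 and 3, equal to 0 when e = 0. *)
Definition pr0 (e : nat) : nat := logn 2 e.
Definition pr1 (e : nat) : nat := logn 3 e.

(* The closed formula of L^* obtained from a formula of L by replacing its free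
   variables with constants is represented by the formula of L together with an
   assignment [r] of numbers to variables. *)
Fixpoint realizes (f : interp) (F : form) (r : nat -> nat) (e : nat) : Prop :=
  match F with
  | Bot => False
  | Atom n i v => if f n i is Some p then p (map_tuple r v) e else False
  | And F G => realizes f F r (pr0 e) /\ realizes f G r (pr1 e)
  | Or F G => pr0 e = 0 /\ realizes f F r (pr1 e) \/
              pr0 e = 1 /\ realizes f G r (pr1 e)
  | Imp F G => forall a, realizes f F r a ->
                 exists b, kleene e a b /\ realizes f G r b
  | Neg F => forall a, realizes f F r a -> exists b, kleene e a b /\ False
  | All x F => forall a, exists b, kleene e a b /\ realizes f F (upd r x a) b
  | Ex x F => realizes f F (upd r x (pr0 e)) (pr1 e)
  end.

Definition absolutely_realizable (F : form) : Prop :=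
  exists e : nat, forall (f : interp) (r : nat -> nat),
    interp_of f F -> realizes f F r e.

(** * Arithmetic formulas *)

Definition fZ x : form := @Atom 1 0 [tuple x].
Definition fE x y : form := @Atom 2 0 [tuple x; y].
Definition fS x y : form := @Atom 2 1 [tuple x; y].
Definition fA x y z : form := @Atom 3 0 [tuple x; y; z].
Definition fM x y z : form := @Atom 3 1 [tuple x; y; z].
Definition fP x : form := @Atom 1 1 [tuple x].
Definition fR x y : form := @Atom 2 2 [tuple x; y].

Definition Ar_preds : seq (nat * nat) :=
  [:: (1, 0); (2, 0); (2, 1); (3, 0); (3, 1)].

Definition Ar_form (F : form) : bool := all (mem Ar_preds) (preds F).

Definition std_atom (n i : nat) (s : seq nat) : Prop :=
  match n, i, s with
  | 1, 0, [:: a] => a = 0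
  | 2, 0, [:: a; b] => a = b
  | 2, 1, [:: a; b] => a + 1 = b
  | 3, 0, [:: a; b; c] => a + b = c
  | 3, 1, [:: a; b; c] => a * b = c
  | _, _, _ => False
  end.

(* Truth in the standard model, under the assignment [r]. *)
Fixpoint sat (F : form) (r : nat -> nat) : Prop :=
  match F with
  | Bot => False
  | Atom n i v => std_atom n i (map r v)
  | And F G => sat F r /\ sat G r
  | Or F G => sat F r \/ sat G r
  | Imp F G => sat F r -> sat G r
  | Neg F => ~ sat F r
  | All x F => forall a, sat F (upd r x a)
  | Ex x F => exists a, sat F (upd r x a)
  end.

(* x <= t, with [z] as the bound variable of the abbreviation. *)
Definition fLe z x t : form := Ex z (fA z x t).
Definition Le x t : form := fLe (fresh [:: x; t]) x t.

Definition bAll x t z (F : form) : form := All x (Imp (fLe z x t) F).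
Definition bEx x t z (F : form) : form := Ex x (And (fLe z x t) F).

Inductive Delta0 : form -> Prop :=
| delta_bot : Delta0 Bot
| delta_atom n i (v : n.-tuple nat) : (n, i) \in Ar_preds -> Delta0 (Atom i v)
| delta_neg F : Delta0 F -> Delta0 (Neg F)
| delta_or F G : Delta0 F -> Delta0 G -> Delta0 (Or F G)
| delta_and F G : Delta0 F -> Delta0 G -> Delta0 (And F G)
| delta_imp F G : Delta0 F -> Delta0 G -> Delta0 (Imp F G)
| delta_bex x t z F : t != x -> z \notin [:: x; t] ->
    Delta0 F -> Delta0 (bEx x t z F)
| delta_ball x t z F : t != x -> z \notin [:: x; t] ->
    Delta0 F -> Delta0 (bAll x t z F).

Inductive Sigma : form -> Prop :=
| sigma_delta F : Delta0 F -> Sigma F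
| sigma_or F G : Sigma F -> Sigma G -> Sigma (Or F G)
| sigma_and F G : Sigma F -> Sigma G -> Sigma (And F G)
| sigma_bex x t z F : t != x -> z \notin [:: x; t] ->
    Sigma F -> Sigma (bEx x t z F)
| sigma_ball x t z F : t != x -> z \notin [:: x; t] ->
    Sigma F -> Sigma (bAll x t z F)
| sigma_ex x F : Sigma F -> Sigma (Ex x F).

Local Notation vx := 0 (only parsing).
Local Notation vy := 1 (only parsing).
Local Notation vz := 2 (only parsing).
Local Notation vu := 3 (only parsing).
Local Notation vv := 4 (only parsing).
Local Notation vx1 := 5 (only parsing).
Local Notation vx2 := 6 (only parsing).
Local Notation vy1 := 7 (only parsing).
Local Notation vy2 := 8 (only parsing).
Local Notation vz1 := 9 (only parsing).
Local Notation vz2 := 10 (only parsing).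
Local Notation vt := 11 (only parsing).
Local Notation vw := 12 (only parsing).

Definition A1 := Alls [:: vx; vy; vz]
  (Imp (And (fS vx vz) (fS vy vz)) (fE vx vy)).
Definition A2 := Alls [:: vx; vy] (Imp (fS vx vy) (Neg (fZ vy))).
Definition A3 := Alls [:: vx; vy; vz]
  (Imp (And (fE vx vy) (fE vx vz)) (fE vy vz)).
Definition A4 := Alls [:: vx; vy; vz]
  (Imp (And (fE vx vy) (fS vx vz)) (fS vy vz)).
Definition A5 := Alls [:: vx; vy] (Imp (fZ vy) (fA vx vy vx)).
Definition A6 := Alls [:: vx; vy; vz; vu; vv]
  (Imp (Ands (fS vy vz) [:: fA vx vy vu; fS vu vv]) (fA vx vz vv)).
Definition A7 := Alls [:: vx; vy] (Imp (fZ vy) (fM vx vy vy)).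
Definition A8 := Alls [:: vx; vy; vz; vu; vv]
  (Imp (Ands (fS vy vz) [:: fM vx vy vu; fA vu vx vv]) (fM vx vz vv)).
Definition A9 := Alls [:: vx1; vx2; vy; vz]
  (Imp (And (fE vx1 vx2) (fA vx1 vy vz)) (fA vx2 vy vz)).
Definition A10 := Alls [:: vx; vy1; vy2; vz]
  (Imp (And (fE vy1 vy2) (fA vx vy1 vz)) (fA vx vy2 vz)).
Definition A11 := Alls [:: vx1; vx2; vy; vz]
  (Imp (And (fE vx1 vx2) (fM vx1 vy vz)) (fM vx2 vy vz)).
Definition A12 := Alls [:: vx; vy1; vy2; vz]
  (Imp (And (fE vy1 vy2) (fM vx vy1 vz)) (fM vx vy2 vz)).
Definition A13 := All vx (Or (fZ vx) (Ex vy (fS vy vx))).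
Definition A14 := Ex vx (fZ vx).
Definition A15 := Alls [:: vx; vy] (Imp (And (fZ vx) (fZ vy)) (fE vx vy)).
Definition A16 := Alls [:: vx; vy] (Imp (And (fE vx vy) (fZ vx)) (fZ vy)).
Definition A17 := All vx (Ex vy (fS vx vy)).
Definition A18 := Alls [:: vx; vy; vz]
  (Imp (And (fS vx vy) (fS vx vz)) (fE vy vz)).
Definition A19 := Alls [:: vx; vy; vz]
  (Imp (And (fS vx vy) (fE vy vz)) (fS vx vz)).
Definition A20 := Alls [:: vx; vy] (Ex vz (fA vx vy vz)).
Definition A21 := Alls [:: vx; vy; vz1; vz2]
  (Imp (And (fA vx vy vz1) (fA vx vy vz2)) (fE vz1 vz2)).
Definition A22 := Alls [:: vx; vy; vz1; vz2]
  (Imp (And (fA vx vy vz1) (fE vz1 vz2)) (fA vx vy vz2)).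
Definition A23 := Alls [:: vx; vy] (Ex vz (fM vx vy vz)).
Definition A24 := Alls [:: vx; vy; vz1; vz2]
  (Imp (And (fM vx vy vz1) (fM vx vy vz2)) (fE vz1 vz2)).
Definition A25 := Alls [:: vx; vy; vz1; vz2]
  (Imp (And (fM vx vy vz1) (fE vz1 vz2)) (fM vx vy vz2)).
Definition A26 (G : form) := Alls [:: vx; vy; vz1; vz2]
  (Imp (And (app G [:: vx; vy; vz1]) (app G [:: vx; vy; vz2])) (fE vz1 vz2)).

(** ** Heyting arithmetic *)

Definition arith_axioms : seq form :=
  [:: A2; A3; A4; A5; A6; A7; A8; A9; A10; A11; A12; A13; A14; A15; A16; A17;
      A18; A19; A20; A21; A22; A23; A24; A25].

Definition induction (F : form) (x y : nat) : form :=
  Imp (And (All x (Imp (fZ x) F))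
           (Alls [:: x; y] (Imp (And F (fS x y)) (subst1 F x y))))
      (All x F).

(* Heyting arithmetic in the relational language Z, E, S, A, M: the graphs of
   the successor, addition and multiplication are total and functional, E is
   equality, and the induction scheme holds for all Ar-formulas. *)
Inductive HA_axiom : form -> Prop :=
| ha_basic F : List.In F (A1 :: arith_axioms) -> HA_axiom F
| ha_ind F x y : Ar_form F -> y != x -> y \notin fv F ->
    HA_axiom (induction F x y).

Definition HA : form -> Prop := IQC HA_axiom.

(** ** The formulas G and B *)

(* [G] has the designated variables 0, 1, 2. *)
Definition graph_formula (G : form) : Prop :=
  [/\ Sigma G, {subset fv G <= [:: vx; vy; vz]},
      forall a b c, sat G (nth 0 [:: a; b; c]) <-> kleene a b c
    & HA (A26 G)].

(* [F] is a Sigma-formula in the variables 0, ..., k that HA proves to be the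
   graph of a total function of k arguments. *)
Definition HA_function (k : nat) (F : form) : Prop :=
  let xs := iota 0 k in
  [/\ Sigma F, {subset fv F <= iota 0 k.+1},
      HA (Alls xs (Ex k F))
    & HA (Alls (xs ++ [:: k; k.+1])
           (Imp (And F (app F (rcons xs k.+1))) (fE k k.+1)))].

(* c(x, y) = z, i.e. (x + y) * (x + y + 1) + (x + x) = z + z. *)
Definition fC x y z : form :=
  let m := fresh [:: x; y; z] in
  Exs (iota m 5)
    (Ands (fA x y m)
       [:: fS m m.+1; fM m m.+1 m.+2; fA x x m.+3; fA m.+2 m.+3 m.+4;
           fA z z m.+4]).

(* [L x y], [R x y], [Ls x y z] represent l(x) = y, r(x) = y, l_*(x, y) = z:
   HA proves the defining equations c(l(x), r(x)) = x, l_*(x, 0) = x and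
   l_*(x, y + 1) = l(l_*(x, y)). *)
Definition projections_formulas (L R Ls : form) : Prop :=
  [/\ HA_function 1 L, HA_function 1 R, HA_function 2 Ls,
      HA (Alls [:: vx; vy; vz]
            (Imp (And (app L [:: vx; vy]) (app R [:: vx; vz]))
                 (fC vy vz vx)))
    & HA (Alls [:: vx; vz] (Imp (fZ vz) (app Ls [:: vx; vz; vx]))) /\
      HA (Alls [:: vx; vy; vz; vt; vw]
            (Imp (Ands (fS vy vz) [:: app Ls [:: vx; vy; vt]; app L [:: vt; vw]])
                 (app Ls [:: vx; vz; vw])))].

(* r(l_*(u, v)) = 1, for the designated variables u = 0 and v = 1. *)
Definition B_formula (R Ls : form) : form :=
  Exs [:: vt; vw; vz]
    (Ands (app Ls [:: 0; 1; vt]) [:: app R [:: vt; vw]; fZ vz; fS vz vw]).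

(** * The calculus MQC *)

Definition Hf (G : form) x y : form :=
  let z := fresh [:: x; y] in Ex z (And (fZ z) (app G [:: x; y; z])).

Definition A27 (G B : form) := Alls [:: vy; vz]
  (Neg (Neg (Ex vv (All vx
    (Imp (Le vx vz) (Iff (app B [:: vv; vx]) (Hf G vy vx))))))).
Definition A28 (B : form) := Alls [:: vx; vy]
  (Or (app B [:: vx; vy]) (Neg (app B [:: vx; vy]))).

Definition Q (G B : form) : form :=
  Ands A1 (arith_axioms ++ [:: A26 G; A27 G B; A28 B]).

(* The conjunction of the equality axioms for P and R. *)
Definition EqPR : form :=
  And (Alls [:: vx; vy] (Imp (fE vx vy) (Imp (fP vx) (fP vy))))
      (Alls [:: vx1; vx2; vy1; vy2]
         (Imp (And (fE vx1 vy1) (fE vx2 vy2)) (Imp (fR vx1 vx2) (fR vy1 vy2)))).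

Definition Markov : form :=
  Imp (And (All vx (Or (fP vx) (Neg (fP vx)))) (Neg (Neg (Ex vx (fP vx)))))
      (Ex vx (fP vx)).

Definition nCT (G : form) : form :=
  Imp (All vx (Imp (Neg (fP vx)) (Ex vy (fR vx vy))))
      (Ex vz (All vx (Imp (Neg (fP vx))
         (Ex vy (And (app G [:: vz; vx; vy]) (fR vx vy)))))).

Definition nCTstar (G B : form) : form := Imp (And (Q G B) EqPR) (nCT G).

Definition MQC (G B : form) : form -> Prop :=
  IQC (fun F => instance Markov F \/ instance (nCTstar G B) F).

(* Main.v *)
Require Import Defs.
From mathcomp Require Import all_boot zify.
From Stdlib Require Import Classical ClassicalEpsilon.

(** Realizability is sound for intuitionistic predicate logic, uniformly in the
interpretation: a deduction of F gives a code that computes, from the values of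
the free variables, a number realizing F under every interpretation
([iqc_sound]). Replacing predicate variables by formulas only changes the
interpretation ([realizes_psub]), so for the substitutional instances of an
axiom it is enough to realize the axiom itself by one number under all
interpretations.

For the Markov principle the number searches for the first x at which the
realizer of the decidability of P answers yes; since realizability of a
negation is a classical statement, the search ends ([markov_realized]).

For nCT* suppose that q realizes Q. The interpretation is then a structure on
the natural numbers in which an atom counts as true if it has a realizer, and q
computes zero, successors, predecessors, sums and products in it. The elements
obtained from zero by successors are its numerals [nu q n], and an element is
standard if it is equal to a numeral; the index of a standard element is
computable. On standard elements true Delta0-sentences are decided and realized
by computation, and hence true Sigma-sentences are realized by search
([delta_decides], [sigma_code]). In particular {k}(n) = l makes the formula G
realizable at elements of indices k, n, l, with a computable realizer
([graph_code]).

The point of the axioms A27 and A28 is that every element is standard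
([all_std]). This is the argument of Tennenbaum. A nonstandard element is above
all numerals, so by A27 some v codes, at all numerals at once, the set of the n
with {d}(n) = 0, where {d}(n) = {n}(n). By A28 the set coded by v is decided by
a total recursive function D, taking the value 1 on the set and 0 off it. At
the Goedel number e of D one has {d}(e) = {e}(e) = D(e), and D(e) = 1 and
D(e) = 0 both contradict the choice of the set coded by v.

The structure is thus computably isomorphic to the natural numbers, and the
classical realization of Church's thesis transfers: from a realizer of the
premise of nCT one reads off a Goedel number k of the partial function that
maps n to the index of the value chosen for the n-th numeral, and the numeral
of k witnesses the conclusion ([nCTstar_realized]). *)

Set Implicit Arguments.
Unset Strict Implicit.
Unset Printing Implicit Defensive.

(** * Recursive functions *)

(** A sigma type rather than a proposition: codes built from such proofs are
called by other codes below. *)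
Definition recursive (F : seq nat -> nat) := {c : code | forall v, eval c v (F v)}.

Lemma rec_ext F F' : F =1 F' -> recursive F -> recursive F'.
Proof. by move=> e [c cP]; exists c => v; rewrite -e. Qed.

Lemma rec_nth i : recursive (fun v => nth 0 v i).
Proof. by exists (Proj i) => v; constructor. Qed.

Fixpoint numeral (a : nat) : code :=
  if a is b.+1 then Comp Succ [:: numeral b] else Zero.

Lemma eval_numeral a v : eval (numeral a) v a.
Proof.
elim: a => [|a IH]; first exact: eval_zero.
by apply: (@eval_comp _ _ _ [:: a]) => [//|[]//|]; apply: (eval_succ [:: a]).
Qed.

Lemma rec_const a : recursive (fun=> a).
Proof. by exists (numeral a) => v; apply: eval_numeral. Qed.

Lemma eval_comp1 c c1 v x z :
  eval c1 v x -> eval c [:: x] z -> eval (Comp c [:: c1]) v z.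
Proof. by move=> e1; apply: eval_comp => // -[]. Qed.

Lemma eval_comp2 c c1 c2 v x y z :
  eval c1 v x -> eval c2 v y -> eval c [:: x; y] z ->
  eval (Comp c [:: c1; c2]) v z.
Proof. by move=> e1 e2; apply: eval_comp => // -[|[]]. Qed.

Definition recursive1 (f : nat -> nat) := recursive (fun v => f (nth 0 v 0)).
Definition recursive2 (f : nat -> nat -> nat) :=
  recursive (fun v => f (nth 0 v 0) (nth 0 v 1)).
Definition recursive3 (f : nat -> nat -> nat -> nat) :=
  recursive (fun v => f (nth 0 v 0) (nth 0 v 1) (nth 0 v 2)).
Definition recursive4 (f : nat -> nat -> nat -> nat -> nat) :=
  recursive (fun v => f (nth 0 v 0) (nth 0 v 1) (nth 0 v 2) (nth 0 v 3)).

Lemma rec_op1 f g : recursive1 f -> recursive g -> recursive (fun v => f (g v)).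
Proof.
by move=> [c cP] [d dP]; exists (Comp c [:: d]) => v; apply: eval_comp1 (dP v) (cP _).
Qed.

Lemma rec_op2 f g h : recursive2 f -> recursive g -> recursive h -> recursive (fun v => f (g v) (h v)).
Proof.
move=> [c cP] [d dP] [d' dP']; exists (Comp c [:: d; d']) => v.
exact: eval_comp2 (dP v) (dP' v) (cP _).
Qed.

Lemma rec_op3 f g h k : recursive3 f -> recursive g -> recursive h -> recursive k ->
  recursive (fun v => f (g v) (h v) (k v)).
Proof.
move=> [c cP] [d1 P1] [d2 P2] [d3 P3]; exists (Comp c [:: d1; d2; d3]) => v.
by apply: (@eval_comp _ _ _ [:: g v; h v; k v]) => [//|[|[|[]]]|]//; apply: cP.
Qed.

Lemma rec_op4 f g h k l : recursive4 f -> recursive g -> recursive h -> recursive k -> recursive l ->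
  recursive (fun v => f (g v) (h v) (k v) (l v)).
Proof.
move=> [c cP] [d1 P1] [d2 P2] [d3 P3] [d4 P4].
exists (Comp c [:: d1; d2; d3; d4]) => v.
by apply: (@eval_comp _ _ _ [:: g v; h v; k v; l v]) => [//|[|[|[|[]]]]|]//; apply: cP.
Qed.

Lemma rec_S : recursive1 S.
Proof. by exists Succ => v; constructor. Qed.

Lemma rec_prim F b s : recursive1 b -> recursive3 s -> (forall p, F 0 p = b p) ->
  (forall n p, F n.+1 p = s n (F n p) p) -> recursive2 F.
Proof.
move=> [c cP] [d dP] F0 FS; exists (Comp (Prec c d) [:: Proj 0; Proj 1]) => v.
apply: eval_comp2; [by constructor | by constructor |].
elim: (nth 0 v 0) => [|n IH].
  by constructor; rewrite F0; apply: cP.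
by apply: eval_precS IH _; rewrite FS; apply: dP.
Qed.

Lemma rec_mu F g : recursive2 F ->
  (forall p, F (g p) p = 0) -> (forall p m, m < g p -> 0 < F m p) -> recursive1 g.
Proof.
move=> [c cP] g0 gm; exists (Comp (Mu c) [:: Proj 0]) => v.
apply: eval_comp1; first by constructor.
set p := nth 0 v 0.
apply: (@eval_mu _ _ _ (fun m => (F m p).-1)) => [m lt|].
  by rewrite prednK ?gm //; apply: cP.
by have := cP [:: g p; p]; rewrite /= g0.
Qed.

Definition cond (x a b : nat) : nat := if x is 0 then a else b.

Lemma rec_cond : recursive3 cond.
Proof.
exists (Comp (Prec (Proj 0) (Proj 3)) [:: Proj 0; Proj 1; Proj 2]) => v.
apply: (@eval_comp _ _ _ [:: nth 0 v 0; nth 0 v 1; nth 0 v 2]) => [//||].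
  by move=> [|[|[]]]// _; apply: eval_proj.
elim: (nth 0 v 0) => [|n IH]; first by constructor; apply: eval_proj.
by apply: eval_precS IH _; apply: (eval_proj 3 [:: _; _; _; _]).
Qed.

Lemma rec_predn : recursive1 predn.
Proof.
exists (Comp (Prec Zero (Proj 0)) [:: Proj 0]) => v.
apply: eval_comp1; first exact: eval_proj.
elim: (nth 0 v 0) => [|n IH]; first by constructor; constructor.
by apply: eval_precS IH _; apply: (eval_proj 0 [:: _; _]).
Qed.

Lemma rec_addn : recursive2 addn.
Proof.
apply: (@rec_prim _ id (fun i y p => y.+1)) => //; first exact: rec_nth.
by apply: (rec_op1 rec_S); apply: rec_nth.
Qed.

Lemma rec_subn : recursive2 subn.
Proof.
have H : recursive2 (fun n p => p - n).
  apply: (@rec_prim _ id (fun i y p => y.-1)); first exact: rec_nth.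
  - by apply: (rec_op1 rec_predn); apply: rec_nth.
  - by move=> p; rewrite subn0.
  - by move=> n p; rewrite subnS.
by apply: (rec_op2 H); apply: rec_nth.
Qed.

Lemma rec_muln : recursive2 muln.
Proof.
apply: (@rec_prim _ (fun=> 0) (fun i y p => p + y)) => //; first exact: rec_const.
by apply: (rec_op2 rec_addn); apply: rec_nth.
Qed.

Ltac rec_tac1 :=
  match goal with
  | |- recursive1 _ => rewrite /recursive1
  | |- recursive2 _ => rewrite /recursive2
  | |- recursive3 _ => rewrite /recursive3
  | |- recursive4 _ => rewrite /recursive4
  | |- recursive (fun v => ?c) => exact: (rec_const c)
  | |- recursive (fun v => nth 0 v ?i) => exact: (rec_nth i)
  | |- recursive (fun v => S _) => apply: (rec_op1 rec_S)
  | |- recursive (fun v => predn _) => apply: (rec_op1 rec_predn)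
  | |- recursive (fun v => addn _ _) => apply: (rec_op2 rec_addn)
  | |- recursive (fun v => subn _ _) => apply: (rec_op2 rec_subn)
  | |- recursive (fun v => muln _ _) => apply: (rec_op2 rec_muln)
  | |- recursive (fun v => cond _ _ _) => apply: (rec_op3 rec_cond)
  | H : recursive4 ?f |- recursive (fun v => ?f _ _ _ _) => apply: (rec_op4 H)
  | H : recursive3 ?f |- recursive (fun v => ?f _ _ _) => apply: (rec_op3 H)
  | H : recursive2 ?f |- recursive (fun v => ?f _ _) => apply: (rec_op2 H)
  | H : recursive1 ?f |- recursive (fun v => ?f _) => apply: (rec_op1 H)
  end.

Ltac rec_tac := repeat rec_tac1.

Lemma rec_prim1 F b s : recursive2 s -> F 0 = b -> (forall n, F n.+1 = s n (F n)) ->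
  recursive1 F.
Proof.
move=> sP F0 FS; have [c cP] : recursive2 (fun n _ => F n).
  apply: (@rec_prim _ (fun=> b) (fun i y _ => s i y)) => //; first exact: rec_const.
by exists (Comp c [:: Proj 0]) => v; apply: eval_comp1 (eval_proj 0 v) (cP _).
Qed.

Lemma rec_iter f : recursive1 f -> recursive2 (fun n x => iter n f x).
Proof. by move=> fP; apply: (@rec_prim _ id (fun i y p => f y)) => //; rec_tac. Qed.

Lemma rec_expn : recursive2 expn.
Proof.
have H : recursive2 (fun n p => p ^ n).
  apply: (@rec_prim _ (fun=> 1) (fun i y p => p * y)); rec_tac.
    by move=> p; rewrite expn0.
  by move=> n p; rewrite expnS.
by apply: (rec_op2 H); rec_tac.
Qed.

Lemma rec_modn : recursive2 modn.
Proof.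
apply: (@rec_prim _ (fun=> 0) (fun i y d => cond d y.+1 (cond (d - y.+1) 0 y.+1))); rec_tac.
  by move=> p; rewrite mod0n.
move=> n [|d]; first by rewrite !modn0.
rewrite /cond; have lt := ltn_pmod n (ltn0Sn d).
rewrite {1}(divn_eq n d.+1) -addnS modnMDl; case E: (_ - _) => [|k].
  have -> : (n %% d.+1).+1 = d.+1 by lia.
  by rewrite modnn.
by rewrite modn_small //; lia.
Qed.

Lemma rec_div4 : recursive1 (divn^~ 4).
Proof.
have rm := rec_modn.
apply: (@rec_prim1 _ 0 (fun i y => cond (i.+1 %% 4) y.+1 y)) => //; rec_tac.
by move=> n; rewrite divnS // /dvdn; case: (_ %% 4).
Qed.

Definition tri n := 'C(n.+1, 2).

Lemma rec_tri : recursive1 tri.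
Proof.
apply: (@rec_prim1 _ 0 (fun i y => y + i.+1)) => //; rec_tac.
by move=> n; rewrite /tri bin2S.
Qed.

Lemma rec_cpair : recursive2 cpair.
Proof.
have rt := rec_tri.
apply: (@rec_ext (fun v => tri (nth 0 v 0 + nth 0 v 1) + nth 0 v 0)); last by rec_tac.
by move=> v; rewrite cpairE.
Qed.

(** [diag n] is the diagonal x + y of the pair (x, y) coded by [n]; since
[cpair x y = tri (x + y) + x], it determines both projections. *)
Fixpoint diag n :=
  if n is m.+1 then cond (tri (diag m).+1 - m.+1) (diag m).+1 (diag m) else 0.

Definition cleft n := n - tri (diag n).
Definition cright n := diag n - cleft n.

Lemma diagP n : tri (diag n) <= n < tri (diag n).+1.
Proof.
elim: n => // n IH /=; rewrite /cond.
have e : tri (diag n).+2 = tri (diag n).+1 + (diag n).+2 by rewrite /tri bin2S.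
by case E: (_ - _) => [|k]; lia.
Qed.

Lemma tri_mono m n : m <= n -> tri m <= tri n.
Proof. by move=> le; apply: leq_bin2l. Qed.

Lemma diag_cpair x y : diag (cpair x y) = x + y.
Proof.
have := diagP (cpair x y); have := cpairE x y; rewrite -/(tri (x + y)) => E.
have e : tri (x + y).+1 = tri (x + y) + (x + y).+1 by rewrite /tri bin2S.
move=> H; have [lt|lt|//] := ltngtP (diag (cpair x y)) (x + y).
- by have := tri_mono lt; lia.
- by have := tri_mono lt; lia.
Qed.

Lemma cleftK x y : cleft (cpair x y) = x.
Proof. by rewrite /cleft diag_cpair cpairE -/(tri (x + y)) addKn. Qed.

Lemma crightK x y : cright (cpair x y) = y.
Proof. by rewrite /cright diag_cpair cleftK addKn. Qed.

Lemma rec_diag : recursive1 diag.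
Proof.
have rt := rec_tri.
by apply: (@rec_prim1 _ 0 (fun i y => cond (tri y.+1 - i.+1) y.+1 y)) => //; rec_tac.
Qed.

Lemma rec_cleft : recursive1 cleft.
Proof. by have rt := rec_tri; have rd := rec_diag; rewrite /cleft; rec_tac. Qed.

Lemma rec_cright : recursive1 cright.
Proof. by have rl := rec_cleft; have rd := rec_diag; rewrite /cright; rec_tac. Qed.

Lemma rec_logn p : prime p -> recursive1 (logn p).
Proof.
move=> pp; have re := rec_expn; have rm := rec_modn.
apply: (@rec_mu (fun i e => cond e 0 (cond (e %% p ^ i.+1) 1 0))); rec_tac.
  case=> [|e] //=; rewrite /cond; case E: (_ %% _) => //.
  by have := pfactor_dvdn (logn p e.+1).+1 pp (ltn0Sn e); rewrite ltnn /dvdn E.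
case=> [|e] m /=; first by rewrite logn0.
by rewrite -pfactor_dvdn // /dvdn => /eqP ->.
Qed.

Definition ppair (a b : nat) : nat := 2 ^ a * 3 ^ b.

Lemma pr0K a b : pr0 (ppair a b) = a.
Proof. by rewrite /pr0 /ppair lognM ?expn_gt0 // !lognX !(@logn_prime 2) // muln1 muln0 addn0. Qed.

Lemma pr1K a b : pr1 (ppair a b) = b.
Proof. by rewrite /pr1 /ppair lognM ?expn_gt0 // !lognX !(@logn_prime 3) // muln1 muln0. Qed.

Lemma rec_ppair : recursive2 ppair.
Proof. by have re := rec_expn; rewrite /ppair; rec_tac. Qed.

Lemma rec_pr0 : recursive1 pr0. Proof. exact: (@rec_logn 2 isT). Qed.
Lemma rec_pr1 : recursive1 pr1. Proof. exact: (@rec_logn 3 isT). Qed.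

(** * A universal code *)
Definition ccons a n := (cpair a n).+1.
Definition chead n := cleft n.-1.
Definition ctail n := cright n.-1.
Definition cnth i v := chead (iter i ctail v).
Definition quad a b c d := cpair a (cpair b (cpair c d)).
Definition quad0 s := cleft s.
Definition quad1 s := cleft (cright s).
Definition quad2 s := cleft (cright (cright s)).
Definition quad3 s := cright (cright (cright s)).

Lemma cheadK a n : chead (ccons a n) = a. Proof. exact: cleftK. Qed.
Lemma ctailK a n : ctail (ccons a n) = n. Proof. exact: crightK. Qed.
Lemma quad0K a b c d : quad0 (quad a b c d) = a. Proof. exact: cleftK. Qed.
Lemma quad1K a b c d : quad1 (quad a b c d) = b. Proof. by rewrite /quad1 !(cleftK, crightK). Qed.
Lemma quad2K a b c d : quad2 (quad a b c d) = c. Proof. by rewrite /quad2 !(cleftK, crightK). Qed.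
Lemma quad3K a b c d : quad3 (quad a b c d) = d. Proof. by rewrite /quad3 !(cleftK, crightK). Qed.
Definition machE := (cheadK, ctailK, quad0K, quad1K, quad2K, quad3K, cleftK, crightK).

(** The states of a stack machine on numbers: evaluate a code on a list of
arguments, evaluate a list of codes on a list of arguments, or return a value;
[k] is the continuation, a list of frames. Lists are coded as in [seqnum], so
that the code in a state is literally a Goedel number. *)
Definition st_eval c v k := quad 0 c v k.
Definition st_args gs v k := quad 1 gs v k.
Definition st_ret z k := quad 2 z 0 k.

(** What to do with a returned value: apply a code to it (a coded list of
values), continue a primitive recursion, test it in a minimization, evaluate
the head of a list of codes, or prepend it to the values of the tail. *)
Definition frame_app f := quad 0 f 0 0.
Definition frame_prec g n v := quad 1 g n v.
Definition frame_mu f m v := quad 2 f m v.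
Definition frame_arg g v := quad 3 g v 0.
Definition frame_cons ws := quad 4 ws 0 0.

(** For c > 1, the remainder [j] of c - 2 by 4 is the constructor of the code
and the quotient [i] codes its arguments. *)
Definition step_case c i j v k :=
  cond j (st_ret (cnth i v) k)
  (cond j.-1 (st_args (cright i) v (ccons (frame_app (cleft i)) k))
  (cond j.-2
    (cond (chead v) (st_eval (cleft i) (ctail v) k)
      (st_eval c (ccons (chead v).-1 (ctail v))
        (ccons (frame_prec (cright i) (chead v).-1 (ctail v)) k)))
  (st_eval i (ccons 0 v) (ccons (frame_mu i 0 v) k)))).

Definition step_eval c v k :=
  cond c (st_ret 0 k) (cond c.-1 (st_ret (chead v).+1 k)
    (step_case c (c.-2 %/ 4) (c.-2 %% 4) v k)).

(** The tail of the list is evaluated before the head, so that the list of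
values is built by consing. *)
Definition step_args gs v k :=
  cond gs (st_ret 0 k) (st_args (ctail gs) v (ccons (frame_arg (chead gs) v) k)).

Definition step_frame t a b c z k :=
  cond t (st_eval a z k)
  (cond t.-1 (st_eval a (ccons b (ccons z c)) k)
  (cond t.-2
    (cond z (st_ret b k) (st_eval a (ccons b.+1 c) (ccons (frame_mu a b.+1 c) k)))
  (cond t.-2.-1 (st_eval a b (ccons (frame_cons z) k))
  (st_ret (ccons z a) k)))).

Definition step_ret z k :=
  cond k (st_ret z k)
    (step_frame (quad0 (chead k)) (quad1 (chead k)) (quad2 (chead k)) (quad3 (chead k)) z (ctail k)).

Definition step s :=
  cond (quad0 s) (step_eval (quad1 s) (quad2 s) (quad3 s))
  (cond (quad0 s).-1 (step_args (quad1 s) (quad2 s) (quad3 s)) (step_ret (quad1 s) (quad3 s))).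

Lemma rec_step : recursive1 step.
Proof.
have rl := rec_cleft; have rr := rec_cright; have rc := rec_cpair.
have rm := rec_modn; have rd := rec_div4.
have rh : recursive1 chead by rewrite /chead; rec_tac.
have rt : recursive1 ctail by rewrite /ctail; rec_tac.
have ri := rec_iter rt.
have r0 : recursive1 quad0 by rewrite /quad0; rec_tac.
have r1 : recursive1 quad1 by rewrite /quad1; rec_tac.
have r2 : recursive1 quad2 by rewrite /quad2; rec_tac.
have r3 : recursive1 quad3 by rewrite /quad3; rec_tac.
have rco : recursive2 ccons by rewrite /ccons; rec_tac.
have rq : recursive4 quad by rewrite /quad; rec_tac.
have rnth : recursive2 cnth by exact: (rec_op1 rh ri).
have re : recursive3 step_eval.
  rewrite /step_eval /step_case /st_ret /st_args /st_eval /frame_app /frame_prec /frame_mu.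
  by rec_tac; apply: (rec_op1 rd); rec_tac.
have ra : recursive3 step_args by rewrite /step_args /st_ret /st_args /frame_arg; rec_tac.
have rr' : recursive2 step_ret.
  by rewrite /step_ret /step_frame /st_ret /st_eval /frame_mu /frame_cons; rec_tac.
by rewrite /step; rec_tac.
Qed.

Definition reach s t := exists n, iter n step s = t.

Lemma reach_refl s : reach s s. Proof. by exists 0. Qed.
Lemma reach_step s t : reach (step s) t -> reach s t.
Proof. by case=> n <-; exists n.+1; rewrite iterSr. Qed.
Lemma reach_trans s t u : reach s t -> reach t u -> reach s u.
Proof. by case=> m <- [n <-]; exists (n + m); rewrite iterD. Qed.

Definition enc (s : seq nat) : nat := seqnum s.
Arguments enc : simpl never.
Lemma enc_cons a s : enc (a :: s) = ccons a (enc s). Proof. by []. Qed.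

Lemma step_EvalE c v k : step (st_eval c v k) = step_eval c v k.
Proof. by rewrite /step /st_eval !machE. Qed.
Lemma step_ArgsE c v k : step (st_args c v k) = step_args c v k.
Proof. by rewrite /step /st_args !machE. Qed.
Lemma step_RetE z k : step (st_ret z k) = step_ret z k.
Proof. by rewrite /step /st_ret !machE. Qed.
Lemma step_Ret t a b c z k :
  step (st_ret z (ccons (quad t a b c) k)) = step_frame t a b c z k.
Proof. by rewrite step_RetE /step_ret !machE. Qed.

Lemma step_compound c x j v k : j < 4 -> c = 4 * x + j.+2 ->
  step (st_eval c v k) = step_case c x j v k.
Proof.
move=> lt e; rewrite step_EvalE /step_eval.
have -> : c.-2 %/ 4 = x by lia.
have -> : c.-2 %% 4 = j by lia.
by case: c e => [|[|c]] e //; lia.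
Qed.

Lemma step_cProj i v k : step (st_eval (gnum (Proj i)) v k) = st_ret (cnth i v) k.
Proof. exact: (step_compound (j := 0)). Qed.

Lemma step_cComp f gs v k :
  step (st_eval (gnum (Comp f gs)) v k) =
  st_args (seqnum (map gnum gs)) v (ccons (frame_app (gnum f)) k).
Proof.
set x := cpair (gnum f) (seqnum (map gnum gs)).
by rewrite (step_compound (x := x) (j := 1)) // /step_case /x !machE.
Qed.

Lemma step_cPrec f g v k :
  step (st_eval (gnum (Prec f g)) v k) =
    (cond (chead v) (st_eval (gnum f) (ctail v) k)
      (st_eval (gnum (Prec f g)) (ccons (chead v).-1 (ctail v))
        (ccons (frame_prec (gnum g) (chead v).-1 (ctail v)) k))).
Proof.
set x := cpair (gnum f) (gnum g).
by rewrite (step_compound (x := x) (j := 2)) // /step_case /x !machE.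
Qed.

Lemma step_cMu f v k :
  step (st_eval (gnum (Mu f)) v k) =
    st_eval (gnum f) (ccons 0 v) (ccons (frame_mu (gnum f) 0 v) k).
Proof. exact: (step_compound (j := 3)). Qed.

Lemma cnthE s i : cnth i (enc s) = nth 0 s i.
Proof.
rewrite /cnth; elim: i s => [|i IH] [|a s] //=.
- by rewrite cheadK.
- by rewrite -iterS iterSr; apply: etrans (IH [::]) (nth_nil _ _).
- by rewrite -iterS iterSr enc_cons ctailK IH.
Qed.

Lemma reach_args gs v ws k :
  size ws = size gs ->
  (forall i, i < size gs -> forall k,
     reach (st_eval (gnum (nth Zero gs i)) (enc v) k) (st_ret (nth 0 ws i) k)) ->
  reach (st_args (seqnum (map gnum gs)) (enc v) k) (st_ret (enc ws) k).
Proof.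
elim: gs ws k => [|g gs IH] [|w ws] //= k.
  by move=> _ _; apply: reach_step; rewrite step_ArgsE; apply: reach_refl.
case=> sz H; apply: reach_step; rewrite step_ArgsE /step_args /= !machE.
apply: reach_trans (IH ws _ sz _) _ => [i lt|]; first exact: (H i.+1).
apply: reach_step; rewrite step_Ret; apply: reach_trans (H 0 _ _) _ => //.
by apply: reach_step; rewrite step_Ret; apply: reach_refl.
Qed.

(** The machine simulates evaluation under every continuation, by induction on
the evaluation; a minimization re-enters its frame once for each value below
the result. *)
Lemma reach_eval c v z : eval c v z ->
  forall k, reach (st_eval (gnum c) (enc v) k) (st_ret z k).
Proof.
elim=> {c v z}.
- by move=> v k; apply: reach_step; rewrite step_EvalE; apply: reach_refl.
- move=> v k; apply: reach_step; rewrite step_EvalE -cnthE; exact: reach_refl.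
- by move=> i v k; apply: reach_step; rewrite step_cProj cnthE; apply: reach_refl.
- move=> f gs v ws z sz _ IH _ IHf k; apply: reach_step; rewrite step_cComp.
  apply: reach_trans (reach_args _ sz IH) _.
  by apply: reach_step; rewrite step_Ret; apply: IHf.
- move=> f g v z _ IH k; apply: reach_step; rewrite step_cPrec enc_cons !machE.
  exact: IH.
- move=> f g n v y z _ IH1 _ IH2 k; apply: reach_step.
  rewrite step_cPrec enc_cons !machE; apply: reach_trans (IH1 _) _.
  by apply: reach_step; rewrite step_Ret; apply: IH2.
- move=> f v n w _ IHw _ IH k; apply: reach_step; rewrite step_cMu.
  have H m : m <= n -> reach (st_eval (gnum f) (ccons 0 (enc v)) (ccons (frame_mu (gnum f) 0 (enc v)) k))
      (st_eval (gnum f) (ccons m (enc v)) (ccons (frame_mu (gnum f) m (enc v)) k)).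
    elim: m => [|m IHm] le; first exact: reach_refl.
    apply: reach_trans (IHm _) _; first by lia.
    apply: reach_trans (IHw _ le _) _.
    by apply: reach_step; rewrite step_Ret; apply: reach_refl.
  apply: reach_trans (H n (leqnn n)) _; apply: reach_trans (IH _) _.
  by apply: reach_step; rewrite step_Ret; apply: reach_refl.
Qed.

(** Zero on the halted states: a value returned to the empty continuation. *)
Definition running s := (2 - quad0 s) + quad3 s.

(** The number of steps to a halted state is found by minimization. Further
steps do not change the value of a halted state, so the first one carries the
value predicted by the simulation. *)
Lemma universal_code :
  {universal : code | forall e x z, kleene e x z -> eval universal [:: e; x] z}.
Proof.
have rs := rec_step; have ri := rec_iter rs.
have rl := rec_cleft; have rr := rec_cright; have rc := rec_cpair.
have r0 : recursive1 quad0 by rewrite /quad0; rec_tac.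
have r1 : recursive1 quad1 by rewrite /quad1; rec_tac.
have r3 : recursive1 quad3 by rewrite /quad3; rec_tac.
have rq : recursive4 quad by rewrite /quad; rec_tac.
have [c cP] : recursive2 (fun n s => running (iter n step s)).
  by rewrite /running; rec_tac; exact: ri.
have [d dP] : recursive2 (fun n s => quad1 (iter n step s)).
  by rec_tac; exact: ri.
have [i iP] : recursive2 (fun e x => st_eval e (ccons x 0) 0).
  by rewrite /st_eval /ccons; rec_tac.
exists (Comp (Comp d [:: Mu c; Proj 0]) [:: i]) => e x z [p [<- ev]].
apply: eval_comp1; first exact: iP.
rewrite /=; set s := st_eval _ _ _.
have [N EN] : reach s (st_ret z 0) by apply: (reach_eval ev 0).
have ex : exists n, running (iter n step s) == 0.
  by exists N; rewrite EN /running /st_ret !machE.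
case: (ex_minnP ex) => n /eqP n0 nmin.
have En : quad1 (iter n step s) = z.
  have le : n <= N by apply: nmin; rewrite EN /running /st_ret !machE.
  have H k : running (iter (k + n) step s) = 0 /\
             quad1 (iter (k + n) step s) = quad1 (iter n step s).
    elim: k => // k [+ <-]; rewrite addSn iterS; set t := iter _ _ _.
    rewrite /running /step /step_ret => t0.
    have -> : quad3 t = 0 by lia.
    by case: (quad0 t) t0 => [|[|m]] _ //; rewrite /= /st_ret !machE.
  by have [_ <-] := H (N - n); rewrite subnK // EN quad1K.
apply: (eval_comp2 (x := n) (y := s)).
- apply: (@eval_mu _ _ _ (fun m => (running (iter m step s)).-1)) => [m lt|].
    rewrite prednK; first exact: (cP [:: m; s]).
    by rewrite lt0n; apply: contraTneq lt => e0; rewrite -leqNgt nmin // e0.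
  by have := cP [:: n; s]; rewrite /= n0.
- exact: eval_proj.
- by have := dP [:: n; s]; rewrite /= En.
Qed.

(** * A language of realizers *)
Definition universal := sval universal_code.

(** A program with free variables: [t k] is its code when the environment has
[k] values, which abstraction and recursion have to know. Variables are
positions in the environment. *)
Definition term := nat -> code.

(** Weakest preconditions: the program converges to a value satisfying [P]. The
clauses of realizability for implication and universal quantification are
instances of [ap], so realizers are verified by computing preconditions. *)
Definition cwp (c : code) v (P : nat -> Prop) := exists z, eval c v z /\ P z.
Definition wp (t : term) v P := cwp (t (size v)) v P.
Definition ap (e x : nat) (P : nat -> Prop) := exists z, kleene e x z /\ P z.

Lemma cwp_mono c v (P Q : nat -> Prop) :
  (forall z, P z -> Q z) -> cwp c v P -> cwp c v Q.
Proof. by move=> PQ [z [ev /PQ Qz]]; exists z. Qed.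

Lemma wp_mono t v (P Q : nat -> Prop) :
  (forall z, P z -> Q z) -> wp t v P -> wp t v Q.
Proof. exact: cwp_mono. Qed.

Lemma ap_mono e x (P Q : nat -> Prop) :
  (forall z, P z -> Q z) -> ap e x P -> ap e x Q.
Proof. by move=> PQ [z [ev /PQ Qz]]; exists z. Qed.

Definition tV i : term := fun=> Proj i.
Definition tFn c (ts : seq term) : term := fun k => Comp c [seq t k | t : term <- ts].
Definition tC a : term := tFn (numeral a) [::].
Definition tApp s t : term := tFn universal [:: s; t].

Lemma wp_V i v (P : nat -> Prop) : P (nth 0 v i) -> wp (tV i) v P.
Proof. by exists (nth 0 v i); split=> //; constructor. Qed.

Lemma wp_C a v (P : nat -> Prop) : P a -> wp (tC a) v P.
Proof.
exists a; split=> //; apply: (@eval_comp _ _ _ [::]) => //; exact: eval_numeral.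
Qed.

(** In continuation form, so that on an explicit list of programs it unfolds to
nested preconditions. *)
Fixpoint wps (ts : seq term) v (K : seq nat -> Prop) : Prop :=
  if ts is t :: ts' then wp t v (fun a => wps ts' v (fun s => K (a :: s))) else K [::].

Lemma wpsE ts v K : wps ts v K -> exists ws,
  [/\ size ws = size ts,
      forall i, i < size ts -> eval (nth (tC 0) ts i (size v)) v (nth 0 ws i) & K ws].
Proof.
elim: ts K => [|t ts IH] K /=; first by exists [::].
move=> [a [ea /IH[ws [sz H HK]]]]; exists (a :: ws); split=> //=; first by rewrite sz.
by case.
Qed.

Lemma wp_call c ts v P : wps ts v (fun s => cwp c s P) -> wp (tFn c ts) v P.
Proof.
move=> /wpsE[ws [sz H [z [ez Pz]]]]; exists z; split=> //.
apply: (@eval_comp _ _ _ ws) ez; rewrite size_map // => i lt.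
by rewrite (nth_map (tC 0)) //; apply: H.
Qed.

Lemma wp_call1 c t v P :
  wp t v (fun x => cwp c [:: x] P) -> wp (tFn c [:: t]) v P.
Proof. exact: (@wp_call c [:: t]). Qed.

Lemma wp_call2 c s t v P :
  wp s v (fun x => wp t v (fun y => cwp c [:: x; y] P)) -> wp (tFn c [:: s; t]) v P.
Proof. exact: (@wp_call c [:: s; t]). Qed.

Definition op1 f (fP : recursive1 f) t : term := tFn (sval fP) [:: t].
Definition op2 f (fP : recursive2 f) s t : term := tFn (sval fP) [:: s; t].
Definition op3 f (fP : recursive3 f) s t u : term := tFn (sval fP) [:: s; t; u].

Lemma wp_op1 f (fP : recursive1 f) t v P :
  wp t v (fun x => P (f x)) -> wp (op1 fP t) v P.
Proof.
move=> H; apply: wp_call1; apply: wp_mono H => x Px.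
by exists (f x); split=> //; apply: (svalP fP [:: x]).
Qed.

Lemma wp_op2 f (fP : recursive2 f) s t v P :
  wp s v (fun x => wp t v (fun y => P (f x y))) -> wp (op2 fP s t) v P.
Proof.
move=> H; apply: wp_call2; apply: wp_mono H => x; apply: wp_mono => y Pxy.
by exists (f x y); split=> //; apply: (svalP fP [:: x; y]).
Qed.

Lemma wp_op3 f (fP : recursive3 f) s t u v P :
  wp s v (fun x => wp t v (fun y => wp u v (fun z => P (f x y z)))) ->
  wp (op3 fP s t u) v P.
Proof.
move=> H; apply: wp_call; apply: wp_mono H => x; apply: wp_mono => y.
apply: wp_mono => z Pz.
by exists (f x y z); split=> //; apply: (svalP fP [:: x; y; z]).
Qed.

Lemma wp_app s t v P :
  wp s v (fun e => wp t v (fun x => ap e x P)) -> wp (tApp s t) v P.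
Proof.
move=> H; apply: wp_call2; apply: wp_mono H => e; apply: wp_mono => x.
by move=> [z [/(svalP universal_code) ev Pz]]; exists z.
Qed.

(** The s-m-n theorem: the environment is stored in the code as numerals. *)
Definition clos c v := gnum (Comp c (Proj 0 :: map numeral v)).

Lemma kleene_clos c v x z : eval c (x :: v) z -> kleene (clos c v) x z.
Proof.
move=> ev; exists (Comp c (Proj 0 :: map numeral v)); split=> //.
apply: (@eval_comp _ _ _ (x :: v)) => //=; first by rewrite size_map.
case=> [|i] lt; first exact: eval_proj.
rewrite /= (nth_map 0); first exact: eval_numeral.
by move: lt; rewrite /= size_map.
Qed.

Lemma rec_numeral : recursive1 (fun a => gnum (numeral a)).
Proof.
have rc := rec_cpair.
by apply: (@rec_prim1 _ 0 (fun i y => 4 * cpair 1 (cpair y 0).+1 + 3)); rec_tac.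
Qed.

Lemma clos_code k c : {d : code | forall v, size v = k -> eval d v (clos c v)}.
Proof.
have rc := rec_cpair; have rn := rec_numeral.
have H j m : recursive (fun v => seqnum [seq gnum (numeral (nth 0 v i)) | i <- iota j m]).
  elim: m j => [|m IH] j /=; first by rec_tac.
  have IH' := IH j.+1.
  apply: (rec_op1 rec_S); apply: (rec_op2 rc); last exact: IH'.
  by apply: (rec_op1 rn); rec_tac.
have [d dP] : recursive (fun v => 4 * cpair (gnum c) (cpair 2
    (seqnum [seq gnum (numeral (nth 0 v i)) | i <- iota 0 k])).+1 + 3).
  by rec_tac; apply: H.
exists d => v sz; have := dP v; congr eval; rewrite /clos /=.
congr (4 * cpair _ (cpair _ (seqnum _)).+1 + 3).
have vE : v = [seq nth 0 v i | i <- iota 0 k] by rewrite map_nth_iota0 -sz ?take_size.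
by rewrite [in RHS]vE -!map_comp.
Qed.

Definition tLam (t : term) : term := fun k => sval (clos_code k (t k.+1)).

Lemma wp_lam t v (P : nat -> Prop) :
  (forall e, (forall x Q, wp t (x :: v) Q -> ap e x Q) -> P e) -> wp (tLam t) v P.
Proof.
move=> H; exists (clos (t (size v).+1) v); split.
  exact: (svalP (clos_code (size v) (t (size v).+1)) v).
by apply: H => x Q [z [ev Qz]]; exists z; split=> //; apply: kleene_clos.
Qed.

Definition tRec (n s t : term) : term :=
  fun k => Comp (Prec (s k) (t k.+2)) (n k :: [seq Proj i | i <- iota 0 k]).

(** The step program has to converge only on values that satisfy the invariant
[J]. *)
Lemma wp_rec (J : nat -> nat -> Prop) n s t v P :
  wp n v (fun m => [/\ wp s v (J 0),
    (forall i y, i < m -> J i y -> wp t [:: i, y & v] (J i.+1)) &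
    (forall y, J m y -> P y)]) ->
  wp (tRec n s t) v P.
Proof.
move=> [m [en [Hs Ht HP]]].
suff [y [ey Jy]] : exists y, eval (Prec (s (size v)) (t (size v).+2)) (m :: v) y /\ J m y.
  exists y; split; last exact: HP.
  apply: (@eval_comp _ _ _ (m :: v)) ey; first by rewrite /= size_map size_iota.
  case=> [//|i]; rewrite /= ltnS size_map size_iota => lt.
  rewrite (nth_map 0) ?size_iota // nth_iota //; exact: eval_proj.
elim: {en HP}m Ht => [|m IH] Ht.
  by have [z [ev Jz]] := Hs; exists z; split=> //; constructor.
have [|y [ey Jy]] := IH; first by move=> i y lt; apply: Ht; lia.
have [//|z [ez Jz]] := Ht m y _ Jy.
by exists z; split=> //; apply: eval_precS ey ez.
Qed.

Definition tMu (t : term) : term := fun k => Mu (t k.+1).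

(** [g] gives the values of the tested program, which has to converge up to the
first zero only. *)
Lemma wp_mu (g : nat -> nat) (t : term) v (P : nat -> Prop) n :
  g n = 0 -> (forall m, m <= n -> (forall j, j < m -> g j <> 0) -> wp t (m :: v) (eq (g m))) ->
  (forall m, g m = 0 -> (forall j, j < m -> g j <> 0) -> P m) ->
  wp (tMu t) v P.
Proof.
move=> gn Ht HP; have ex : exists n, g n == 0 by exists n; apply/eqP.
case: (ex_minnP ex) => m /eqP gm mmin.
have lem : m <= n by apply: mmin; apply/eqP.
have nz j : j < m -> g j <> 0.
  by move=> lt /eqP/mmin; rewrite leqNgt lt.
have W j : j <= m -> eval (t (size v).+1) (j :: v) (g j).
  move=> le; have [||z [ez ->]] := Ht j _ _ => //; first by lia.
  by move=> i lt; apply: nz; lia.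
exists m; split; last exact: HP.
apply: (@eval_mu _ _ _ (fun j => (g j).-1)) => [j lt|].
  by rewrite prednK; [apply: W; lia | rewrite lt0n; apply/eqP/nz].
by rewrite -gm; apply: W.
Qed.

Definition tPair := op2 rec_ppair.
Definition tFst := op1 rec_pr0.
Definition tSnd := op1 rec_pr1.

Lemma wp_pair s t v (P : nat -> Prop) :
  wp s v (fun a => wp t v (fun b => forall e, pr0 e = a -> pr1 e = b -> P e)) ->
  wp (tPair s t) v P.
Proof.
move=> H; apply: wp_op2; apply: wp_mono H => x; apply: wp_mono => y.
by apply; rewrite ?pr0K ?pr1K.
Qed.

Lemma wp_fst t v P : wp t v (fun x => P (pr0 x)) -> wp (tFst t) v P.
Proof. exact: wp_op1. Qed.
Lemma wp_snd t v P : wp t v (fun x => P (pr1 x)) -> wp (tSnd t) v P.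
Proof. exact: wp_op1. Qed.

(** Only the selected branch is run: both are made into closures, one is chosen,
and it is applied to the value of [b], which therefore is variable 0 of the
branches. *)
Definition tCase b s t : term := tApp (op3 rec_cond b (tLam s) (tLam t)) b.

Lemma wp_case b s t v P :
  wp b v (fun x => if x is 0 then wp s (0 :: v) P else wp t (x :: v) P) ->
  wp (tCase b s t) v P.
Proof.
move=> [x [ex H]]; apply: wp_app; apply: wp_op3; exists x; split=> //.
apply: wp_lam => e1 H1; apply: wp_lam => e2 H2; exists x; split=> //.
by case: x ex H => [|x] _ H; [apply: H1 | apply: H2].
Qed.

(** * Encoded assignments *)

(** A number codes a finite assignment as an association list, with 0 for the
variables that are not bound. A realizer of an open formula can thus take the
whole assignment as one argument. *)
Definition lookup_step x l :=
  cond l 0 (cond ((cleft (chead l) - x) + (x - cleft (chead l))) l (ctail l)).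
Definition dec s x := cright (chead (iter s (lookup_step x) s)).
Definition ext s x a := ccons (cpair x a) s.

Lemma leq_cright n : cright n <= n.
Proof. by have [x [y <-]] := cpair_surj n; rewrite crightK; have [] := leq_cpair x y. Qed.

(** The list coded by [l] has at most [l] cells, so the lookup is over after [l]
steps. *)
Lemma lookup_stable y n l : l <= n ->
  lookup_step y (iter n (lookup_step y) l) = iter n (lookup_step y) l.
Proof.
elim: n l => [|n IH] [|l] // le.
  by elim: n {IH le} => [|n IH] //=; rewrite IH.
have : lookup_step y l.+1 = l.+1 \/ lookup_step y l.+1 <= n.
  rewrite /lookup_step /=; case: (_ + _) => [|j]; [by left | right].
  by apply: leq_trans (leq_cright _) _.
case=> [e|lt]; last by rewrite iterSr IH.
have -> k : iter k (lookup_step y) l.+1 = l.+1 by elim: k => //= k ->.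
exact: e.
Qed.

Lemma dec_ext s x a : dec (ext s x a) =1 upd (dec s) x a.
Proof.
move=> y; rewrite /upd /dec; set l := ext s x a.
have lE : l = ext s x a by [].
have -> : l = (cpair (cpair x a) s).+1 by [].
rewrite iterSr -/l.
have l1 : lookup_step y l = if y == x then l else s.
  rewrite /lookup_step lE /ext !machE /cond /ccons; case: eqP => [->|ne].
    by rewrite subnn.
  by case E: (_ + _) => //; lia.
rewrite l1; case: eqP => [->|ne].
  have l2 n : iter n (lookup_step x) l = l.
    by elim: n => //= n ->; rewrite /lookup_step lE /ext !machE /cond /ccons subnn.
  by rewrite l2 lE /ext !machE.
congr (cright (chead _)); have [_] := leq_cpair (cpair x a) s.
move=> /subnK <-; elim: (_ - s) => [|k IH]; first by rewrite add0n.
by rewrite addSn iterS IH lookup_stable.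
Qed.

Lemma rec_dec : recursive2 dec.
Proof.
have rl := rec_cleft; have rr := rec_cright; have rc := rec_cpair.
have rh : recursive1 chead by rewrite /chead; rec_tac.
have rt : recursive1 ctail by rewrite /ctail; rec_tac.
have rk : recursive2 lookup_step by rewrite /lookup_step; rec_tac.
have ri : recursive2 (fun n p => iter n (lookup_step (cright p)) (cleft p)).
  by apply: (@rec_prim _ cleft (fun i y p => lookup_step (cright p) y)) => //; rec_tac.
have [c cP] : recursive2 (fun s x => cright (chead
    (iter s (lookup_step (cright (cpair s x))) (cleft (cpair s x))))).
  by rec_tac; apply: (rec_op2 ri); rec_tac.
by exists c => v; have := cP v; rewrite crightK cleftK.
Qed.

Lemma rec_ext3 : recursive3 ext.
Proof. by have rc := rec_cpair; rewrite /ext /ccons; rec_tac. Qed.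

Definition tDec s x := op2 rec_dec s x.
Definition tExt s x a := op3 rec_ext3 s x a.

(** * Realizability and substitution *)
Lemma upd_eq r x a : upd r x a x = a. Proof. by rewrite /upd eqxx. Qed.

Lemma realizes_fv f F r r' e :
  {in fv F, r =1 r'} -> realizes f F r e -> realizes f F r' e.
Proof.
suff H : {in fv F, r =1 r'} -> forall e, realizes f F r e <-> realizes f F r' e.
  by move=> rr; have [] := H rr e.
elim: F r r' {e} => [|n i v|F IHF G IHG|F IHF G IHG|F IHF G IHG|F IHF|x F IHF|x F IHF]
  r r' rr e //=.
- suff -> : map_tuple r v = map_tuple r' v by [].
  by apply: val_inj; apply/eq_in_map.
1-3: have eF : {in fv F, r =1 r'} by move=> y yF; apply: rr; rewrite mem_cat yF.
1-3: have eG : {in fv G, r =1 r'} by move=> y yF; apply: rr; rewrite mem_cat yF orbT.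
- by rewrite (IHF _ _ eF) (IHG _ _ eG).
- by rewrite (IHF _ _ eF) (IHG _ _ eG).
- split=> H a /(IHF _ _ eF) /H [b [k /(IHG _ _ eG) Hb]]; by exists b.
- by split=> H a /(IHF _ _ rr) /H.
- have eF a : {in fv F, upd r x a =1 upd r' x a}.
    move=> y yF; rewrite /upd; case: eqP => // ne; apply: rr.
    by rewrite mem_filter yF andbT; apply/eqP.
  by split=> H a; have [b [k Hb]] := H a; exists b; split=> //; apply/(IHF _ _ (eF a)).
- apply: IHF => y yF; rewrite /upd; case: eqP => // ne; apply: rr.
  by rewrite mem_filter yF andbT; apply/eqP.
Qed.

Lemma realizes_ext f F r r' e :
  r =1 r' -> realizes f F r e -> realizes f F r' e.
Proof. by move=> rr; apply: realizes_fv => y _. Qed.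

Lemma fresh_notin s : fresh s \notin s.
Proof.
have H y : y \in s -> y <= foldr maxn 0 s.
  elim: s => //= a s IH; rewrite inE => /orP[/eqP ->|/IH]; lia.
by apply/negP => /H; rewrite ltnn.
Qed.

Lemma bvar_notin s x F : bvar s x F \notin [seq s y | y <- fv F & y != x].
Proof. by rewrite /bvar; case: ifP => [_|->//]; apply: fresh_notin. Qed.

(** The choice of the bound variable in [ren] avoids capture. *)
Lemma upd_bvar s x F r a :
  {in fv F, upd r (bvar s x F) a \o upd s x (bvar s x F) =1 upd (r \o s) x a}.
Proof.
move=> y yF; rewrite /= {2 3}/upd; case: eqP => [_|ne]; first exact: upd_eq.
rewrite /upd; case: eqP => // e.
have := bvar_notin s x F; rewrite -e map_f // mem_filter yF andbT; exact/eqP.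
Qed.

Lemma realizes_ren f F s r e :
  realizes f (ren s F) r e <-> realizes f F (r \o s) e.
Proof.
have fvE G r1 r2 : {in fv G, r1 =1 r2} -> forall e, realizes f G r1 e <-> realizes f G r2 e.
  by move=> rr e'; split; apply: realizes_fv => // y /rr.
elim: F s r e => [|n i v|F IHF G IHG|F IHF G IHG|F IHF G IHG|F IHF|x F IHF|x F IHF]
  s r e //=.
- suff -> : map_tuple r (map_tuple s v) = map_tuple (r \o s) v by [].
  by apply: val_inj; rewrite /= map_comp.
- by rewrite IHF IHG.
- by rewrite !IHF !IHG.
- by split=> H a /IHF /H [b [k /IHG Hb]]; exists b.
- by split=> H a /IHF /H.
- split=> H a; have [b [k Hb]] := H a; exists b; split=> //.
    by apply/(fvE _ _ _ (@upd_bvar s x F r a))/IHF.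
  by apply/IHF/(fvE _ _ _ (@upd_bvar s x F r a)).
- rewrite IHF; exact: fvE (@upd_bvar s x F r _) _.
Qed.

(** The interpretation of a predicate variable is the realizability of the
formula substituted for it; [r] evaluates the parameters of that formula. *)
Definition psub_interp (f : interp) (T : psubst) (r : nat -> nat) : interp :=
  fun n i => Some (fun (v : n.-tuple nat) e => realizes f (T n i).2
    (fun y => if y \in (T n i).1 then nth 0 v (index y (T n i).1) else r y) e).

(** The assignment [r] changes under the quantifiers of [F] while the
interpretation, fixed by [r0], must not: [psub_ok] says that the quantifiers do
not bind parameters. *)
Lemma realizes_psub f T F r r0 e : psub_ok T F ->
  (forall p, p \in preds F -> {in params T p, r =1 r0}) ->
  realizes f (psub T F) r e <-> realizes (psub_interp f T r0) F r e.
Proof.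
elim: F r e => [|n i v|F IHF G IHG|F IHF G IHG|F IHF G IHG|F IHF|x F IHF|x F IHF]
  r e //=.
- move=> _ rr; rewrite realizes_ren.
  have E : {in fv (T n i).2, r \o desig (T n i).1 v =1
     fun y => if y \in (T n i).1 then nth 0 (map_tuple r v) (index y (T n i).1) else r0 y}.
    move=> y yF; rewrite /= /desig; case: ifP => yx.
      by rewrite (nth_map 0) // size_tuple -[X in _ < X](size_tuple (T n i).1) index_mem.
    by apply: (rr (n, i)); rewrite ?inE // mem_filter /= yx.
  by split; apply: realizes_fv => y yF; rewrite E.
1-3: move=> /andP[okF okG] rr.
1-3: have {}IHF r' e' := IHF r' e' okF.
1-3: have {}IHG r' e' := IHG r' e' okG.
1-3: have eF : forall p, p \in preds F -> {in params T p, r =1 r0}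
       by move=> p pF; apply: rr; rewrite mem_cat pF.
1-3: have eG : forall p, p \in preds G -> {in params T p, r =1 r0}
       by move=> p pF; apply: rr; rewrite mem_cat pF orbT.
- by rewrite IHF ?IHG.
- by rewrite !IHF ?IHG.
- by split=> H a /(IHF _ _ eF) /H [b [k /(IHG _ _ eG) Hb]]; exists b.
- by move=> ok rr; split=> H a /(IHF _ _ ok rr) /H.
- move=> /andP[/allP nx ok] rr.
  have eF a : forall p, p \in preds F -> {in params T p, upd r x a =1 r0}.
    move=> p pF y yp; rewrite /upd; case: eqP => [e0|_]; last exact: (rr p).
    by have := nx p pF; rewrite -e0 yp.
  by split=> H a; have [b [k Hb]] := H a; exists b; split=> //;
    apply/(IHF _ _ ok (eF a)).
- move=> /andP[/allP nx ok] rr; apply: IHF => // p pF y yp.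
  rewrite /upd; case: eqP => [e0|_]; last exact: (rr p).
  by have := nx p pF; rewrite -e0 yp.
Qed.

(** * Soundness of intuitionistic predicate logic *)

(** One code for all interpretations, which computes a realizer from the values
of the free variables. *)
Definition sound F := exists c, forall f s, cwp c [:: s] (realizes f F (dec s)).

Lemma soundI F t : (forall f s, wp t [:: s] (realizes f F (dec s))) -> sound F.
Proof. by move=> H; exists (t 1). Qed.

Definition uniformly_realized F := exists e, forall f r, realizes f F r e.

(** A number that realizes [F] under all interpretations does so under the one
induced by the substitution. *)
Lemma sound_instance F F' : uniformly_realized F -> instance F F' -> sound F'.
Proof.
move=> [e He] [T [_ ok ->]]; apply: (@soundI _ (tC e)) => f s.
by apply: wp_C; apply/(realizes_psub _ _ ok (r0 := dec s)).
Qed.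

(** The code of a closed formula may be run on any assignment; its value is a
single number because the code does not depend on the interpretation. *)
Lemma sound_closed F : closed_form F -> sound F -> uniformly_realized F.
Proof.
move=> /nilP cl [c H].
have [e [ev _]] := H (fun _ _ => None) 0.
exists e => f r; have [e' [ev' Re]] := H f 0.
by rewrite (eval_fun ev ev'); apply: realizes_fv Re => y; rewrite cl.
Qed.

Section ConnectiveRules.
Variables (f : interp) (r : nat -> nat) (v : seq nat).

Lemma wp_imp t F G :
  (forall a, realizes f F r a -> wp t (a :: v) (realizes f G r)) ->
  wp (tLam t) v (realizes f (Imp F G) r).
Proof. by move=> H; apply: wp_lam => e He a /H; apply: He. Qed.

Lemma wp_neg t F :
  (forall a, ~ realizes f F r a) -> wp t v (fun=> True) ->
  wp t v (realizes f (Neg F) r).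
Proof. by move=> H; apply: wp_mono => e _ a /H. Qed.

Lemma wp_all t x F :
  (forall a, wp t (a :: v) (realizes f F (upd r x a))) ->
  wp (tLam t) v (realizes f (All x F) r).
Proof. by move=> H; apply: wp_lam => e He a; apply: He. Qed.

Lemma wp_and s t F G :
  wp s v (realizes f F r) -> wp t v (realizes f G r) ->
  wp (tPair s t) v (realizes f (And F G) r).
Proof.
move=> Hs Ht; apply: wp_pair; apply: wp_mono Hs => a Ha; apply: wp_mono Ht.
by move=> b Hb e /= -> ->.
Qed.

Lemma wp_or1 t F G :
  wp t v (realizes f F r) -> wp (tPair (tC 0) t) v (realizes f (Or F G) r).
Proof.
move=> Ht; apply: wp_pair; apply: wp_C; apply: wp_mono Ht.
by move=> b Hb e /= -> ->; left.
Qed.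

Lemma wp_or2 t F G :
  wp t v (realizes f G r) -> wp (tPair (tC 1) t) v (realizes f (Or F G) r).
Proof.
move=> Ht; apply: wp_pair; apply: wp_C; apply: wp_mono Ht.
by move=> b Hb e /= -> ->; right.
Qed.

Lemma wp_ex s t x F :
  wp s v (fun a => wp t v (realizes f F (upd r x a))) ->
  wp (tPair s t) v (realizes f (Ex x F) r).
Proof.
move=> Hs; apply: wp_pair; apply: wp_mono Hs => a; apply: wp_mono.
by move=> b Hb e /= -> ->.
Qed.

Lemma wp_mp s t F G :
  wp s v (realizes f (Imp F G) r) -> wp t v (realizes f F r) ->
  wp (tApp s t) v (realizes f G r).
Proof.
move=> Hs Ht; apply: wp_app; apply: wp_mono Hs => e He; apply: wp_mono Ht => a.
exact: He.
Qed.

Lemma wp_inst s t x F :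
  wp s v (realizes f (All x F) r) ->
  forall P, wp t v (fun a => forall e, realizes f F (upd r x a) e -> P e) ->
  wp (tApp s t) v P.
Proof.
move=> Hs P Ht; apply: wp_app; apply: wp_mono Hs => e He; apply: wp_mono Ht => a HP.
by have [b [k Hb]] := He a; exists b; split=> //; apply: HP.
Qed.

End ConnectiveRules.

Ltac lam := apply: wp_imp => ? ?.
Ltac hyp := apply: wp_V; assumption.

(** The propositional axioms are realized by the usual lambda terms. In the two
quantifier rules the realizer of the premise is run on the updated assignment,
which agrees with the old one on the side formula. *)
Lemma iqc_sound Ax F : (forall F, Ax F -> sound F) -> IQC Ax F -> sound F.
Proof.
move=> HAx; elim=> {F}.
- exact: HAx.
- by move=> F G; apply: (@soundI _ (tLam (tLam (tV 1)))) => f s; do 2!lam; hyp.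
- move=> F G H; apply: (@soundI _ (tLam (tLam (tLam
    (tApp (tApp (tV 1) (tV 0)) (tApp (tV 2) (tV 0))))))) => f s; do 3!lam.
  by apply: (wp_mp (F := G)); [apply: (wp_mp (F := F)) | apply: (wp_mp (F := F))]; hyp.
- move=> F G; apply: (@soundI _ (tLam (tLam (tPair (tV 1) (tV 0))))) => f s; do 2!lam.
  by apply: wp_and; hyp.
- move=> F G; apply: (@soundI _ (tLam (tFst (tV 0)))) => f s.
  by apply: wp_imp => a [H1 H2]; apply: wp_fst; hyp.
- move=> F G; apply: (@soundI _ (tLam (tSnd (tV 0)))) => f s.
  by apply: wp_imp => a [H1 H2]; apply: wp_snd; hyp.
- move=> F G; apply: (@soundI _ (tLam (tPair (tC 0) (tV 0)))) => f s.
  by lam; apply: wp_or1; hyp.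
- move=> F G; apply: (@soundI _ (tLam (tPair (tC 1) (tV 0)))) => f s.
  by lam; apply: wp_or2; hyp.
- move=> F G H; apply: (@soundI _ (tLam (tLam (tLam
    (tCase (tFst (tV 0)) (tApp (tV 3) (tSnd (tV 1))) (tApp (tV 2) (tSnd (tV 1)))))))) => f s.
  apply: wp_imp => p Hp; apply: wp_imp => q Hq; apply: wp_imp => a Ha.
  apply: wp_case; apply: wp_fst; apply: wp_V => /=.
  by case: Ha => -[-> Ha]; [apply: (wp_mp (F := F)) | apply: (wp_mp (F := G))];
    try hyp; apply: wp_snd; hyp.
- move=> F G; apply: (@soundI _ (tLam (tLam (tC 0)))) => f s.
  apply: wp_imp => p Hp; apply: wp_imp => q Hq; apply: wp_neg; last exact: wp_C.
  by move=> a Ha; have [b [_ Hb]] := Hp a Ha; have [c [_ /(_ _ Hb)[d []]]] := Hq a Ha.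
- move=> F G; apply: (@soundI _ (tLam (tLam (tC 0)))) => f s.
  apply: wp_imp => p Hp; apply: wp_imp => q Hq.
  by have [b []] := Hp _ Hq.
- by move=> F; apply: (@soundI _ (tLam (tC 0))) => f s; apply: wp_imp.
- move=> F x y _; apply: (@soundI _ (tLam (tApp (tV 0) (tDec (tV 1) (tC y))))) => f s.
  apply: wp_imp => a Ha; apply: (wp_inst (f := f) (r := dec s) (x := x) (F := F)).
    by apply: wp_V; exact: Ha.
  apply: wp_op2; apply: wp_V; apply: wp_C => e He.
  apply/realizes_ren; apply: realizes_ext He => z.
  by rewrite /upd /=; case: ifP.
- move=> F x y _; apply: (@soundI _ (tLam (tPair (tDec (tV 1) (tC y)) (tV 0)))) => f s.
  apply: wp_imp => a /realizes_ren Ha; apply: wp_ex; apply: wp_op2; apply: wp_V.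
  apply: wp_C; apply: wp_V; apply: realizes_ext Ha => z.
  by rewrite /upd /=; case: ifP.
- move=> F G _ [c Hc] _ [d Hd].
  apply: (@soundI _ (tApp (tFn d [:: tV 0]) (tFn c [:: tV 0]))) => f s.
  by apply: (wp_mp (F := F)); apply: wp_call1; apply: wp_V.
- move=> F G x xG _ [c Hc].
  apply: (@soundI _ (tLam (tLam (tApp (tFn c [:: tExt (tV 2) (tC x) (tV 0)]) (tV 1))))) => f s.
  apply: wp_imp => g Hg; apply: wp_all => a.
  have E := @dec_ext s x a.
  apply: wp_mono; last first.
    apply: (wp_mp (r := dec (ext s x a)) (F := G)).
      by apply: wp_call1; apply: wp_op3; apply: wp_V; apply: wp_C; apply: wp_V; apply: Hc.
    apply: wp_V; apply: realizes_fv Hg => y yG; rewrite E /upd; case: eqP => // e.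
    by rewrite -e yG in xG.
  by move=> e; apply: realizes_ext.
- move=> F G x xG _ [c Hc].
  apply: (@soundI _ (tLam (tApp (tFn c [:: tExt (tV 1) (tC x) (tFst (tV 0))]) (tSnd (tV 0))))) => f s.
  apply: wp_imp => g; rewrite [realizes _ _ _ _]/=; set a := pr0 g => Hg.
  have E := @dec_ext s x a.
  apply: wp_mono; last first.
    apply: (wp_mp (r := dec (ext s x a)) (F := F)).
      apply: wp_call1; apply: wp_op3; apply: wp_V; apply: wp_C; apply: wp_fst.
      by apply: wp_V; apply: Hc.
    by apply: wp_snd; apply: wp_V; apply: realizes_ext Hg => y; rewrite E.
  move=> e; apply: realizes_fv => y yG; rewrite E /upd; case: eqP => // ey.
  by rewrite -ey yG in xG.
Qed.

(** * The Markov principle *)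

(** Search for the first x at which the decision is positive. If there were
none, no number would realize the existential formula, every number would
realize its negation, and the double negation could not be realized. *)
Lemma markov_realized : uniformly_realized Markov.
Proof.
apply: sound_closed => //.
pose t := tFst (tApp (tFst (tV 1)) (tV 0)).
apply: (@soundI _ (tLam (tPair (tMu t) (tSnd (tApp (tFst (tV 0)) (tMu t)))))) => f s.
apply: wp_imp => p [Hd Hn]; set r := dec s.
(* [g n] is the decision at [n] computed by the realizer. *)
have [g Hg] : exists g : nat -> nat, forall n, ap (pr0 p) n (eq (g n)) /\
    (pr0 (g n) = 0 /\ realizes f (fP 0) (upd r 0 n) (pr1 (g n)) \/
     pr0 (g n) = 1 /\ forall a, ~ realizes f (fP 0) (upd r 0 n) a).
  suff H n : {y | ap (pr0 p) n (eq y) /\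
    (pr0 y = 0 /\ realizes f (fP 0) (upd r 0 n) (pr1 y) \/
     pr0 y = 1 /\ forall a, ~ realizes f (fP 0) (upd r 0 n) a)}.
    by exists (fun n => sval (H n)) => n; apply: (svalP (H n)).
  apply: constructive_indefinite_description.
  have [y [k Hy]] := Hd n; exists y; split; first by exists y.
  case: Hy => -[y0 Hy]; [by left | right; split=> // a Ha].
  by have [b []] := Hy a Ha.
have [n Hn0] : exists n, pr0 (g n) = 0.
  apply: NNPP => no.
  have N a : ~ realizes f (Ex 0 (fP 0)) r a.
    move=> Ha; apply: no; exists (pr0 a).
    by have [_ []] := Hg (pr0 a); [case | case=> _ /(_ _ Ha)].
  have [|b [_ []]] := Hn 0; first by move=> a /N.
have [m [em m0]] : wp (tMu t) [:: p; s] (fun m => pr0 (g m) = 0).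
  apply: (wp_mu (g := pr0 \o g) Hn0) => [m _ _|//].
  apply: wp_fst; apply: wp_app; apply: wp_fst; apply: wp_V.
  by apply: wp_V; have [+ _] := Hg m; apply: ap_mono => z <-.
apply: wp_ex; exists m; split=> //; apply: wp_snd; apply: wp_app; apply: wp_fst.
apply: wp_V; exists m; split=> //; have [+ Hm] := Hg m; apply: ap_mono => z <-.
by case: Hm => -[]; rewrite m0.
Qed.

(** * The realizers of Q *)
Fixpoint upds (r : nat -> nat) (xs args : seq nat) : nat -> nat :=
  match xs, args with
  | x :: xs, a :: args => upds (upd r x a) xs args
  | _, _ => r
  end.

Fixpoint tApps (t : term) (i k : nat) : term :=
  if k is k'.+1 then tApps (tApp t (tV i)) i.+1 k' else t.

Lemma wp_alls f xs args r F v t i :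
  size args = size xs ->
  (forall j, j < size xs -> nth 0 v (i + j) = nth 0 args j) ->
  wp t v (realizes f (Alls xs F) r) ->
  wp (tApps t i (size xs)) v (realizes f F (upds r xs args)).
Proof.
elim: xs args r t i => [|x xs IH] [|a args] r t i //= [sz] E Ht.
apply: IH => // [j lt|]; first by have := E j.+1 lt; rewrite addnS.
apply: wp_inst Ht _ _; apply: wp_V; have := E 0 isT; rewrite addn0 => -> //.
Qed.

Fixpoint realize_all f (Fs : seq form) r es : Prop :=
  match Fs, es with
  | [::], [::] => True
  | F :: Fs, e :: es => realizes f F r e /\ realize_all f Fs r es
  | _, _ => False
  end.

Lemma realize_all_size f Fs r es : realize_all f Fs r es -> size es = size Fs.
Proof. by elim: Fs es => [|F Fs IH] [|e es] //= [_ /IH ->]. Qed.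

Fixpoint tTuple i k : term :=
  if k is k'.+1 then tPair (tV i) (tTuple i.+1 k') else tV i.

Lemma wp_ands f r Fs F es v i :
  (forall j, j <= size Fs -> nth 0 v (i + j) = nth 0 es j) ->
  realize_all f (F :: Fs) r es ->
  wp (tTuple i (size Fs)) v (realizes f (Ands F Fs) r).
Proof.
elim: Fs F es i => [|G Gs IH] F [|e es] i //= E [He Hes].
  by apply: wp_V; have := E 0 isT; rewrite addn0 => ->.
apply: wp_and; first by apply: wp_V; have := E 0 isT; rewrite addn0 => ->.
by apply: IH Hes => j le; have := E j.+1 le; rewrite addnS.
Qed.

Lemma ands_proj F Fs j : j <= size Fs -> {c | forall f r q,
  realizes f (Ands F Fs) r q -> cwp c [:: q] (realizes f (nth Bot (F :: Fs) j) r)}.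
Proof.
elim: Fs F j => [|G Gs IH] F [|j] //= le.
- by exists (tV 0 1) => f r q Hq; apply: (@wp_V 0 [:: q]).
- by exists (tFst (tV 0) 1) => f r q [Hq _]; apply: (@wp_fst (tV 0) [:: q]); apply: wp_V.
have [c cP] := IH G j le.
exists (tFn c [:: tSnd (tV 0)] 1) => f r q [_ Hq].
by apply: (@wp_call1 c (tSnd (tV 0)) [:: q]); apply: wp_snd; apply: wp_V; apply: cP.
Qed.

Section Model.
Variables (G B : form).

(** [q] makes [f] a structure on the natural numbers in which an atom counts as
true if it has a realizer. *)
Definition model f q := exists r, realizes f (Q G B) r q.

Definition Q_axioms := A1 :: arith_axioms ++ [:: A26 G; A27 G B; A28 B].

(** Conjuncts are numbered from 0: the axiom A_i of Q has index i - 1. *)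
Lemma axiom_rule j xs F : j <= 27 -> nth Bot Q_axioms j = Alls xs F ->
  {c | forall f r q args, realizes f (Q G B) r q -> size args = size xs ->
     cwp c (q :: args) (realizes f F (upds r xs args))}.
Proof.
move=> le E; have [|c cP] := @ands_proj A1 (arith_axioms ++ [:: A26 G; A27 G B; A28 B]) j.
  exact: le.
exists (tApps (tFn c [:: tV 0]) 1 (size xs) (size xs).+1) => f r q args Hq sz.
have := @wp_alls f xs args r F (q :: args) (tFn c [:: tV 0]) 1 sz.
rewrite /wp /= sz; apply => //; apply: (@wp_call1 c (tV 0) (q :: args)); apply: wp_V.
by have := cP _ _ _ Hq; rewrite -/(nth Bot Q_axioms j) E.
Qed.

(** An axiom that is an implication acts as a rule, which computes a realizer of
the conclusion from [q], the individuals and the realizers of the premises. *)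
Lemma imp_rule j xs P Ps C : j <= 27 ->
  nth Bot Q_axioms j = Alls xs (Imp (Ands P Ps) C) ->
  {c | forall f q, model f q -> exists r, forall args es, size args = size xs ->
     realize_all f (P :: Ps) (upds r xs args) es ->
     cwp c (q :: args ++ es) (realizes f C (upds r xs args))}.
Proof.
move=> le E; have [c cP] := axiom_rule le E.
set k := size xs; set m := size Ps.
pose t := tApp (tFn c (tV 0 :: [seq tV i | i <- iota 1 k])) (tTuple k.+1 m).
exists (t (k + m).+2) => f q [r Hq]; exists r => args es sz Hes.
set v := q :: args ++ es.
have szes : size es = m.+1 := realize_all_size Hes.
have -> : (k + m).+2 = size v by rewrite /v /= size_cat szes sz addnS.
apply: (@wp_mp _ _ v _ _ (Ands P Ps)).
  have [e [ee He]] := cP _ _ _ args Hq sz; exists e; split=> //.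
  apply: (@eval_comp _ _ _ (q :: args)) ee; first by rewrite /= !size_map size_iota sz.
  rewrite /= !size_map size_iota => -[|i] lt; first exact: eval_proj.
  rewrite /= (nth_map (tC 0)) ?size_map ?size_iota // (nth_map 0) ?size_iota //.
  rewrite nth_iota // (_ : nth 0 args i = nth 0 v (1 + i)); first exact: eval_proj.
  by move: lt; rewrite ltnS /= nth_cat sz -/k => ->.
apply: wp_ands Hes => j' _; rewrite /= nth_cat sz ltnNge leq_addr /=.
by rewrite addKn.
Qed.
End Model.

(** The arguments are a sequence, since tuples with the same entries may carry
different proofs of their size. *)
Definition atom_realizes (f : interp) n i (s : seq nat) (e : nat) : Prop :=
  exists2 t : n.-tuple nat, tval t = s & if f n i is Some p then p t e else False.

Lemma realizes_atom f n i (v : n.-tuple nat) r e :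
  realizes f (Atom i v) r e <-> atom_realizes f n i (map r v) e.
Proof.
split; first by exists (map_tuple r v).
by move=> [t tE H]; rewrite /= (_ : map_tuple r v = t) //; apply: val_inj; apply: esym.
Qed.

Section AxiomRules.
Variables (G B : form).
Notation model := (model G B).

Section Atoms.
Variable f : interp.
Definition rZ x := atom_realizes f 1 0 [:: x].
Definition rE x y := atom_realizes f 2 0 [:: x; y].
Definition rS x y := atom_realizes f 2 1 [:: x; y].
Definition rA x y z := atom_realizes f 3 0 [:: x; y; z].
Definition rM x y z := atom_realizes f 3 1 [:: x; y; z].
End Atoms.

Ltac by_axiom H args es :=
  refine (cwp_mono _ (H args es erefl _));
  [by move=> e /realizes_atom | by do ?split; apply/realizes_atom].

Lemma E_of_S : {C | forall f q, model f q -> forall x y z a b,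
  rS f x z a -> rS f y z b -> cwp C [:: q; x; y; z; a; b] (rE f x y)}.
Proof.
have [C CP] := @imp_rule G B 0 [:: 0; 1; 2] (fS 0 2) [:: fS 1 2] (fE 0 1) isT erefl.
exists C => f q /CP[r H] x y z a b *; by_axiom H [:: x; y; z] [:: a; b].
Qed.

Lemma E_eucl : {C | forall f q, model f q -> forall x y z a b,
  rE f x y a -> rE f x z b -> cwp C [:: q; x; y; z; a; b] (rE f y z)}.
Proof.
have [C CP] := @imp_rule G B 2 [:: 0; 1; 2] (fE 0 1) [:: fE 0 2] (fE 1 2) isT erefl.
exists C => f q /CP[r H] x y z a b *; by_axiom H [:: x; y; z] [:: a; b].
Qed.

Lemma S_substl : {C | forall f q, model f q -> forall x y z a b,
  rE f x y a -> rS f x z b -> cwp C [:: q; x; y; z; a; b] (rS f y z)}.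
Proof.
have [C CP] := @imp_rule G B 3 [:: 0; 1; 2] (fE 0 1) [:: fS 0 2] (fS 1 2) isT erefl.
exists C => f q /CP[r H] x y z a b *; by_axiom H [:: x; y; z] [:: a; b].
Qed.

Lemma A_zero : {C | forall f q, model f q -> forall x y a,
  rZ f y a -> cwp C [:: q; x; y; a] (rA f x y x)}.
Proof.
have [C CP] := @imp_rule G B 4 [:: 0; 1] (fZ 1) [:: ] (fA 0 1 0) isT erefl.
exists C => f q /CP[r H] x y a *; by_axiom H [:: x; y] [:: a].
Qed.

Lemma A_succ : {C | forall f q, model f q -> forall x y z u v a b c,
  rS f y z a -> rA f x y u b -> rS f u v c -> cwp C [:: q; x; y; z; u; v; a; b; c] (rA f x z v)}.
Proof.
have [C CP] := @imp_rule G B 5 [:: 0; 1; 2; 3; 4] (fS 1 2) [:: fA 0 1 3; fS 3 4] (fA 0 2 4) isT erefl.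
exists C => f q /CP[r H] x y z u v a b c *; by_axiom H [:: x; y; z; u; v] [:: a; b; c].
Qed.

Lemma M_zero : {C | forall f q, model f q -> forall x y a,
  rZ f y a -> cwp C [:: q; x; y; a] (rM f x y y)}.
Proof.
have [C CP] := @imp_rule G B 6 [:: 0; 1] (fZ 1) [:: ] (fM 0 1 1) isT erefl.
exists C => f q /CP[r H] x y a *; by_axiom H [:: x; y] [:: a].
Qed.

Lemma M_succ : {C | forall f q, model f q -> forall x y z u v a b c,
  rS f y z a -> rM f x y u b -> rA f u x v c -> cwp C [:: q; x; y; z; u; v; a; b; c] (rM f x z v)}.
Proof.
have [C CP] := @imp_rule G B 7 [:: 0; 1; 2; 3; 4] (fS 1 2) [:: fM 0 1 3; fA 3 0 4] (fM 0 2 4) isT erefl.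
exists C => f q /CP[r H] x y z u v a b c *; by_axiom H [:: x; y; z; u; v] [:: a; b; c].
Qed.

Lemma A_subst1 : {C | forall f q, model f q -> forall x1 x2 y z a b,
  rE f x1 x2 a -> rA f x1 y z b -> cwp C [:: q; x1; x2; y; z; a; b] (rA f x2 y z)}.
Proof.
have [C CP] := @imp_rule G B 8 [:: 5; 6; 1; 2] (fE 5 6) [:: fA 5 1 2] (fA 6 1 2) isT erefl.
exists C => f q /CP[r H] x1 x2 y z a b *; by_axiom H [:: x1; x2; y; z] [:: a; b].
Qed.

Lemma A_subst2 : {C | forall f q, model f q -> forall x y1 y2 z a b,
  rE f y1 y2 a -> rA f x y1 z b -> cwp C [:: q; x; y1; y2; z; a; b] (rA f x y2 z)}.
Proof.
have [C CP] := @imp_rule G B 9 [:: 0; 7; 8; 2] (fE 7 8) [:: fA 0 7 2] (fA 0 8 2) isT erefl.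
exists C => f q /CP[r H] x y1 y2 z a b *; by_axiom H [:: x; y1; y2; z] [:: a; b].
Qed.

Lemma M_subst1 : {C | forall f q, model f q -> forall x1 x2 y z a b,
  rE f x1 x2 a -> rM f x1 y z b -> cwp C [:: q; x1; x2; y; z; a; b] (rM f x2 y z)}.
Proof.
have [C CP] := @imp_rule G B 10 [:: 5; 6; 1; 2] (fE 5 6) [:: fM 5 1 2] (fM 6 1 2) isT erefl.
exists C => f q /CP[r H] x1 x2 y z a b *; by_axiom H [:: x1; x2; y; z] [:: a; b].
Qed.

Lemma M_subst2 : {C | forall f q, model f q -> forall x y1 y2 z a b,
  rE f y1 y2 a -> rM f x y1 z b -> cwp C [:: q; x; y1; y2; z; a; b] (rM f x y2 z)}.
Proof.
have [C CP] := @imp_rule G B 11 [:: 0; 7; 8; 2] (fE 7 8) [:: fM 0 7 2] (fM 0 8 2) isT erefl.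
exists C => f q /CP[r H] x y1 y2 z a b *; by_axiom H [:: x; y1; y2; z] [:: a; b].
Qed.

Lemma E_zeros : {C | forall f q, model f q -> forall x y a b,
  rZ f x a -> rZ f y b -> cwp C [:: q; x; y; a; b] (rE f x y)}.
Proof.
have [C CP] := @imp_rule G B 14 [:: 0; 1] (fZ 0) [:: fZ 1] (fE 0 1) isT erefl.
exists C => f q /CP[r H] x y a b *; by_axiom H [:: x; y] [:: a; b].
Qed.

Lemma Z_subst : {C | forall f q, model f q -> forall x y a b,
  rE f x y a -> rZ f x b -> cwp C [:: q; x; y; a; b] (rZ f y)}.
Proof.
have [C CP] := @imp_rule G B 15 [:: 0; 1] (fE 0 1) [:: fZ 0] (fZ 1) isT erefl.
exists C => f q /CP[r H] x y a b *; by_axiom H [:: x; y] [:: a; b].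
Qed.

Lemma S_fun : {C | forall f q, model f q -> forall x y z a b,
  rS f x y a -> rS f x z b -> cwp C [:: q; x; y; z; a; b] (rE f y z)}.
Proof.
have [C CP] := @imp_rule G B 17 [:: 0; 1; 2] (fS 0 1) [:: fS 0 2] (fE 1 2) isT erefl.
exists C => f q /CP[r H] x y z a b *; by_axiom H [:: x; y; z] [:: a; b].
Qed.

Lemma S_substr : {C | forall f q, model f q -> forall x y z a b,
  rS f x y a -> rE f y z b -> cwp C [:: q; x; y; z; a; b] (rS f x z)}.
Proof.
have [C CP] := @imp_rule G B 18 [:: 0; 1; 2] (fS 0 1) [:: fE 1 2] (fS 0 2) isT erefl.
exists C => f q /CP[r H] x y z a b *; by_axiom H [:: x; y; z] [:: a; b].
Qed.

Lemma A_fun : {C | forall f q, model f q -> forall x y z1 z2 a b,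
  rA f x y z1 a -> rA f x y z2 b -> cwp C [:: q; x; y; z1; z2; a; b] (rE f z1 z2)}.
Proof.
have [C CP] := @imp_rule G B 20 [:: 0; 1; 9; 10] (fA 0 1 9) [:: fA 0 1 10] (fE 9 10) isT erefl.
exists C => f q /CP[r H] x y z1 z2 a b *; by_axiom H [:: x; y; z1; z2] [:: a; b].
Qed.

Lemma A_subst3 : {C | forall f q, model f q -> forall x y z1 z2 a b,
  rA f x y z1 a -> rE f z1 z2 b -> cwp C [:: q; x; y; z1; z2; a; b] (rA f x y z2)}.
Proof.
have [C CP] := @imp_rule G B 21 [:: 0; 1; 9; 10] (fA 0 1 9) [:: fE 9 10] (fA 0 1 10) isT erefl.
exists C => f q /CP[r H] x y z1 z2 a b *; by_axiom H [:: x; y; z1; z2] [:: a; b].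
Qed.

Lemma M_fun : {C | forall f q, model f q -> forall x y z1 z2 a b,
  rM f x y z1 a -> rM f x y z2 b -> cwp C [:: q; x; y; z1; z2; a; b] (rE f z1 z2)}.
Proof.
have [C CP] := @imp_rule G B 23 [:: 0; 1; 9; 10] (fM 0 1 9) [:: fM 0 1 10] (fE 9 10) isT erefl.
exists C => f q /CP[r H] x y z1 z2 a b *; by_axiom H [:: x; y; z1; z2] [:: a; b].
Qed.

Lemma M_subst3 : {C | forall f q, model f q -> forall x y z1 z2 a b,
  rM f x y z1 a -> rE f z1 z2 b -> cwp C [:: q; x; y; z1; z2; a; b] (rM f x y z2)}.
Proof.
have [C CP] := @imp_rule G B 24 [:: 0; 1; 9; 10] (fM 0 1 9) [:: fE 9 10] (fM 0 1 10) isT erefl.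
exists C => f q /CP[r H] x y z1 z2 a b *; by_axiom H [:: x; y; z1; z2] [:: a; b].
Qed.


End AxiomRules.

(** * Equality and numerals *)

(** The value of a code where it is defined. *)
Definition output c v := epsilon (inhabits 0) (eval c v).

Lemma cwp_output c v P : cwp c v P -> eval c v (output c v) /\ P (output c v).
Proof.
move=> [z [ez Pz]]; have ev : eval c v (output c v) by apply: epsilon_spec; exists z.
by rewrite -(eval_fun ez ev).
Qed.

Lemma cwp_ev c v z (P : nat -> Prop) : eval c v z -> P z -> cwp c v P.
Proof. by exists z. Qed.

Lemma cwp_term t v P : wp t v P -> cwp (t (size v)) v P.
Proof. by []. Qed.

(** [ev] computes a precondition until a code known only by its specification
has to be run; [use] then runs it. *)
Ltac ev1 := match goal with
  | |- wp (tV _) _ _ => apply: wp_V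
  | |- wp (tC _) _ _ => apply: wp_C
  | |- wp (tFst _) _ _ => apply: wp_fst
  | |- wp (tSnd _) _ _ => apply: wp_snd
  | |- wp (tPair _ _) _ _ => apply: wp_pair
  | |- wp (tFn _ _) _ _ => apply: wp_call
  | |- wp (op1 _ _) _ _ => apply: wp_op1
  | |- wp (op2 _ _ _) _ _ => apply: wp_op2
  | |- wp (tExt _ _ _) _ _ => apply: wp_op3
  | |- wp (tDec _ _) _ _ => apply: wp_op2
  | |- wp (tCase _ _ _) _ _ => apply: wp_case
  | |- wp (tApp _ _) _ _ => apply: wp_app
  | |- wps _ _ _ => rewrite /wps
  end; cbv beta iota; rewrite ?[nth _ _ _]/=.
Ltac ev := cbv beta zeta; repeat ev1.
Ltac use H := ev; refine (cwp_mono _ H).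
Ltac by_rule R := ev; (eapply (svalP R); eassumption).

Section Numerals.
Variables (G B : form).
Notation model := (model G B).
Notation call R := (tFn (sval R)).

Lemma zero_exists : {C | forall f q, model f q ->
  cwp C [:: q] (fun e => rZ f (pr0 e) (pr1 e))}.
Proof.
have [C CP] := @axiom_rule G B 13 [::] A14 isT erefl.
exists C => f q [r Hq]; apply: cwp_mono (CP f r q [::] Hq erefl) => e.
by move/realizes_atom.
Qed.

Lemma succ_exists : {C | forall f q, model f q -> forall x,
  cwp C [:: q; x] (fun e => rS f x (pr0 e) (pr1 e))}.
Proof.
have [C CP] := @axiom_rule G B 16 [:: 0] (Ex 1 (fS 0 1)) isT erefl.
exists C => f q [r Hq] x; apply: cwp_mono (CP f r q [:: x] Hq erefl) => e.
by move/realizes_atom.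
Qed.

Lemma add_exists : {C | forall f q, model f q -> forall x y,
  cwp C [:: q; x; y] (fun e => rA f x y (pr0 e) (pr1 e))}.
Proof.
have [C CP] := @axiom_rule G B 19 [:: 0; 1] (Ex 2 (fA 0 1 2)) isT erefl.
exists C => f q [r Hq] x y; apply: cwp_mono (CP f r q [:: x; y] Hq erefl) => e.
by move/realizes_atom.
Qed.

Lemma zero_or_pred : {C | forall f q, model f q -> forall x,
  cwp C [:: q; x] (fun e => pr0 e = 0 /\ rZ f x (pr1 e) \/
                     pr0 e = 1 /\ rS f (pr0 (pr1 e)) x (pr1 (pr1 e)))}.
Proof.
have [C CP] := @axiom_rule G B 12 [:: 0] (Or (fZ 0) (Ex 1 (fS 1 0))) isT erefl.
exists C => f q [r Hq] x; apply: cwp_mono (CP f r q [:: x] Hq erefl) => e.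
by case=> -[-> /realizes_atom]; [left | right].
Qed.

(** By A17 and A1: [x] and [x] have a common successor. *)
Lemma E_refl : {C | forall f q, model f q -> forall x, cwp C [:: q; x] (rE f x x)}.
Proof.
pose s := call succ_exists [:: tV 0; tV 1].
pose t := call (E_of_S G B) [:: tV 0; tV 1; tV 1; tFst s; tSnd s; tSnd s].
exists (t 2) => f q m x; apply: (@cwp_term t).
have [es Hs] := cwp_output (svalP succ_exists f q m x).
by do 3!(rewrite /t; ev; rewrite /s; ev; apply: (cwp_ev es)); by_rule (E_of_S G B).
Qed.

Lemma E_sym : {C | forall f q, model f q -> forall x y a,
  rE f x y a -> cwp C [:: q; x; y; a] (rE f y x)}.
Proof.
pose t := call (E_eucl G B) [:: tV 0; tV 1; tV 2; tV 1; tV 3; call E_refl [:: tV 0; tV 1]].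
exists (t 4) => f q m x y a Ha; apply: (@cwp_term t); rewrite /t; ev.
use (svalP E_refl f q m x) => e He; by_rule (E_eucl G B).
Qed.

Lemma E_trans : {C | forall f q, model f q -> forall x y z a b,
  rE f x y a -> rE f y z b -> cwp C [:: q; x; y; z; a; b] (rE f x z)}.
Proof.
pose t := call (E_eucl G B) [:: tV 0; tV 2; tV 1; tV 3;
   call E_sym [:: tV 0; tV 1; tV 2; tV 4]; tV 5].
exists (t 6) => f q m x y z a b Ha Hb; apply: (@cwp_term t); rewrite /t; ev.
use (svalP E_sym f q m x y a Ha) => e He; by_rule (E_eucl G B).
Qed.

(** The numerals of the structure: the witness of A14, followed by iterated
witnesses of A17. *)
Fixpoint nu q n : nat :=
  if n is k.+1 then pr0 (output (sval succ_exists) [:: q; nu q k])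
  else pr0 (output (sval zero_exists) [:: q]).

Lemma nu_code : {C | forall f q, model f q -> forall n, eval C [:: q; n] (nu q n)}.
Proof.
pose t := tRec (tV 1) (tFst (call zero_exists [:: tV 0]))
   (tFst (call succ_exists [:: tV 2; tV 1])).
exists (t 2) => f q m n.
suff [z [ez <-]] : wp t [:: q; n] (fun z => z = nu q n) by [].
apply: (wp_rec (J := fun i y => y = nu q i)); ev; split=> // [|i y _ ->]; ev.
  by have [es _] := cwp_output (svalP zero_exists f q m); apply: (cwp_ev es).
by have [es _] := cwp_output (svalP succ_exists f q m (nu q i)); apply: (cwp_ev es).
Qed.

Lemma wp_nu f q n P : model f q -> P (nu q n) -> cwp (sval nu_code) [:: q; n] P.
Proof. by move=> m Pn; exists (nu q n); split=> //; apply: (svalP nu_code f). Qed.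

Lemma Z_nu : {C | forall f q, model f q -> cwp C [:: q] (rZ f (nu q 0))}.
Proof.
pose t := tSnd (call zero_exists [:: tV 0]).
exists (t 1) => f q m; apply: (@cwp_term t); rewrite /t; ev.
by have [es Hs] := cwp_output (svalP zero_exists f q m); apply: (cwp_ev es).
Qed.

Lemma S_nu : {C | forall f q, model f q -> forall n,
  cwp C [:: q; n] (rS f (nu q n) (nu q n.+1))}.
Proof.
pose t := tSnd (call succ_exists [:: tV 0; call nu_code [:: tV 0; tV 1]]).
exists (t 2) => f q m n; apply: (@cwp_term t); rewrite /t; ev.
apply: (wp_nu m).
by have [es Hs] := cwp_output (svalP succ_exists f q m (nu q n)); apply: (cwp_ev es).
Qed.

Notation num q n := (call nu_code [:: q; n]).

Lemma A_nu : {C | forall f q, model f q -> forall n k,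
  cwp C [:: q; n; k] (rA f (nu q n) (nu q k) (nu q (n + k)))}.
Proof.
pose t := tRec (tV 2)
  (call (A_zero G B) [:: tV 0; num (tV 0) (tV 1); num (tV 0) (tC 0); call Z_nu [:: tV 0]])
  (let i := tV 0 in let q := tV 2 in let s := op2 rec_addn (tV 3) i in
   call (A_succ G B) [:: q; num q (tV 3); num q i; num q (op1 rec_S i);
      num q s; num q (op1 rec_S s);
      call S_nu [:: q; i]; tV 1; call S_nu [:: q; s]]).
exists (t 3) => f q m n k; apply: (@cwp_term t [:: q; n; k]).
apply: (wp_rec (J := fun i => rA f (nu q n) (nu q i) (nu q (n + i)))); ev.
split=> // [|i y _ Hy]; ev.
  rewrite addn0; do 2!(apply: (wp_nu m); ev); use (svalP Z_nu f q m) => z Hz.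
  by_rule (A_zero G B).
rewrite addnS; do 5!(apply: (wp_nu m); ev).
use (svalP S_nu f q m i) => e He; ev.
use (svalP S_nu f q m (n + i)) => e' He'.
by_rule (A_succ G B).
Qed.

Lemma M_nu : {C | forall f q, model f q -> forall n k,
  cwp C [:: q; n; k] (rM f (nu q n) (nu q k) (nu q (n * k)))}.
Proof.
pose t := tRec (tV 2)
  (call (M_zero G B) [:: tV 0; num (tV 0) (tV 1); num (tV 0) (tC 0); call Z_nu [:: tV 0]])
  (let i := tV 0 in let q := tV 2 in let s := op2 rec_muln (tV 3) i in
   call (M_succ G B) [:: q; num q (tV 3); num q i; num q (op1 rec_S i);
      num q s; num q (op2 rec_addn s (tV 3));
      call S_nu [:: q; i]; tV 1; call A_nu [:: q; s; tV 3]]).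
exists (t 3) => f q m n k; apply: (@cwp_term t [:: q; n; k]).
apply: (wp_rec (J := fun i => rM f (nu q n) (nu q i) (nu q (n * i)))); ev.
split=> // [|i y _ Hy]; ev.
  rewrite muln0; do 2!(apply: (wp_nu m); ev); use (svalP Z_nu f q m) => z Hz.
  by_rule (M_zero G B).
rewrite mulnSr; do 5!(apply: (wp_nu m); ev).
use (svalP S_nu f q m i) => e He; ev.
use (svalP A_nu f q m (n * i) n) => e' He'.
by_rule (M_succ G B).
Qed.

End Numerals.

(** * Standard elements *)
Section Standard.
Variables (G B : form).
Notation model := (model G B).
Notation call R := (tFn (sval R)).
Notation num q n := (call (nu_code G B) [:: q; n]).
Notation nu := (nu G B).

(** [a] is equal to the [n]-th numeral in the structure. *)
Definition std f q a n := exists e, rE f a (nu q n) e.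

Lemma S_not_Z f q : model f q -> forall x y a b, rS f x y a -> rZ f y b -> False.
Proof.
have [C CP] := @axiom_rule G B 1 [:: 0; 1] (Imp (fS 0 1) (Neg (fZ 1))) isT erefl.
move=> [r Hq] x y a b Ha Hb; have [e [_ He]] := CP f r q [:: x; y] Hq erefl.
have ra : realizes f (fS 0 1) (upds r [:: 0; 1] [:: x; y]) a by apply/realizes_atom.
have rb : realizes f (fZ 1) (upds r [:: 0; 1] [:: x; y]) b by apply/realizes_atom.
by have [d [_ /(_ _ rb)[c []]]] := He a ra.
Qed.

Section Facts.
Variables (f : interp) (q : nat) (m : model f q).
Notation stdq := (std f q).

Lemma Z_nu_inv n e : rZ f (nu q n) e -> n = 0.
Proof.
case: n => // n He; have [d [_ Hd]] := svalP (S_nu G B) f q m n.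
by have := S_not_Z m Hd He.
Qed.

Lemma nu_inj n k e : rE f (nu q n) (nu q k) e -> n = k.
Proof.
have [z [_ Hz]] := svalP (Z_nu G B) f q m.
have S i := svalP (S_nu G B) f q m i.
elim: n k e => [|n IH] [|k] e He //.
- have [d [_ Hd]] := svalP (Z_subst G B) f q m _ _ _ _ He Hz.
  by have := Z_nu_inv Hd.
- have [e' [_ He']] := svalP (E_sym G B) f q m _ _ _ He.
  have [d [_ Hd]] := svalP (Z_subst G B) f q m _ _ _ _ He' Hz.
  by have := Z_nu_inv Hd.
have [s [_ Hs]] := S n; have [t [_ Ht]] := S k.
have [d [_ Hd]] := svalP (S_substr G B) f q m _ _ _ _ _ Hs He.
have [e' [_ He']] := svalP (E_of_S G B) f q m _ _ _ _ _ Hd Ht.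
by rewrite (IH _ _ He').
Qed.

Lemma std_unique a n k : stdq a n -> stdq a k -> n = k.
Proof.
move=> [d Hd] [e He]; have [e' [_ He']] := svalP (E_eucl G B) f q m _ _ _ _ _ Hd He.
exact: nu_inj He'.
Qed.

Lemma std_nu n : stdq (nu q n) n.
Proof. by have [e [_ He]] := svalP (E_refl G B) f q m (nu q n); exists e. Qed.

Lemma std_Z a e : rZ f a e -> stdq a 0.
Proof.
move=> He; have [z [_ Hz]] := svalP (Z_nu G B) f q m.
by have [d [_ Hd]] := svalP (E_zeros G B) f q m _ _ _ _ He Hz; exists d.
Qed.

Lemma std_Z0 a n e : stdq a n -> rZ f a e -> n = 0.
Proof. by move=> Ha /std_Z Hz; apply: std_unique Ha Hz. Qed.

Lemma std_S a b n e : rS f a b e -> stdq a n -> stdq b n.+1.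
Proof.
move=> He [d Hd]; have [s [_ Hs]] := svalP (S_nu G B) f q m n.
have [t [_ Ht]] := svalP (S_substl G B) f q m _ _ _ _ _ Hd He.
by have [c [_ Hc]] := svalP (S_fun G B) f q m _ _ _ _ _ Ht Hs; exists c.
Qed.

Lemma std_pred a b n e : rS f a b e -> stdq b n.+1 -> stdq a n.
Proof.
move=> He [d Hd]; have [s [_ Hs]] := svalP (S_nu G B) f q m n.
have [t [_ Ht]] := svalP (S_substr G B) f q m _ _ _ _ _ He Hd.
by have [c [_ Hc]] := svalP (E_of_S G B) f q m _ _ _ _ _ Ht Hs; exists c.
Qed.

Lemma std_S0 a b e : rS f a b e -> ~ stdq b 0.
Proof.
move=> He [d Hd]; have [z [_ Hz]] := svalP (Z_nu G B) f q m.
have [d' [_ Hd']] := svalP (E_sym G B) f q m _ _ _ Hd.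
have [t [_ Ht]] := svalP (Z_subst G B) f q m _ _ _ _ Hd' Hz.
exact: S_not_Z m _ _ _ _ He Ht.
Qed.

Lemma std_E a b n e : rE f a b e -> stdq a n -> stdq b n.
Proof.
move=> He [d Hd].
by have [c [_ Hc]] := svalP (E_eucl G B) f q m _ _ _ _ _ He Hd; exists c.
Qed.

Lemma std_Esym a b n e : rE f a b e -> stdq b n -> stdq a n.
Proof.
move=> He; have [d [_ Hd]] := svalP (E_sym G B) f q m _ _ _ He; exact: std_E Hd.
Qed.

Lemma std_A a b c n k e : rA f a b c e -> stdq a n -> stdq b k -> stdq c (n + k).
Proof.
move=> He [d Hd] [d' Hd'].
have [e1 [_ He1]] := svalP (A_subst1 G B) f q m _ _ _ _ _ _ Hd He.
have [e2 [_ He2]] := svalP (A_subst2 G B) f q m _ _ _ _ _ _ Hd' He1.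
have [e3 [_ He3]] := svalP (A_nu G B) f q m n k.
by have [e4 [_ He4]] := svalP (A_fun G B) f q m _ _ _ _ _ _ He2 He3; exists e4.
Qed.

Lemma std_M a b c n k e : rM f a b c e -> stdq a n -> stdq b k -> stdq c (n * k).
Proof.
move=> He [d Hd] [d' Hd'].
have [e1 [_ He1]] := svalP (M_subst1 G B) f q m _ _ _ _ _ _ Hd He.
have [e2 [_ He2]] := svalP (M_subst2 G B) f q m _ _ _ _ _ _ Hd' He1.
have [e3 [_ He3]] := svalP (M_nu G B) f q m n k.
by have [e4 [_ He4]] := svalP (M_fun G B) f q m _ _ _ _ _ _ He2 He3; exists e4.
Qed.

(** From w + a = b with b the k-th numeral, either a is zero or A13 gives a
predecessor a' of a; then b is the successor of w + a', so b is not zero and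
w + a' is the numeral of k - 1. *)
Lemma std_le w a b k e : rA f w a b e -> stdq b k -> exists2 n, n <= k & stdq a n.
Proof.
elim: k a b e => [|k IH] a b e He Hb.
all: have [d [_ Hd]] := svalP (zero_or_pred G B) f q m a.
all: case: Hd => -[_]; [by move=> /std_Z; exists 0 | set a' := pr0 _ => Ha'].
all: have [t [_ Ht]] := svalP (add_exists G B) f q m w a'.
all: have [s [_ Hs]] := svalP (succ_exists G B) f q m (pr0 t).
all: have [e1 [_ He1]] := svalP (A_succ G B) f q m _ _ _ _ _ _ _ _ Ha' Ht Hs.
all: have [e2 [_ He2]] := svalP (A_fun G B) f q m _ _ _ _ _ _ He1 He.
all: have Hsb := std_Esym He2 Hb.
- by have := std_S0 Hs Hsb.
have [n le Hn] := IH _ _ _ Ht (std_pred Hs Hsb).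
by exists n.+1 => //; apply: std_S Ha' Hn.
Qed.

Definition zp_output a := output (sval (zero_or_pred G B)) [:: q; a].

Lemma zp_outputP a : pr0 (zp_output a) = 0 /\ rZ f a (pr1 (zp_output a)) \/
   pr0 (zp_output a) = 1 /\ rS f (pr0 (pr1 (zp_output a))) a (pr1 (pr1 (zp_output a))).
Proof. by have [] := cwp_output (svalP (zero_or_pred G B) f q m a). Qed.

(** Iterated predecessors, as chosen by the realizer of A13; below a zero they
have no meaning. *)
Fixpoint ancestor a i := if i is j.+1 then pr0 (pr1 (zp_output (ancestor a j))) else a.

Lemma std_ancestor a n i : stdq a n -> i <= n -> stdq (ancestor a i) (n - i).
Proof.
move=> Ha; elim: i => [|i IH] lt; first by rewrite subn0.
have {}IH := IH (ltnW lt); case: (zp_outputP (ancestor a i)) => -[_ H].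
  by have := std_Z0 IH H; lia.
by apply: std_pred H _; rewrite -subnSK in IH.
Qed.

Lemma ancestor_zero a n i : stdq a n -> i <= n -> (pr0 (zp_output (ancestor a i)) = 0) <-> i = n.
Proof.
move=> Ha le; have H := std_ancestor Ha le; case: (zp_outputP (ancestor a i)) => -[-> H'].
  by split=> // _; have := std_Z0 H H'; lia.
split=> // e; rewrite e subnn in H *; rewrite e in H'; by have := std_S0 H' H.
Qed.

End Facts.

Lemma wp_zp f q a (P : nat -> Prop) : model f q -> P (zp_output q a) ->
  cwp (sval (zero_or_pred G B)) [:: q; a] P.
Proof.
by move=> m Pa; apply: cwp_ev Pa; have [] := cwp_output (svalP (zero_or_pred G B) f q m a).
Qed.

Notation zp q a := (call (zero_or_pred G B) [:: q; a]).

Lemma ancestor_code : {C | forall f q a i (P : nat -> Prop), model f q -> P (ancestor q a i) ->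
  cwp C [:: q; a; i] P}.
Proof.
pose t := tRec (tV 2) (tV 1) (tFst (tSnd (zp (tV 2) (tV 1)))).
exists (t 3) => f q a i P m Pa; apply: (@cwp_term t [:: q; a; i]).
apply: (wp_rec (J := fun i y => y = ancestor q a i)); ev; split=> // [|j y _ ->|y ->] //.
  by ev.
by ev; apply: (wp_zp m).
Qed.

(** The index of a standard element is the number of steps down to zero. *)
Lemma idx_code : {C | forall f q a n (P : nat -> Prop), model f q -> std f q a n -> P n ->
  cwp C [:: q; a] P}.
Proof.
pose t := tMu (tFst (zp (tV 1) (call ancestor_code [:: tV 1; tV 2; tV 0]))).
exists (t 2) => f q a n P m Ha Pn; apply: (@cwp_term t [:: q; a]).
have H i : i <= n -> _ := ancestor_zero m Ha (i := i).
apply: (wp_mu (g := fun i => pr0 (zp_output q (ancestor q a i))) (n := n)).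
- exact/(H n).
- move=> i _ _; ev; apply: (svalP ancestor_code f _ _ _ _ m); ev.
  by apply: (wp_zp m).
- move=> i i0 ne; have [lt|lt|<- //] := ltngtP n i.
    by have := ne n lt; case: (H n (leqnn n)) => _ /(_ erefl).
  by have := (H i (ltnW lt)).1 i0 => e; rewrite e ltnn in lt.
Qed.

Notation ac q a i := (call ancestor_code [:: q; a; i]).

(** Going up again from the zero reached: the ancestor at depth n - j is equal
to the j-th numeral. *)
Lemma std_code : {C | forall f q a n, model f q -> std f q a n ->
  cwp C [:: q; a; n] (rE f a (nu q n))}.
Proof.
pose t := tRec (tV 2)
  (call (E_zeros G B) [:: tV 0; ac (tV 0) (tV 1) (tV 2); num (tV 0) (tC 0);
     tSnd (zp (tV 0) (ac (tV 0) (tV 1) (tV 2))); call (Z_nu G B) [:: tV 0]])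
  (let j := tV 0 in let q := tV 2 in let i := op2 rec_subn (tV 4) (op1 rec_S j) in
   let x := ac q (tV 3) i in let y := ac q (tV 3) (op1 rec_S i) in
   call (S_fun G B) [:: q; num q j; x; num q (op1 rec_S j);
     call (S_substl G B) [:: q; y; num q j; x; tV 1; tSnd (tSnd (zp q x))];
     call (S_nu G B) [:: q; j]]).
exists (t 3) => f q a n m Ha; apply: (@cwp_term t [:: q; a; n]).
apply: (wp_rec (J := fun j => rE f (ancestor q a (n - j)) (nu q j))); ev.
have ancP v i P Pa := svalP ancestor_code f q v i P m Pa.
split=> [|j y lt Hy|]; last by rewrite subnn.
  rewrite subn0; ev; apply: (ancP); ev; apply: (wp_nu m); ev; apply: (ancP); ev.
  apply: (wp_zp m); use (svalP (Z_nu G B) f q m) => z Hz.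
  have [_ /(_ erefl)] := ancestor_zero m Ha (leqnn n).
  by have := zp_outputP m (ancestor q a n) => -[] [-> // Hz' _]; by_rule (E_zeros G B).
ev; apply: (wp_nu m); ev; apply: (ancP); ev; apply: (wp_nu m); ev.
apply: (ancP); ev; apply: (wp_nu m); ev; apply: (ancP); ev; apply: (ancP); ev.
apply: (wp_zp m); set x := ancestor q a (n - j.+1).
have e : ancestor q a (n - j.+1).+1 = ancestor q a (n - j) by rewrite subnSK.
have Hs : rS f (ancestor q a (n - j)) x (pr1 (pr1 (zp_output q x))).
  have := zp_outputP m x => -[] [h0 H]; last by rewrite -e.
  by have := (ancestor_zero m Ha (i := n - j.+1) (leq_subr _ _)).1 h0; lia.
rewrite e; use (svalP (S_substl G B) f q m _ _ _ _ _ Hy Hs) => d Hd; ev.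
use (svalP (S_nu G B) f q m j) => d' Hd'; by_rule (S_fun G B).
Qed.

Lemma std_sym_code : {C | forall f q a n, model f q -> std f q a n ->
  cwp C [:: q; a; n] (rE f (nu q n) a)}.
Proof.
pose t := call (E_sym G B) [:: tV 0; tV 1; num (tV 0) (tV 2);
   call std_code [:: tV 0; tV 1; tV 2]].
exists (t 3) => f q a n m Ha; apply: (@cwp_term t [:: q; a; n]); rewrite /t; ev.
by apply: (wp_nu m); ev; use (svalP std_code f q a n m Ha) => e He; by_rule (E_sym G B).
Qed.

Notation toN q a n := (call std_code [:: q; a; n]).
Notation ofN q a n := (call std_sym_code [:: q; a; n]).

Lemma Z_std : {C | forall f q a, model f q -> std f q a 0 -> cwp C [:: q; a] (rZ f a)}.
Proof.
pose t := call (Z_subst G B) [:: tV 0; num (tV 0) (tC 0); tV 1;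
  ofN (tV 0) (tV 1) (tC 0); call (Z_nu G B) [:: tV 0]].
exists (t 2) => f q a m Ha; apply: (@cwp_term t [:: q; a]); rewrite /t; ev.
apply: (wp_nu m); ev; use (svalP std_sym_code f q a 0 m Ha) => e He; ev.
by use (svalP (Z_nu G B) f q m) => z Hz; by_rule (Z_subst G B).
Qed.

Lemma E_std : {C | forall f q a b n, model f q -> std f q a n -> std f q b n ->
  cwp C [:: q; a; b; n] (rE f a b)}.
Proof.
pose t := call (E_trans G B) [:: tV 0; tV 1; num (tV 0) (tV 3); tV 2;
  toN (tV 0) (tV 1) (tV 3); ofN (tV 0) (tV 2) (tV 3)].
exists (t 4) => f q a b n m Ha Hb; apply: (@cwp_term t [:: q; a; b; n]); rewrite /t; ev.
apply: (wp_nu m); ev; use (svalP std_code f q a n m Ha) => d Hd; ev.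
by use (svalP std_sym_code f q b n m Hb) => e He; by_rule (E_trans G B).
Qed.

Lemma S_std : {C | forall f q a b n, model f q -> std f q a n -> std f q b n.+1 ->
  cwp C [:: q; a; b; n] (rS f a b)}.
Proof.
pose t := let q := tV 0 in let a := tV 1 in let b := tV 2 in let n := tV 3 in let n1 := op1 rec_S n in 
  call (S_substl G B) [:: q; num q n; a; b; ofN q a n;
  call (S_substr G B) [:: q; num q n; num q n1; b; call (S_nu G B) [:: q; n];
    ofN q b n1]].
exists (t 4) => f q a b n m Ha Hb; apply: (@cwp_term t [:: q; a; b; n]).
rewrite /t; ev; apply: (wp_nu m); ev; use (svalP std_sym_code f q a n m Ha) => d Hd; ev.
do 2!(apply: (wp_nu m); ev); use (svalP (S_nu G B) f q m n) => s Hs; ev.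
use (svalP std_sym_code f q b _ m Hb) => e He; ev.
by use (svalP (S_substr G B) f q m _ _ _ _ _ Hs He) => g Hg; by_rule (S_substl G B).
Qed.

Lemma A_std : {C | forall f q a b c n k, model f q ->
  std f q a n -> std f q b k -> std f q c (n + k) ->
  cwp C [:: q; a; b; c; n; k] (rA f a b c)}.
Proof.
pose t := let q := tV 0 in let a := tV 1 in let b := tV 2 in let c := tV 3 in
  let n := tV 4 in let k := tV 5 in let s := op2 rec_addn n k in 
  call (A_subst3 G B) [:: q; a; b; num q s; c;
  call (A_subst2 G B) [:: q; a; num q k; b; num q s; ofN q b k;
    call (A_subst1 G B) [:: q; num q n; a; num q k; num q s; ofN q a n;
      call (A_nu G B) [:: q; n; k]]]; ofN q c s].
exists (t 6) => f q a b c n k m Ha Hb Hc.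
apply: (@cwp_term t [:: q; a; b; c; n; k]); rewrite /t; ev.
do 3!(apply: (wp_nu m); ev); use (svalP std_sym_code f q b k m Hb) => e2 He2; ev.
do 3!(apply: (wp_nu m); ev); use (svalP std_sym_code f q a n m Ha) => e1 He1; ev.
use (svalP (A_nu G B) f q m n k) => d Hd; ev.
use (svalP (A_subst1 G B) f q m _ _ _ _ _ _ He1 Hd) => d1 Hd1; ev.
use (svalP (A_subst2 G B) f q m _ _ _ _ _ _ He2 Hd1) => d2 Hd2; ev.
by use (svalP std_sym_code f q c _ m Hc) => e3 He3; by_rule (A_subst3 G B).
Qed.

Lemma M_std : {C | forall f q a b c n k, model f q ->
  std f q a n -> std f q b k -> std f q c (n * k) ->
  cwp C [:: q; a; b; c; n; k] (rM f a b c)}.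
Proof.
pose t := let q := tV 0 in let a := tV 1 in let b := tV 2 in let c := tV 3 in
  let n := tV 4 in let k := tV 5 in let s := op2 rec_muln n k in 
  call (M_subst3 G B) [:: q; a; b; num q s; c;
  call (M_subst2 G B) [:: q; a; num q k; b; num q s; ofN q b k;
    call (M_subst1 G B) [:: q; num q n; a; num q k; num q s; ofN q a n;
      call (M_nu G B) [:: q; n; k]]]; ofN q c s].
exists (t 6) => f q a b c n k m Ha Hb Hc.
apply: (@cwp_term t [:: q; a; b; c; n; k]); rewrite /t; ev.
do 3!(apply: (wp_nu m); ev); use (svalP std_sym_code f q b k m Hb) => e2 He2; ev.
do 3!(apply: (wp_nu m); ev); use (svalP std_sym_code f q a n m Ha) => e1 He1; ev.
use (svalP (M_nu G B) f q m n k) => d Hd; ev.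
use (svalP (M_subst1 G B) f q m _ _ _ _ _ _ He1 Hd) => d1 Hd1; ev.
use (svalP (M_subst2 G B) f q m _ _ _ _ _ _ He2 Hd1) => d2 Hd2; ev.
by use (svalP std_sym_code f q c _ m Hc) => e3 He3; by_rule (M_subst3 G B).
Qed.

End Standard.

(** * Decision of bounded formulas *)
Section Decide.
Variables (G B : form).
Notation model := (model G B).
Notation std := (std G B).
Notation nu := (nu G B).
Notation call R := (tFn (sval R)).
Notation num q n := (call (nu_code G B) [:: q; n]).
Notation idx q a := (call (idx_code G B) [:: q; a]).

Notation env0 := [:: tV 0; tV 1; tV 2].
Notation env1 := [:: tV 1; tV 2; tV 3].
Notation env2 := [:: tV 2; tV 3; tV 4].

Definition std_env f q F s rho := {in fv F, forall x, std f q (dec s x) (rho x)}.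

Definition answer f F s (T : Prop) e :=
  pr0 e = 0 /\ T /\ realizes f F (dec s) (pr1 e) \/ pr0 e = 1 /\ ~ T.

(** [rho] gives the indices of the elements assigned to the variables, [beta w
rho] is a truth value in the standard model, where the unbounded existential
quantifiers may be cut at [w]. The code decides it and, if it holds, also
realizes [F]. That [beta] depends on the elements only through their indices is
essential for the bounded universal quantifier. *)
Definition decides F (beta : nat -> (nat -> nat) -> Prop) c :=
  forall f q s rho w, model f q -> std_env f q F s rho ->
    cwp c [:: q; s; w] (answer f F s (beta w rho)).

Lemma std_env_sub f q F F' s rho : {subset fv F' <= fv F} ->
  std_env f q F s rho -> std_env f q F' s rho.
Proof. by move=> sub g x /sub; apply: g. Qed.

Lemma std_env_ext f q x F s rho a n : std f q a n -> std_env f q (Ex x F) s rho ->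
  std_env f q F (ext s x a) (upd rho x n).
Proof.
move=> Ha g y yF; rewrite dec_ext /upd; case: eqP => // ne; apply: g.
by rewrite /= mem_filter yF andbT; apply/eqP.
Qed.

Lemma realizes_dec f F s x a e :
  realizes f F (dec (ext s x a)) e <-> realizes f F (upd (dec s) x a) e.
Proof. by split; apply: realizes_ext => y; rewrite dec_ext. Qed.

Definition tYes t : term := tPair (tC 0) t.
Definition tNo : term := tPair (tC 1) (tC 0).

Lemma wp_yes f F s (T : Prop) t v :
  T -> wp t v (realizes f F (dec s)) -> wp (tYes t) v (answer f F s T).
Proof.
move=> HT Ht; apply: wp_pair; ev; apply: wp_mono Ht => a Ha e e0 e1.
by left; rewrite e1.
Qed.

Lemma wp_no f F s (T : Prop) v : ~ T -> wp tNo v (answer f F s T).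
Proof. by move=> nT; apply: wp_pair; ev; move=> e e0 _; right. Qed.

Definition tIf cnd t : term := tCase cnd (tYes t) tNo.

Lemma wp_if f F s (T : Prop) cnd t v :
  wp cnd v (fun n => n = 0 <-> T) ->
  (T -> wp t (0 :: v) (realizes f F (dec s))) ->
  wp (tIf cnd t) v (answer f F s T).
Proof.
move=> Hc Ht; apply: wp_case; apply: wp_mono Hc => -[|n] [H1 H2].
  by apply: wp_yes; [apply: H1 | apply/Ht/H1].
by apply: wp_no => /H2.
Qed.

Lemma answer_flag f F s T e : answer f F s T e -> pr0 e = 0 <-> T.
Proof. by case=> -[-> H]; split=> //; case: H. Qed.

Lemma answer_yes f F s (T : Prop) e : T -> answer f F s T e ->
  pr0 e = 0 /\ realizes f F (dec s) (pr1 e).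
Proof. by move=> HT [[-> [_ H]]|[_ /(_ HT)]]. Qed.

Lemma decides_iff F beta beta' c :
  (forall w rho, beta w rho <-> beta' w rho) -> decides F beta c -> decides F beta' c.
Proof.
move=> H D f q s rho w m g; apply: cwp_mono (D f q s rho w m g) => e.
by rewrite /answer H.
Qed.

Lemma decide_bot beta : (forall w rho, ~ beta w rho) -> exists c, decides Bot beta c.
Proof.
by move=> nb; exists (tNo 3) => f q s rho w m g; apply: (@cwp_term tNo [:: q; s; w]); apply: wp_no.
Qed.

Lemma decide_and F F' beta beta' c c' : decides F beta c -> decides F' beta' c' ->
  exists d, decides (And F F') (fun w rho => beta w rho /\ beta' w rho) d.
Proof.
move=> D D'.
pose t := tIf (op2 rec_addn (tFst (tFn c env0)) (tFst (tFn c' env0)))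
              (tPair (tSnd (tFn c env1)) (tSnd (tFn c' env1))).
exists (t 3) => f q s rho w m g; apply: (@cwp_term t [:: q; s; w]).
have gF : std_env f q F s rho by apply: std_env_sub g => x xF; rewrite mem_cat xF.
have gF' : std_env f q F' s rho by apply: std_env_sub g => x xF; rewrite mem_cat xF orbT.
apply: wp_if => [|[HT HT']].
  use (D _ _ _ _ w m gF) => e He; have {}He := answer_flag He.
  use (D' _ _ _ _ w m gF') => e' He'; have {}He' := answer_flag He'.
  by rewrite -He -He'; lia.
apply: wp_and.
  by use (D _ _ _ _ w m gF) => e /(answer_yes HT)[].
by use (D' _ _ _ _ w m gF') => e /(answer_yes HT')[].
Qed.

Lemma decide_or F F' beta beta' c c' : decides F beta c -> decides F' beta' c' ->
  exists d, decides (Or F F') (fun w rho => beta w rho \/ beta' w rho) d.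
Proof.
move=> D D'.
pose t := tIf (op2 rec_muln (tFst (tFn c env0)) (tFst (tFn c' env0)))
   (tCase (tFst (tFn c env1)) (tPair (tC 0) (tSnd (tFn c env2))) (tPair (tC 1) (tSnd (tFn c' env2)))).
exists (t 3) => f q s rho w m g; apply: (@cwp_term t [:: q; s; w]).
have gF : std_env f q F s rho by apply: std_env_sub g => x xF; rewrite mem_cat xF.
have gF' : std_env f q F' s rho by apply: std_env_sub g => x xF; rewrite mem_cat xF orbT.
apply: wp_if => [|HT].
  use (D _ _ _ _ w m gF) => e He; have {}He := answer_flag He.
  use (D' _ _ _ _ w m gF') => e' He'; have {}He' := answer_flag He'.
  rewrite -He -He'; split=> [/eqP|[->|->]]; rewrite ?muln0 //.
  by rewrite muln_eq0 => /orP[] /eqP; auto.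
apply: wp_case; use (D _ _ _ _ w m gF) => e He; have := answer_flag He; case: (pr0 e) => [|n] {}He.
  by apply: wp_or1; use (D _ _ _ _ w m gF) => e' /(answer_yes (He.1 erefl))[].
apply: wp_or2; case: HT => [/He //|HT].
by use (D' _ _ _ _ w m gF') => e' /(answer_yes HT)[].
Qed.

(** Realizability implies truth. Implication and negation need it, because their
premises occur negatively. *)
Definition adequate F (beta : nat -> (nat -> nat) -> Prop) :=
  forall f q s rho w e, model f q -> std_env f q F s rho ->
    realizes f F (dec s) e -> beta w rho.

Lemma decide_imp F F' beta beta' c c' : decides F beta c -> decides F' beta' c' ->
  adequate F beta ->
  exists d, decides (Imp F F') (fun w rho => beta w rho -> beta' w rho) d.
Proof.
move=> D D' ad.
pose t := tIf (op2 rec_subn (tFst (tFn c' env0)) (tFst (tFn c env0))) (tLam (tSnd (tFn c' env2))).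
exists (t 3) => f q s rho w m g; apply: (@cwp_term t [:: q; s; w]).
have gF : std_env f q F s rho by apply: std_env_sub g => x xF; rewrite mem_cat xF.
have gF' : std_env f q F' s rho by apply: std_env_sub g => x xF; rewrite mem_cat xF orbT.
apply: wp_if => [|HT].
  use (D' _ _ _ _ w m gF') => e' He'; use (D _ _ _ _ w m gF) => e He.
  case: He He' => -[-> H] [] [-> H'] /=; split=> //; try tauto.
apply: wp_imp => z /(ad _ _ _ _ w _ m gF)/HT HT'.
by use (D' _ _ _ _ w m gF') => e' /(answer_yes HT')[].
Qed.

Lemma decide_neg F beta c : decides F beta c -> adequate F beta ->
  exists d, decides (Neg F) (fun w rho => ~ beta w rho) d.
Proof.
move=> D ad.
pose t := tIf (op2 rec_subn (tC 1) (tFst (tFn c [:: tV 0; tV 1; tV 2]))) (tC 0).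
exists (t 3) => f q s rho w m g; apply: (@cwp_term t [:: q; s; w]).
apply: wp_if => [|HT].
  use (D _ _ _ _ w m g) => e [] [-> H] /=; split=> //; tauto.
apply: wp_neg => [z /(ad _ _ _ _ w _ m g) //|]; exact: wp_C.
Qed.

(** The result [n.+1] stands for the witness [n], and 0 for failure. *)
Lemma find_code x F beta c : decides F beta c ->
  exists C, forall f q s rho w k, model f q -> std_env f q (Ex x F) s rho ->
   cwp C [:: q; s; w; k] (fun y =>
     (y = 0 /\ forall n, n < k -> ~ beta w (upd rho x n)) \/
     exists n, [/\ y = n.+1, n < k & beta w (upd rho x n)]).
Proof.
move=> D.
pose t := tRec (tV 3) (tC 0)
  (tCase (tV 1)
    (tCase (tFst (tFn c [:: tV 3; tExt (tV 4) (tC x) (num (tV 3) (tV 1)); tV 5]))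
       (op1 rec_S (tV 2)) (tC 0))
    (tV 2)).
exists (t 4) => f q s rho w k m g; apply: (@cwp_term t [:: q; s; w; k]).
apply: (wp_rec (J := fun k y =>
     (y = 0 /\ forall n, n < k -> ~ beta w (upd rho x n)) \/
     exists n, [/\ y = n.+1, n < k & beta w (upd rho x n)])); ev.
split=> // [|i y _ Hy]; first by ev; left.
apply: wp_case; ev; case: Hy => [[-> Hy]|[n [-> lt Hn]]]; last first.
  by ev; right; exists n; split=> //; lia.
have gi := std_env_ext (std_nu m i) g.
apply: wp_case; ev; apply: (wp_nu m).
use (D _ _ _ _ w m gi) => e He; have := answer_flag He; case: (pr0 e) => [|j] {}He; ev.
  by right; exists i; split=> //; apply: He.1.
left; split=> // n; rewrite ltnS leq_eqVlt => /orP[/eqP ->|/Hy //].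
by case: He => _ He /He.
Qed.

Lemma check_code x F beta c : decides F beta c ->
  exists C, forall f q s rho w k, model f q -> std_env f q (Ex x F) s rho ->
   cwp C [:: q; s; w; k] (fun y => y = 0 <-> forall n, n < k -> beta w (upd rho x n)).
Proof.
move=> D.
pose t := tRec (tV 3) (tC 0) (op2 rec_addn (tV 1)
  (tFst (tFn c [:: tV 2; tExt (tV 3) (tC x) (num (tV 2) (tV 0)); tV 4]))).
exists (t 4) => f q s rho w k m g; apply: (@cwp_term t [:: q; s; w; k]).
apply: (wp_rec (J := fun k y => y = 0 <-> forall n, n < k -> beta w (upd rho x n))); ev.
split=> // [|i y _ Hy]; first by ev.
have gi := std_env_ext (std_nu m i) g.
ev; apply: (wp_nu m); use (D _ _ _ _ w m gi) => e He; have {}He := answer_flag He.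
split=> [e0 n|H].
  rewrite ltnS leq_eqVlt => /orP[/eqP ->|]; first by apply/He; lia.
  by apply: (proj1 Hy); lia.
have y0 : y = 0 by apply/Hy => n lt; apply: H; lia.
by rewrite y0; apply/He/H.
Qed.

Lemma decide_ex x F beta c : decides F beta c ->
  exists d, decides (Ex x F) (fun w rho => exists2 n, n < w & beta w (upd rho x n)) d.
Proof.
move=> D; have [C CP] := find_code x D.
pose nn := num (tV 1) (op1 rec_predn (tV 0)).
pose t := tCase (tFn C [:: tV 0; tV 1; tV 2; tV 2]) tNo
  (tYes (tPair nn (tSnd (tFn c [:: tV 1; tExt (tV 2) (tC x) nn; tV 3])))).
exists (t 3) => f q s rho w m g; apply: (@cwp_term t [:: q; s; w]).
apply: wp_case; use (CP _ _ _ _ w w m g) => y [[-> Hy]|[n [-> lt Hn]]].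
  by apply: wp_no => -[n lt]; apply: Hy.
apply: wp_yes; first by exists n.
apply: wp_ex; rewrite /nn; ev; apply: (wp_nu m); ev; apply: (wp_nu m).
have gn := std_env_ext (std_nu m n) g.
by use (D _ _ _ _ w m gn) => e /(answer_yes Hn)[_ /realizes_dec].
Qed.

Lemma fv_le z x t : z \notin [:: x; t] -> fv (fLe z x t) = [:: x; t].
Proof.
rewrite !inE negb_or => /andP[/negPf zx /negPf zt].
by rewrite /= !eqxx eq_sym zx eq_sym zt.
Qed.

Lemma realizes_le f z x t r e : z \notin [:: x; t] ->
  realizes f (fLe z x t) r e <-> rA f (pr0 e) (r x) (r t) (pr1 e).
Proof.
rewrite !inE negb_or => /andP[/negPf zx /negPf zt].
have E : realizes f (fLe z x t) r e <-> realizes f (fA z x t) (upd r z (pr0 e)) (pr1 e) by [].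
by rewrite E realizes_atom /= upd_eq /upd ![_ == z]eq_sym zx zt.
Qed.

Lemma le_code z x t : z \notin [:: x; t] -> t != x ->
  exists C, forall f q s n a k, model f q -> std f q a n -> std f q (dec s t) k ->
    n <= k -> cwp C [:: q; s; a; n] (realizes f (fLe z x t) (upd (dec s) x a)).
Proof.
move=> zN tx.
pose b := tDec (tV 1) (tC t); pose d := op2 rec_subn (idx (tV 0) b) (tV 3).
pose u := tPair (num (tV 0) d)
  (call (A_std G B) [:: tV 0; num (tV 0) d; tV 2; b; d; tV 3]).
exists (u 4) => f q s n a k m Ha Ht le; apply: (@cwp_term u [:: q; s; a; n]).
have I P Pk := svalP (idx_code G B) f q (dec s t) k P m Ht Pk.
have Hk : std f q (dec s t) (k - n + n) by rewrite subnK.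
rewrite /u /d /b; ev; apply: (I); ev; apply: (wp_nu m); ev; apply: (I); ev.
apply: (wp_nu m); ev; apply: (I); ev.
use (svalP (A_std G B) f q _ _ _ _ _ m (std_nu m (k - n)) Ha Hk) => e He e' e0 e1.
by apply/realizes_le => //; rewrite e0 e1 upd_eq /upd (negPf tx).
Qed.

Lemma std_realized_le f q s z x t a e k : model f q -> z \notin [:: x; t] -> t != x ->
  std f q (dec s t) k ->
  realizes f (fLe z x t) (upd (dec s) x a) e -> exists2 n, n <= k & std f q a n.
Proof.
move=> m zN tx Ht /(realizes_le _ _ _ zN).
rewrite upd_eq /upd (negPf tx) => He; exact: (std_le m He Ht).
Qed.

Section Bounded.
Variables (x t z : nat) (F : form) (beta : nat -> (nat -> nat) -> Prop) (c : code).
Hypotheses (tx : t != x) (zN : z \notin [:: x; t]) (D : decides F beta c).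

Lemma std_env_bounded f q s rho : std_env f q (bEx x t z F) s rho ->
  std_env f q (Ex x F) s rho /\ std f q (dec s t) (rho t).
Proof.
move=> g; split; last first.
  apply: g; rewrite -[fv _]/[seq y <- fv (fLe z x t) ++ fv F | y != x] fv_le //.
  by rewrite mem_filter tx !inE eqxx orbT.
apply: std_env_sub g => y; rewrite /= !mem_filter mem_cat => /andP[-> ->].
by rewrite orbT.
Qed.

Lemma decide_bex : exists d, decides (bEx x t z F)
  (fun w rho => exists2 n, n <= rho t & beta w (upd rho x n)) d.
Proof.
have [C CP] := find_code x D; have [L LP] := le_code zN tx.
pose n := op1 rec_predn (tV 0); pose nn := num (tV 1) n.
pose u := tCase (tFn C [:: tV 0; tV 1; tV 2; op1 rec_S (idx (tV 0) (tDec (tV 1) (tC t)))]) tNo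
  (tYes (tPair nn (tPair (tFn L [:: tV 1; tV 2; nn; n])
    (tSnd (tFn c [:: tV 1; tExt (tV 2) (tC x) nn; tV 3]))))).
exists (u 3) => f q s rho w m /std_env_bounded[g Ht]; apply: (@cwp_term u [:: q; s; w]).
apply: wp_case; ev; apply: (svalP (idx_code G B) f q _ _ _ m Ht); ev.
use (CP _ _ _ _ w (rho t).+1 m g) => y [[-> Hy]|[k [-> lt Hk]]].
  by apply: wp_no => -[k le]; apply: Hy.
apply: wp_yes; first by exists k.
have gn := std_env_ext (std_nu m k) g.
apply: wp_ex; rewrite /nn /n; ev; apply: (wp_nu m); apply: wp_and; ev; apply: (wp_nu m).
  by use (LP _ _ _ _ _ _ m (std_nu m k) Ht lt).
by use (D w m gn) => e /(answer_yes Hk)[_ /realizes_dec].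
Qed.

(** It is enough to check the numerals up to the bound: an arbitrary element
below the bound is standard, and the decision at this element has the truth
value already found at the numeral of the same index. *)
Lemma decide_ball : exists d, decides (bAll x t z F)
  (fun w rho => forall n, n <= rho t -> beta w (upd rho x n)) d.
Proof.
have [C CP] := check_code x D.
pose u := tIf (tFn C [:: tV 0; tV 1; tV 2; op1 rec_S (idx (tV 0) (tDec (tV 1) (tC t)))])
  (tLam (tLam (tSnd (tFn c [:: tV 3; tExt (tV 4) (tC x) (tV 1); tV 5])))).
exists (u 3) => f q s rho w m /std_env_bounded[g Ht]; apply: (@cwp_term u [:: q; s; w]).
apply: wp_if => [|HT].
  ev; apply: (svalP (idx_code G B) f q _ _ _ m Ht); ev.
  by use (CP _ _ _ _ w (rho t).+1 m g) => y.
apply: wp_all => a; apply: wp_imp => p /(std_realized_le m zN tx Ht)[n le Ha].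
by use (D w m (std_env_ext Ha g)) => e /(answer_yes (HT _ le))[_ /realizes_dec].
Qed.

Lemma sat_le a rho : sat (fLe z x t) (upd rho x a) <-> a <= rho t.
Proof.
move: zN; rewrite !inE negb_or => /andP[/negPf zx /negPf zt].
rewrite /= /upd eqxx; split=> [[b]|le].
  by rewrite ![_ == z]eq_sym zx zt eqxx (negPf tx) => <-; rewrite leq_addl.
by exists (rho t - a); rewrite ![_ == z]eq_sym zx zt eqxx (negPf tx) subnK.
Qed.

Lemma sat_bex rho :
  sat (bEx x t z F) rho <-> exists2 n, n <= rho t & sat F (upd rho x n).
Proof.
have E : sat (bEx x t z F) rho <->
  exists a, sat (fLe z x t) (upd rho x a) /\ sat F (upd rho x a) by [].
by rewrite E; split=> [[a [/sat_le]]|[a le H]]; exists a => //; split=> //; apply/sat_le.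
Qed.

Lemma sat_ball rho :
  sat (bAll x t z F) rho <-> forall n, n <= rho t -> sat F (upd rho x n).
Proof.
have E : sat (bAll x t z F) rho <->
  forall a, sat (fLe z x t) (upd rho x a) -> sat F (upd rho x a) by [].
by rewrite E; split=> H a le; apply: H; apply/sat_le.
Qed.

End Bounded.

End Decide.

(** * Completeness for Sigma-formulas *)
Section Arithmetic.
Variables (G B : form).
Notation model := (model G B).
Notation std := (std G B).
Notation nu := (nu G B).
Notation decides := (decides G B).
Notation adequate := (adequate G B).
Notation std_env := (std_env G B).
Notation call R := (tFn (sval R)).
Notation num q n := (call (nu_code G B) [:: q; n]).
Notation idx q a := (call (idx_code G B) [:: q; a]).

Definition tDist s t : term := op2 rec_addn (op2 rec_subn s t) (op2 rec_subn t s).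

Lemma wp_dist s t v (P : nat -> Prop) :
  wp s v (fun n => wp t v (fun k => forall d, (d = 0 <-> n = k) -> P d)) ->
  wp (tDist s t) v P.
Proof.
move=> [n [en [k [ek H]]]].
apply: wp_op2; apply: wp_op2; exists n; split=> //; exists k; split=> //.
apply: wp_op2; exists k; split=> //; exists n; split=> //.
by apply: H; lia.
Qed.

Notation val_of x := (tDec (tV 1) (tC x)).
Notation val_of' x := (tDec (tV 2) (tC x)).

Lemma decide_Z x : exists c, decides (fZ x) (fun _ rho => rho x = 0) c.
Proof.
pose t := tIf (idx (tV 0) (val_of x)) (call (Z_std G B) [:: tV 1; val_of' x]).
exists (t 3) => f q s rho w m g; apply: (@cwp_term t [:: q; s; w]).
have Hx : std f q (dec s x) (rho x) by apply: g; rewrite inE.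
apply: wp_if => [|x0]; ev; first exact: (svalP (idx_code G B) f q _ _ _ m Hx).
rewrite x0 in Hx; use (svalP (Z_std G B) f q _ m Hx) => e He.
by apply/realizes_atom.
Qed.

Lemma decide_E x y : exists c, decides (fE x y) (fun _ rho => rho x = rho y) c.
Proof.
pose t := tIf (tDist (idx (tV 0) (val_of x)) (idx (tV 0) (val_of y)))
  (call (E_std G B) [:: tV 1; val_of' x; val_of' y; idx (tV 1) (val_of' x)]).
exists (t 3) => f q s rho w m g; apply: (@cwp_term t [:: q; s; w]).
have Hx : std f q (dec s x) (rho x) by apply: g; rewrite !inE eqxx.
have Hy : std f q (dec s y) (rho y) by apply: g; rewrite !inE eqxx orbT.
have I a n P Ha := svalP (idx_code G B) f q a n P m Ha.
apply: wp_if => [|xy].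
  by apply: wp_dist; ev; apply: (I _ _ _ Hx); ev; apply: (I _ _ _ Hy).
ev; apply: (I _ _ _ Hx); rewrite -xy in Hy; use (svalP (E_std G B) f q _ _ _ m Hx Hy) => e He.
by apply/realizes_atom.
Qed.

Lemma decide_S x y : exists c, decides (fS x y) (fun _ rho => rho x + 1 = rho y) c.
Proof.
pose t := tIf (tDist (op1 rec_S (idx (tV 0) (val_of x))) (idx (tV 0) (val_of y)))
  (call (S_std G B) [:: tV 1; val_of' x; val_of' y; idx (tV 1) (val_of' x)]).
exists (t 3) => f q s rho w m g; apply: (@cwp_term t [:: q; s; w]).
have Hx : std f q (dec s x) (rho x) by apply: g; rewrite !inE eqxx.
have Hy : std f q (dec s y) (rho y) by apply: g; rewrite !inE eqxx orbT.
have I a n P Ha := svalP (idx_code G B) f q a n P m Ha.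
rewrite addn1; apply: wp_if => [|xy].
  by apply: wp_dist; ev; apply: (I _ _ _ Hx); ev; apply: (I _ _ _ Hy).
ev; apply: (I _ _ _ Hx); rewrite -xy in Hy; use (svalP (S_std G B) f q _ _ _ m Hx Hy) => e He.
by apply/realizes_atom.
Qed.

Lemma decide_A x y z : exists c, decides (fA x y z) (fun _ rho => rho x + rho y = rho z) c.
Proof.
pose t := tIf (tDist (op2 rec_addn (idx (tV 0) (val_of x)) (idx (tV 0) (val_of y)))
                     (idx (tV 0) (val_of z)))
  (call (A_std G B) [:: tV 1; val_of' x; val_of' y; val_of' z;
     idx (tV 1) (val_of' x); idx (tV 1) (val_of' y)]).
exists (t 3) => f q s rho w m g; apply: (@cwp_term t [:: q; s; w]).
have Hx : std f q (dec s x) (rho x) by apply: g; rewrite !inE eqxx.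
have Hy : std f q (dec s y) (rho y) by apply: g; rewrite !inE eqxx orbT.
have Hz : std f q (dec s z) (rho z) by apply: g; rewrite !inE eqxx !orbT.
have I a n P Ha := svalP (idx_code G B) f q a n P m Ha.
apply: wp_if => [|xyz].
  by apply: wp_dist; ev; apply: (I _ _ _ Hx); ev; apply: (I _ _ _ Hy); ev; apply: (I _ _ _ Hz).
ev; apply: (I _ _ _ Hx); ev; apply: (I _ _ _ Hy); rewrite -xyz in Hz.
use (svalP (A_std G B) f q _ _ _ _ _ m Hx Hy Hz) => e He.
by apply/realizes_atom.
Qed.

Lemma decide_M x y z : exists c, decides (fM x y z) (fun _ rho => rho x * rho y = rho z) c.
Proof.
pose t := tIf (tDist (op2 rec_muln (idx (tV 0) (val_of x)) (idx (tV 0) (val_of y)))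
                     (idx (tV 0) (val_of z)))
  (call (M_std G B) [:: tV 1; val_of' x; val_of' y; val_of' z;
     idx (tV 1) (val_of' x); idx (tV 1) (val_of' y)]).
exists (t 3) => f q s rho w m g; apply: (@cwp_term t [:: q; s; w]).
have Hx : std f q (dec s x) (rho x) by apply: g; rewrite !inE eqxx.
have Hy : std f q (dec s y) (rho y) by apply: g; rewrite !inE eqxx orbT.
have Hz : std f q (dec s z) (rho z) by apply: g; rewrite !inE eqxx !orbT.
have I a n P Ha := svalP (idx_code G B) f q a n P m Ha.
apply: wp_if => [|xyz].
  by apply: wp_dist; ev; apply: (I _ _ _ Hx); ev; apply: (I _ _ _ Hy); ev; apply: (I _ _ _ Hz).
ev; apply: (I _ _ _ Hx); ev; apply: (I _ _ _ Hy); rewrite -xyz in Hz.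
use (svalP (M_std G B) f q _ _ _ _ _ m Hx Hy Hz) => e He.
by apply/realizes_atom.
Qed.

(** Every arithmetic atom is one of the five, up to the proof in its tuple. *)
Lemma Ar_atom_ind (P : form -> Prop) :
  (forall x, P (fZ x)) -> (forall x y, P (fE x y)) -> (forall x y, P (fS x y)) ->
  (forall x y z, P (fA x y z)) -> (forall x y z, P (fM x y z)) ->
  forall n i (v : n.-tuple nat), (n, i) \in Ar_preds -> P (Atom i v).
Proof.
move=> HZ HE HS HA HM n i v; rewrite !inE !xpair_eqE.
case/orP=> [|/orP[|/orP[|/orP[]]]] /andP[/eqP e /eqP ->]; subst n.
- case: v => -[|x [|y v]] // p; suff -> : Tuple p = [tuple x] by apply: HZ.
  exact: val_inj.
- case: v => -[|x [|y [|z v]]] // p; suff -> : Tuple p = [tuple x; y] by apply: HE.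
  exact: val_inj.
- case: v => -[|x [|y [|z v]]] // p; suff -> : Tuple p = [tuple x; y] by apply: HS.
  exact: val_inj.
- case: v => -[|x [|y [|z [|u v]]]] // p; suff -> : Tuple p = [tuple x; y; z] by apply: HA.
  exact: val_inj.
- case: v => -[|x [|y [|z [|u v]]]] // p; suff -> : Tuple p = [tuple x; y; z] by apply: HM.
  exact: val_inj.
Qed.

Definition sats F : nat -> (nat -> nat) -> Prop := fun _ => sat F.

Lemma adequate_atom n i (v : n.-tuple nat) : (n, i) \in Ar_preds ->
  adequate (Atom i v) (sats (Atom i v)).
Proof.
apply: (@Ar_atom_ind (fun F => adequate F (sats F))).
- move=> x f q s rho w e m g /realizes_atom He.
  by apply: (std_Z0 m (g x _) He); rewrite inE.
- move=> x y f q s rho w e m g /realizes_atom He.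
  have Hx := g x; have Hy := g y.
  apply: (std_unique m (std_E m He (g x _)) (g y _)); by rewrite !inE eqxx ?orbT.
- move=> x y f q s rho w e m g /realizes_atom He; rewrite /sats /= addn1.
  apply: (std_unique m (std_S m He (g x _)) (g y _)); by rewrite !inE eqxx ?orbT.
- move=> x y z f q s rho w e m g /realizes_atom He.
  apply: (std_unique m (std_A m He (g x _) (g y _)) (g z _)); by rewrite !inE eqxx ?orbT.
- move=> x y z f q s rho w e m g /realizes_atom He.
  apply: (std_unique m (std_M m He (g x _) (g y _)) (g z _)); by rewrite !inE eqxx ?orbT.
Qed.

Lemma decides_adequate F beta c f q s rho w : decides F beta c -> model f q ->
  std_env f q F s rho -> beta w rho -> exists e, realizes f F (dec s) e.
Proof.
move=> D m g HT; have [e [_ /(answer_yes HT)[_ He]]] := D f q s rho w m g.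
by exists (pr1 e).
Qed.

Lemma delta_decides F : Delta0 F -> (exists c, decides F (sats F) c) /\ adequate F (sats F).
Proof.
elim=> {F}.
- by split; [apply: decide_bot => w rho [] | move=> f q s rho w e m g []].
- move=> n i v ar; split; last exact: adequate_atom.
  apply: (@Ar_atom_ind (fun F => exists c, decides F (sats F) c)) ar => *.
  + exact: decide_Z.
  + exact: decide_E.
  + exact: decide_S.
  + exact: decide_A.
  + exact: decide_M.
- move=> F _ [[c D] ad]; split; first exact: decide_neg D ad.
  move=> f q s rho w e m g He HT.
  have [a Ha] := decides_adequate (w := w) D m g HT.
  by have [? []] := He a Ha.
- move=> F F' _ [[c D] ad] _ [[c' D'] ad']; split; first exact: decide_or D D'.
  move=> f q s rho w e m g; case=> -[_ He];
    [left; apply: (ad _ _ _ _ w _ m _ He) | right; apply: (ad' _ _ _ _ w _ m _ He)];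
  by apply: std_env_sub g => y yF; rewrite mem_cat yF ?orbT.
- move=> F F' _ [[c D] ad] _ [[c' D'] ad']; split; first exact: decide_and D D'.
  move=> f q s rho w e m g [He He']; split;
    [apply: (ad _ _ _ _ w _ m _ He) | apply: (ad' _ _ _ _ w _ m _ He')];
  by apply: std_env_sub g => y yF; rewrite mem_cat yF ?orbT.
- move=> F F' _ [[c D] ad] _ [[c' D'] ad']; split; first exact: decide_imp D D' ad.
  move=> f q s rho w e m g He HT.
  have gF : std_env f q F s rho by apply: std_env_sub g => x xF; rewrite mem_cat xF.
  have gF' : std_env f q F' s rho by apply: std_env_sub g => x xF; rewrite mem_cat xF orbT.
  have [a Ha] := decides_adequate (w := w) D m gF HT.
  by have [b [_ Hb]] := He a Ha; apply: (ad' _ _ _ _ w b m gF' Hb).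
- move=> x t z F tx zN _ [[c D] ad]; split.
    have [d Dd] := decide_bex tx zN D; exists d.
    by apply: decides_iff Dd => w rho; apply: iff_sym; apply: sat_bex.
  move=> f q s rho w e m g He; have [gF Ht] := std_env_bounded tx zN g.
  have [H1 H2] : realizes f (And (fLe z x t) F) (upd (dec s) x (pr0 e)) (pr1 e) by [].
  rewrite /sats; apply/(sat_bex F tx zN); have [n le Hn] := std_realized_le m zN tx Ht H1; exists n => //.
  by apply: (ad _ _ _ _ w (pr1 (pr1 e)) m (std_env_ext Hn gF)); apply/realizes_dec; apply: H2.
- move=> x t z F tx zN _ [[c D] ad]; split.
    have [d Dd] := decide_ball tx zN D; exists d.
    by apply: decides_iff Dd => w rho; apply: iff_sym; apply: sat_ball.
  move=> f q s rho w e m g He; have [gF Ht] := std_env_bounded tx zN g.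
  rewrite /sats; apply/(sat_ball F tx zN) => n le.
  have {}He : forall a, exists b, kleene e a b /\
    realizes f (Imp (fLe z x t) F) (upd (dec s) x a) b by [].
  have [b [_ Hb]] := He (nu q n).
  have [C CP] := le_code G B zN tx.
  have [l [_ Hl]] := CP f q s n _ _ m (std_nu m n) Ht le.
  have [a [_ Ha]] := Hb l Hl.
  by apply: (ad _ _ _ _ w a m (std_env_ext (std_nu m n) gF)); apply/realizes_dec.
Qed.

(** The truth value with witnesses bounded by [w] is decidable, increases with
[w] and exhausts truth. *)
Definition semidecides F (beta : nat -> (nat -> nat) -> Prop) c :=
  [/\ decides F beta c,
      forall rho w w', w <= w' -> beta w rho -> beta w' rho &
      forall rho, sat F rho -> exists w, beta w rho].

(** Monotonicity provides a common bound for the finitely many instances of a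
bounded universal quantifier. *)
Lemma sigma_semidecides F : Sigma F -> exists c beta, semidecides F beta c.
Proof.
elim=> {F}.
- move=> F /delta_decides[[c D] _]; exists c, (sats F); split=> // rho H.
  by exists 0.
- move=> F F' _ [c [b [D mo ex]]] _ [c' [b' [D' mo' ex']]].
  have [d Dd] := decide_or D D'; exists d; eexists; split; first exact: Dd.
    by move=> rho w w' le /= [/(mo _ _ _ le)|/(mo' _ _ _ le)]; [left | right].
  by move=> rho [/ex[w H]|/ex'[w H]]; exists w; [left | right].
- move=> F F' _ [c [b [D mo ex]]] _ [c' [b' [D' mo' ex']]].
  have [d Dd] := decide_and D D'; exists d; eexists; split; first exact: Dd.
    by move=> rho w w' le /= [/(mo _ _ _ le) ? /(mo' _ _ _ le) ?].
  move=> rho [/ex[w H] /ex'[w' H']]; exists (maxn w w'); split.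
    by apply: mo H; apply: leq_maxl.
  by apply: mo' H'; apply: leq_maxr.
- move=> x t z F tx zN _ [c [b [D mo ex]]].
  have [d Dd] := decide_bex tx zN D; exists d; eexists; split; first exact: Dd.
    by move=> rho w w' le /= [n ln /(mo _ _ _ le) ?]; exists n.
  by move=> rho /(sat_bex F tx zN)[n le /ex[w H]]; exists w, n.
- move=> x t z F tx zN _ [c [b [D mo ex]]].
  have [d Dd] := decide_ball tx zN D; exists d; eexists; split; first exact: Dd.
    by move=> rho w w' le /= H n /H; apply: mo.
  move=> rho /(sat_ball F tx zN) H.
  suff [w Hw] : exists w, forall n, n < (rho t).+1 -> b w (upd rho x n).
    by exists w => n le; apply: Hw.
  have {}H n : n < (rho t).+1 -> sat F (upd rho x n) by move=> lt; apply: H.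
  elim: (rho t).+1 H => [|k IH] H; first by exists 0.
  have [|w Hw] := IH; first by move=> n lt; apply: H; lia.
  have [w' Hw'] := ex _ (H k (ltnSn k)).
  exists (maxn w w') => n; rewrite ltnS leq_eqVlt => /orP[/eqP ->|lt].
    by apply: mo Hw'; apply: leq_maxr.
  by apply: mo (Hw n lt); apply: leq_maxl.
- move=> x F _ [c [b [D mo ex]]].
  have [d Dd] := decide_ex x D; exists d; eexists; split; first exact: Dd.
    move=> rho w w' le /= [n ln /(mo _ _ _ le) ?]; exists n => //; lia.
  move=> rho [n /ex[w H]]; exists (maxn n.+1 w), n; first exact: leq_maxl.
  by apply: mo H; apply: leq_maxr.
Qed.

(** Search for a sufficient bound on the witnesses. *)
Lemma sigma_code F : Sigma F -> exists C, forall f q s rho, model f q ->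
  std_env f q F s rho -> sat F rho -> cwp C [:: q; s] (realizes f F (dec s)).
Proof.
move=> /sigma_semidecides[c [b [D mo ex]]].
pose t := tSnd (tFn c [:: tV 0; tV 1; tMu (tFst (tFn c [:: tV 1; tV 2; tV 0]))]).
exists (t 2) => f q s rho m g /ex[w0 H0]; apply: (@cwp_term t [:: q; s]); rewrite /t; ev.
have O w := cwp_output (D f q s rho w m g).
apply: (wp_mu (g := fun w => pr0 (output c [:: q; s; w])) (n := w0)).
- by have [_ /(answer_yes H0)[]] := O w0.
- by move=> w _ _; ev; have [ew _] := O w; apply: cwp_ev ew _.
move=> w w1 _; have [ew aw] := O w; ev; apply: cwp_ev ew _.
by case: aw => [[_ [_ H]]|[e _]] //; rewrite e in w1.
Qed.

End Arithmetic.

(** * Every element is standard *)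
Section Church.
Variables (G B : form).
Hypotheses (G_sigma : Sigma G) (fvG : {subset fv G <= [:: 0; 1; 2]})
  (G_graph : forall a b c, sat G (nth 0 [:: a; b; c]) <-> kleene a b c)
  (fvB : {subset fv B <= [:: 0; 1]}).
Notation model := (model G B).
Notation std := (std G B).
Notation nu := (nu G B).
Notation call R := (tFn (sval R)).
Notation num q n := (call (nu_code G B) [:: q; n]).
Notation idx q a := (call (idx_code G B) [:: q; a]).

Definition rG f x y z := realizes f G (nth 0 [:: x; y; z]).
Definition rB f x y := realizes f B (nth 0 [:: x; y]).

Lemma realizes_G f r x y z e :
  realizes f (app G [:: x; y; z]) r e <-> rG f (r x) (r y) (r z) e.
Proof.
have E : {in fv G, r \o nth 0 [:: x; y; z] =1 nth 0 [:: r x; r y; r z]}.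
  by move=> v /fvG; rewrite !inE => /or3P[] /eqP ->.
by rewrite realizes_ren; split; apply: realizes_fv => v /E.
Qed.

Lemma realizes_B f r x y e :
  realizes f (app B [:: x; y]) r e <-> rB f (r x) (r y) e.
Proof.
have E : {in fv B, r \o nth 0 [:: x; y] =1 nth 0 [:: r x; r y]}.
  by move=> v /fvB; rewrite !inE => /orP[] /eqP ->.
by rewrite realizes_ren; split; apply: realizes_fv => v /E.
Qed.

Lemma graph_code : exists C, forall f q a b c n k l, model f q ->
  std f q a n -> std f q b k -> std f q c l -> kleene n k l ->
  cwp C [:: q; a; b; c] (rG f a b c).
Proof.
have [C CP] := @sigma_code G B G G_sigma.
pose s := tExt (tExt (tExt (tC 0) (tC 0) (tV 1)) (tC 1) (tV 2)) (tC 2) (tV 3).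
exists (tFn C [:: tV 0; s] 4) => f q a b c n k l m Ha Hb Hc /G_graph HG.
apply: (@cwp_term (tFn C [:: tV 0; s]) [:: q; a; b; c]); rewrite /s; ev.
have E : {in fv G, dec (ext (ext (ext 0 0 a) 1 b) 2 c) =1 nth 0 [:: a; b; c]}.
  by move=> v /fvG; rewrite !inE => /or3P[] /eqP ->;
    rewrite !(dec_ext, upd_eq) // /upd /= !(dec_ext, upd_eq) // /upd /= !(dec_ext, upd_eq).
apply: cwp_mono (CP f q _ _ m _ HG) => [e|v vG]; first exact: realizes_fv.
by rewrite E //; move: vG => /fvG; rewrite !inE => /or3P[] /eqP ->.
Qed.

Section Facts.
Variables (f : interp) (q : nat) (m : model f q).

Lemma G_fun x y z1 z2 a b : rG f x y z1 a -> rG f x y z2 b -> exists e, rE f z1 z2 e.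
Proof.
move=> Ha Hb; have [r Hq] := m.
have [C CP] := @axiom_rule G B 25 [:: 0; 1; 9; 10]
  (Imp (And (app G [:: 0; 1; 9]) (app G [:: 0; 1; 10])) (fE 9 10)) isT erefl.
have [e [_ He]] := CP f r q [:: x; y; z1; z2] Hq erefl.
have [|d [_ /realizes_atom Hd]] := He (ppair a b); last by exists d.
by split; rewrite ?pr0K ?pr1K; apply/realizes_G.
Qed.

Definition halts_at_zero y x := exists z, (exists e, rZ f z e) /\ exists e, rG f y x z e.

Lemma realizes_Hf r x y : x <> 2 -> y <> 2 -> 2 = fresh [:: x; y] ->
  (exists e, realizes f (Hf G x y) r e) <-> halts_at_zero (r x) (r y).
Proof.
move=> nx ny e2; rewrite /Hf -e2.
have E e : realizes f (Ex 2 (And (fZ 2) (app G [:: x; y; 2]))) r e <->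
   realizes f (fZ 2) (upd r 2 (pr0 e)) (pr0 (pr1 e)) /\
   realizes f (app G [:: x; y; 2]) (upd r 2 (pr0 e)) (pr1 (pr1 e)) by [].
have ux z : upd r 2 z x = r x by rewrite /upd; case: eqP.
have uy z : upd r 2 z y = r y by rewrite /upd; case: eqP.
split=> [[e]|[z [[a Ha] [b Hb]]]].
  rewrite E realizes_atom realizes_G ux uy => -[Ha Hb].
  by exists (pr0 e); split; eexists; [exact: Ha | exact: Hb].
exists (ppair z (ppair a b)); rewrite E !(pr0K, pr1K) realizes_atom realizes_G ux uy.
by split.
Qed.

(** A27 without its double negation: if the existential formula had no realizer,
every number would realize its negation. *)
Lemma halting_set_coded y z : exists v, forall x, (exists w e, rA f w x z e) ->
  (exists e, rB f v x e) <-> halts_at_zero y x.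
Proof.
have [r Hq] := m.
pose X := Ex 4 (All 0 (Imp (Le 0 2) (Iff (app B [:: 4; 0]) (Hf G 1 0)))).
have [C CP] := @axiom_rule G B 26 [:: 1; 2] (Neg (Neg X)) isT erefl.
have [e [_ He]] := CP f r q [:: y; z] Hq erefl.
set r1 := upds r _ _ in He.
have [v Hv] : exists v, exists e,
    realizes f (All 0 (Imp (Le 0 2) (Iff (app B [:: 4; 0]) (Hf G 1 0)))) (upd r1 4 v) e.
  apply: NNPP => no; have [|d [_ []]] := He 0.
  by move=> a Ha; exfalso; apply: no; exists (pr0 a), (pr1 a).
exists v => x [w [a Ha]].
have [g Hg] := Hv; have [b [_ Hb]] := Hg x; move: Hb; set r2 := upd _ 0 x => Hb.
have [|d [_ [Hd1 Hd2]]] := Hb (ppair w a).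
  by apply/realizes_le => //; rewrite pr0K pr1K.
have EB e' : realizes f (app B [:: 4; 0]) r2 e' <-> rB f v x e' by exact: realizes_B.
have EH : (exists e, realizes f (Hf G 1 0) r2 e) <-> halts_at_zero y x by exact: realizes_Hf.
split=> [[e' /EB H]|/EH[e' H]].
  by apply/EH; have [d' [_ Hd']] := Hd1 _ H; exists d'.
by have [d' [_ /EB Hd']] := Hd2 _ H; exists d'.
Qed.

Lemma std_of_ancestor a i k : std f q (ancestor G B q a i) k -> exists n, std f q a n.
Proof.
elim: i k => [|i IH] k H; first by exists k.
have [[_ /(std_Z m)/IH //]|[_ HS]] := zp_outputP m (ancestor G B q a i).
exact: IH (std_S m HS H).
Qed.

End Facts.

Lemma decB_code : {C | forall f q v x, model f q -> cwp C [:: q; v; x]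
  (fun e => pr0 e = 0 /\ rB f v x (pr1 e) \/ pr0 e = 1 /\ forall a, ~ rB f v x a)}.
Proof.
have [C CP] := @axiom_rule G B 27 [:: 0; 1]
  (Or (app B [:: 0; 1]) (Neg (app B [:: 0; 1]))) isT erefl.
exists C => f q v x [r Hq]; apply: cwp_mono (CP f r q [:: v; x] Hq erefl) => e.
have EB a : realizes f (app B [:: 0; 1]) (upds r [:: 0; 1] [:: v; x]) a <-> rB f v x a.
  exact: realizes_B.
case=> -[-> H]; [left | right]; split=> //; first exact/EB.
by move=> a /EB Ha; have [? []] := H a Ha.
Qed.

Lemma diagonal_code : exists d, forall n z, kleene n n z -> kleene d n z.
Proof.
pose t := tApp (tV 0) (tV 0).
exists (gnum (t 1)) => n z k; exists (t 1); split=> //.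
have [z' [ez <-]] : wp t [:: n] (fun z' => z' = z) by rewrite /t; ev; exists z.
exact: ez.
Qed.

(** The argument of Tennenbaum. If [a] is not standard, its chain of predecessors
never ends, so every numeral is below [a] and A27 gives a code [v] of the set of
the n with {d}(n) = 0. By A28 its characteristic function is recursive, and its
own Goedel number [e0] is where it disagrees with the diagonal. *)
Lemma all_std f q : model f q -> forall a, exists n, std f q a n.
Proof.
move=> m a; apply: NNPP => ns.
have chain i : rS f (ancestor G B q a i.+1) (ancestor G B q a i)
    (pr1 (pr1 (zp_output G B q (ancestor G B q a i)))).
  have [[_ /(std_Z m)/(std_of_ancestor m)/ns //]|[_ HS]] := zp_outputP m (ancestor G B q a i).
  exact: HS.
(* The complement of the n-th numeral in [a] is the n-th ancestor of [a]. *)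
have le n : exists w e, rA f w (nu q n) a e.
  exists (ancestor G B q a n).
  suff H j : j <= n -> exists e, rA f (ancestor G B q a n) (nu q j) (ancestor G B q a (n - j)) e.
    by have := H n (leqnn n); rewrite subnn.
  elim: j => [|j IH] lt.
    have [z [_ Hz]] := svalP (Z_nu G B) f q m.
    have [e [_ He]] := svalP (A_zero G B) f q m (ancestor G B q a n) _ _ Hz.
    by exists e; rewrite subn0.
  have [e He] := IH (ltnW lt); have [s [_ Hs]] := svalP (S_nu G B) f q m j.
  have Hc := chain (n - j.+1); rewrite subnSK // in Hc.
  by have [d [_ Hd]] := svalP (A_succ G B) f q m _ _ _ _ _ _ _ _ Hs He Hc; exists d.
have [d dP] := diagonal_code; have [v Hv] := halting_set_coded m (nu q d) a.
have {}Hv n := Hv _ (le n).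
have [C CP] := graph_code.
pose t := tCase (tFst (call decB_code [:: tV 2; tV 1; num (tV 2) (tV 0)])) (tC 1) (tC 0).
have [e0 [_ He0]] : wp (tLam t) [:: v; q] (fun e0 => forall n,
   ap e0 n (fun z => z = 1 /\ (exists e, rB f v (nu q n) e) \/
                     z = 0 /\ ~ (exists e, rB f v (nu q n) e))).
  apply: wp_lam => e0 He0 n; apply: He0; apply: wp_case; ev; apply: (wp_nu m).
  use (svalP decB_code f q v (nu q n) m) => e; case=> -[-> He]; ev; [left | right].
    by split=> //; exists (pr1 e).
  by split=> // -[e' /He].
have [z [/dP kz Hz]] := He0 e0.
have [e [_ He]] := CP f q _ _ _ _ _ _ m (std_nu m d) (std_nu m e0) (std_nu m z) kz.
case: Hz => -[z1 HB]; rewrite z1 in He.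
  have [y [[b Hb] [c Hc]]] := (Hv e0).1 HB.
  have [g Hg] := G_fun m Hc He.
  by have := std_unique m (std_Z m Hb) (std_Esym m Hg (std_nu m 1)).
apply: HB; apply: (Hv e0).2; exists (nu q 0); split; last by exists e.
by have [b [_ Hb]] := svalP (Z_nu G B) f q m; exists b.
Qed.

(** * Church's thesis for negative premises *)
Lemma E_subst_P : {C | forall f r h x y a b, realizes f EqPR r h ->
  rE f x y a -> atom_realizes f 1 1 [:: x] b -> cwp C [:: h; x; y; a; b] (atom_realizes f 1 1 [:: y])}.
Proof.
pose t := tApp (tApp (tApps (tFst (tV 0)) 1 2) (tV 3)) (tV 4).
exists (t 5) => f r h x y a b [Hh _] Ha Hb.
apply: (@cwp_term t [:: h; x; y; a; b]).
have E := @wp_alls f [:: 0; 1] [:: x; y] r (Imp (fE 0 1) (Imp (fP 0) (fP 1)))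
  [:: h; x; y; a; b] (tFst (tV 0)) 1 erefl.
apply: wp_mono; last first.
  apply: (wp_mp (F := fP 0) (G := fP 1)).
    apply: (wp_mp (F := fE 0 1)); first by apply: E => [[|[]]//|]; ev; exact: Hh.
    by ev; apply/realizes_atom.
  by ev; apply/realizes_atom.
by move=> e /realizes_atom.
Qed.

Lemma E_subst_R : {C | forall f r h x x' y y' a b c, realizes f EqPR r h ->
  rE f x y a -> rE f x' y' b -> atom_realizes f 2 2 [:: x; x'] c ->
  cwp C [:: h; x; x'; y; y'; a; b; c] (atom_realizes f 2 2 [:: y; y'])}.
Proof.
pose t := tApp (tApp (tApps (tSnd (tV 0)) 1 4) (tPair (tV 5) (tV 6))) (tV 7).
exists (t 8) => f r h x x' y y' a b c [_ Hh] Ha Hb Hc.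
apply: (@cwp_term t [:: h; x; x'; y; y'; a; b; c]).
have E := @wp_alls f [:: 5; 6; 7; 8] [:: x; x'; y; y'] r
  (Imp (And (fE 5 7) (fE 6 8)) (Imp (fR 5 6) (fR 7 8)))
  [:: h; x; x'; y; y'; a; b; c] (tSnd (tV 0)) 1 erefl.
apply: wp_mono; last first.
  apply: (wp_mp (F := fR 5 6) (G := fR 7 8)).
    apply: (wp_mp (F := And (fE 5 7) (fE 6 8))).
      by apply: E => [[|[|[|[]]]]//|]; ev; exact: Hh.
    by apply: wp_and; ev; apply/realizes_atom.
  by ev; apply/realizes_atom.
by move=> e /realizes_atom.
Qed.

Lemma realizes_and f F F' r e : realizes f (And F F') r e <->
  realizes f F r (pr0 e) /\ realizes f F' r (pr1 e).
Proof. by []. Qed.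

Lemma uniformly_realizedI F t : (forall f r, wp t [::] (realizes f F r)) -> uniformly_realized F.
Proof.
move=> H; have [e [ev0 _]] := H (fun _ _ => None) (fun=> 0).
by exists e => f r; have [e' [ev' Re]] := H f r; rewrite (eval_fun ev0 ev').
Qed.

(** On an element [x] of index [n] such that P(x) has no realizer, the premise
provides a value at the [n]-th numeral rather than at [x]: this makes the value
depend on [n] only, and R is moved back from the numeral to [x] by the equality
axiom. A realizer of not P(x) carries no information, so 0 serves as one. *)
Lemma nCTstar_realized : uniformly_realized (nCTstar G B).
Proof.
have [C CP] := graph_code.
(* The function that maps [n] to the index of the value at the [n]-th numeral;
   its environment is the realizer of the premise and that of Q and EqPR. *)
pose fn := tLam (idx (tFst (tV 2))
  (tFst (tApp (tApp (tV 1) (num (tFst (tV 2)) (tV 0))) (tC 0)))).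
(* Environment: a realizer of not P(x), the element x, the Goedel number of
   [fn], and the environment of [fn]. *)
pose body :=
  let q := tFst (tV 4) in let n := idx q (tV 1) in
  let v := tApp (tApp (tV 3) (num q n)) (tC 0) in let y := tFst v in
  tPair y (tPair (tFn C [:: q; num q (tV 2); tV 1; y])
    (call E_subst_R [:: tSnd (tV 4); num q n; y; tV 1; y;
        call (std_sym_code G B) [:: q; tV 1; n]; call (E_refl G B) [:: q; y]; tSnd v])).
(* [fn] is passed as an argument, so that the numeral exhibited and the
   realizers of G refer to the same Goedel number. *)
pose t := tApp (tLam (tPair (num (tFst (tV 2)) (tV 0)) (tLam (tLam body)))) fn.
apply: (@uniformly_realizedI _ (tLam (tLam t))) => f r.
apply: wp_imp => h /realizes_and[Hq Heq]; set q := pr0 h in Hq *.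
have m : model f q by exists r.
apply: wp_imp => a Ha.
pose noP x := forall e, ~ atom_realizes f 1 1 [:: x] e.
have val_ex n : noP (nu q n) -> exists b w,
    [/\ kleene a (nu q n) b, kleene b 0 w & atom_realizes f 2 2 [:: nu q n; pr0 w] (pr1 w)].
  move=> np; have [b [kb Hb]] := Ha (nu q n).
  have [|w [kw Hw]] := Hb 0; first by move=> e /realizes_atom /np.
  by exists b, w; split=> //; move: Hw => /realizes_atom.
apply: wp_app; apply: wp_lam => g Hg; apply: wp_lam => k Hk; apply: Hg => {g}.
apply: wp_ex; ev; apply: (wp_nu m).
apply: wp_all => x; apply: wp_imp => p Hp; ev.
have [n Hn] := all_std m x.
have npx : noP x by move=> e He; have [|d [_ []]] := Hp e; apply/realizes_atom.
have np : noP (nu q n).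
  move=> e He; have [d [_ Hd]] := svalP (std_sym_code G B) f q x n m Hn.
  have [d' [_ Hd']] := svalP E_subst_P f r _ _ _ _ _ Heq Hd He.
  exact: npx Hd'.
have [b [w [kb kw HR]]] := val_ex n np.
have [l Hl] := all_std m (pr0 w).
have I c j P Pj := svalP (idx_code G B) f q c j P m Pj.
have knl : kleene k n l.
  have [z [kz <-]] : ap k n (fun z => z = l).
    apply: Hk; ev; apply: (wp_nu m); exists b; split=> //; ev; exists w; split=> //.
    exact: I Hl _.
  exact: kz.
rewrite /body; apply: wp_ex; ev.
apply: (I _ _ _ Hn); ev; apply: (wp_nu m); exists b; split=> //; ev; exists w; split=> //.
apply: wp_and; ev.
  apply: (wp_nu m); ev; apply: (I _ _ _ Hn); ev; apply: (wp_nu m).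
  exists b; split=> //; ev; exists w; split=> //.
  use (CP f q _ _ _ _ _ _ m (std_nu m k) Hn Hl knl) => e He; exact/realizes_G.
apply: (I _ _ _ Hn); ev; apply: (wp_nu m); ev.
apply: (I _ _ _ Hn); ev; apply: (wp_nu m); exists b; split=> //; ev; exists w; split=> //; ev.
apply: (I _ _ _ Hn); ev; apply: (wp_nu m); exists b; split=> //; ev; exists w; split=> //; ev.
apply: (I _ _ _ Hn); use (svalP (std_sym_code G B) f q x n m Hn) => d Hd; ev.
apply: (I _ _ _ Hn); ev; apply: (wp_nu m); exists b; split=> //; ev; exists w; split=> //; ev.
use (svalP (E_refl G B) f q m (pr0 w)) => d' Hd'; ev.
apply: (I _ _ _ Hn); ev; apply: (wp_nu m); exists b; split=> //; ev; exists w; split=> //; ev.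
use (svalP E_subst_R f r _ _ _ _ _ _ _ _ Heq Hd Hd' HR) => e He.
by apply/realizes_atom.
Qed.

End Church.

(** * Soundness of MQC *)
Lemma fv_ren s F : {subset fv (ren s F) <= [seq s y | y <- fv F]}.
Proof.
have Q x s' G : {subset fv (ren (upd s' x (bvar s' x G)) G) <=
      [seq upd s' x (bvar s' x G) y | y <- fv G]} ->
    {subset [seq y <- fv (ren (upd s' x (bvar s' x G)) G) | y != bvar s' x G] <=
      [seq s' y | y <- [seq y <- fv G | y != x]]}.
  move=> IH y; rewrite mem_filter => /andP[ny /IH/mapP[z zG ey]].
  move: ey ny; rewrite /upd; case: eqP => [_ ->|/eqP nz -> _]; first by rewrite eqxx.
  by apply: map_f; rewrite mem_filter nz.
elim: F s => [|n i v|F IHF G IHG|F IHF G IHG|F IHF G IHG|F IHF|x F IHF|x F IHF] s //=.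
1-3: move=> y; rewrite map_cat !mem_cat => /orP[/IHF ->|/IHG ->]; rewrite ?orbT //.
1-2: exact: Q (IHF _).
Qed.

Lemma fv_B_formula L R Ls : projections_formulas L R Ls ->
  {subset fv (B_formula R Ls) <= [:: 0; 1]}.
Proof.
case=> _ [_ fvR _ _] [_ fvLs _ _] _ _ y.
rewrite /B_formula /= !mem_filter !mem_cat => /and4P[n11 n12 n2].
move=> /or3P[/fv_ren/mapP[z /fvLs + ey]|/fv_ren/mapP[z /fvR + ey]|].
- by move: n11; rewrite ey !inE => + /or3P[] /eqP ez; rewrite ez.
- by move: n11 n12; rewrite ey !inE => + + /orP[] /eqP ez; rewrite ez.
by rewrite !inE (negPf n2) (negPf n12).
Qed.

Theorem theorem5p2 (G L R Ls : form)
    (hG : graph_formula G) (hB : projections_formulas L R Ls)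
    (F : form) (F_closed : closed_form F) (F_ded : MQC G (B_formula R Ls) F) :
  absolutely_realizable F.
Proof.
have [G_sigma fvG G_graph _] := hG.
have fvB := fv_B_formula hB.
have [|e He] := @sound_closed F F_closed; last by exists e => f r _.
apply: iqc_sound F_ded => F' [].
  exact/sound_instance/markov_realized.
by apply/sound_instance/nCTstar_realized.
Qed.
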